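(* Suppose that Assumption 1 holds and that Assumption 2 holds for some $\alpha\in(0,1]$. Let $\alpha'\in(0,1]$, $\theta_0\in\mathbb{R}^d$, $J\in\mathbb{N}$, $(\kappa,\tau)\in(0,\infty)^2$, $\beta\in(0,1)$ and $\delta\in\big(2\alpha'/(1+3\alpha'),1\big)$. For every $B\in\mathbb{N}$ let $\hat\theta_{J,B}$ be the output of the procedure $\mathrm{MULTI}(\theta_0,B,\alpha',\delta,J,\kappa,\tau,\beta)$ defined in the context. Then, as $B\to\infty$, $\|\hat\theta_{J,B}-\theta_\star\|=o_{\mathbb{P}}(1)$. If, moreover, Assumption 2 holds for $\alpha=\alpha'$, then $$\|\hat\theta_{J,B}-\theta_\star\|=O_{\mathbb{P}}\Big(B^{-\frac{\alpha'}{1+\alpha'}(1-\delta^J)}\Big).$$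
   Context: Setting. $\mathbb{N}=\{1,2,\dots\}$, $\mathbb{N}_0=\mathbb{N}\cup\{0\}$, $d\ge1$. All random variables are defined on a complete probability space $(\Omega,\mathcal{F},\mathbb{P})$. $Z$ is a random variable with values in a Polish space $\mathsf{Z}$, and $(Z_i)_{i\ge1}$ are i.i.d. copies of $Z$. The function $f:\mathbb{R}^d\times\mathsf{Z}\to\mathbb{R}$ is measurable and differentiable in its first argument; $\nabla^k f(\theta,z)$ denotes the $k$-th derivative in $\theta$ ($\nabla^0f=f$). $F(\theta)=\mathbb{E}[f(\theta,Z)]$ is finite for all $\theta$, strictly convex on $\mathbb{R}^d$, and has a (unique) minimizer $\theta_\star=\arg\min_{\theta\in\mathbb{R}^d}F(\theta)$. For $n\in\mathbb{N}$, $F_n(\theta)=\frac1n\sum_{i=1}^n f(\theta,Z_i)$. $\|\cdot\|$ is the Euclidean norm for vectors and the induced operator norm for matrices. No convexity of $\theta\mapsto f(\theta,Z)$ is assumed. Assumption 1. For every compact set $\Theta\subset\mathbb{R}^d$ there is a constant $c_\Theta>0$ such that $F(a\theta_1+(1-a)\theta_2)\le aF(\theta_1)+(1-a)F(\theta_2)-\frac{c_\Theta}{2}a(1-a)\|\theta_1-\theta_2\|^2$ for all $a\in[0,1]$ and $(\theta_1,\theta_2)\in\Theta^2$. Assumption 2 (with exponent $\alpha\in(0,1]$). The map $\theta\mapsto f(\theta,z)$ is twice continuously differentiable on $\mathbb{R}^d$ for all $z\in\mathsf{Z}$; $\mathbb{E}[\|\nabla^2 f(\theta_\star,Z)\|]<\infty$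 and $\mathbb{E}[\|\nabla f(\theta_\star,Z)\|^{1+\alpha}]<\infty$; and for every compact $\Theta\subset\mathbb{R}^d$ there is a measurable $M_\Theta:\mathsf{Z}\to[0,\infty)$ with $\mathbb{E}[M_\Theta(Z)]<\infty$ such that, $\mathbb{P}$-a.s., $\|\nabla^2 f(\theta,Z)-\nabla^2 f(\theta',Z)\|\le M_\Theta(Z)\|\theta-\theta'\|$ for all $(\theta,\theta')\in\Theta^2$. For real random variables $X_B$ and $a_B>0$: $X_B=o_{\mathbb{P}}(1)$ means $X_B\to0$ in probability; $X_B=O_{\mathbb{P}}(a_B)$ means that for every $\epsilon\in(0,1)$ there is a finite $M_\epsilon$ with $\limsup_{B\to\infty}\mathbb{P}(|X_B/a_B|\ge M_\epsilon)\le\epsilon$. Costs. $C_{\mathrm{grad}},C_{\mathrm{eval}}\in\mathbb{N}$ are fixed constants: the costs of computing $\nabla f(\theta,z)$, respectively $f(\theta,z)$, at one pair $(\theta,z)$. Procedure $\mathrm{GD}(\theta_0,n,B,\tau,\beta)$ (gradient descent with backtracking line search), with $\theta_0\in\mathbb{R}^d$, sample size $n$, budget $B$, tolerance $\tau\ge0$, $\beta\in(0,1)$: 1. Set $t=0$, $\theta_{B,0}=\theta_0$, $\tilde B=B$. 2. If $\tilde B\ge nC_{\mathrm{grad}}$: set $G_0=\nabla F_n(\theta_{B,0})$ and $\tilde B\leftarrow\tilde B-nC_{\mathrm{grad}}$. Then, if $\tilde B\ge nC_{\mathrm{eval}}$: set $g_0=F_n(\theta_{B,0})$ and $\tilde B\leftarrow\tilde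 B-nC_{\mathrm{eval}}$. 3. While $\|G_t\|>\tau$ and $\tilde B\ge nC_{\mathrm{eval}}$: (a) set $g_t'=F_n(\theta_{B,t}-G_t)$, $v_{t+1}=1$, $\tilde B\leftarrow\tilde B-nC_{\mathrm{eval}}$; (b) while $g_t'>g_t-\frac{v_{t+1}}2\|G_t\|^2$ and $\tilde B\ge nC_{\mathrm{eval}}$: $v_{t+1}\leftarrow\beta v_{t+1}$, $g_t'\leftarrow F_n(\theta_{B,t}-v_{t+1}G_t)$, $\tilde B\leftarrow\tilde B-nC_{\mathrm{eval}}$; (c) if $g_t'\le g_t-\frac{v_{t+1}}2\|G_t\|^2$: set $\theta_{B,t+1}=\theta_{B,t}-v_{t+1}G_t$, $g_{t+1}=g_t'$, $t\leftarrow t+1$; then, if $\tilde B\ge nC_{\mathrm{grad}}$, set $G_t=\nabla F_n(\theta_{B,t})$ and $\tilde B\leftarrow\tilde B-nC_{\mathrm{grad}}$, otherwise leave the loop of step 3. 4. Return $(\theta_{B,t},\max(\tilde B,0))$. If $G_0$ was not computed in step 2, the loop of step 3 is not entered. Procedure $\mathrm{MULTI}(\theta_0,B,\alpha',\delta,J,\kappa,\tau,\beta)$: set $j=0$, $B_0=B$, $\hat\theta_{0,B}=\theta_0$. While $B_j>0$ and $j<J$: set $j\leftarrow j+1$, $\gamma_j=1-\delta^j$ and $$(\hat\theta_{j,B},B_j)=\mathrm{GD}\Big(\hat\theta_{j-1,B},\lceil\kappa B^{\gamma_j}\rceil,B_{j-1},\tau B^{-\frac{\alpha'}{1+\alpha'}\gamma_j},\beta\Big).$$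 Return the last computed $\hat\theta_{j,B}$. This returned value is denoted $\hat\theta_{J,B}$, even if fewer than $J$ passes of the loop were made. *)

(* Defs.v *)
From HB Require Import structures.
From mathcomp Require Import all_boot all_order all_algebra.
From mathcomp Require Import all_classical all_reals all_analysis.

Set Implicit Arguments.
Unset Strict Implicit.
Unset Printing Implicit Defensive.

Import Order.TTheory GRing.Theory Num.Theory.
Import numFieldNormedType.Exports.

Local Open Scope classical_set_scope.
Local Open Scope ring_scope.

(* The norm that the library puts on 'rV[R]_d is the sup norm; it is used only
   through the topology (compactness, differentiability, continuity, Borel
   sets), which is the Euclidean one.  Every norm written in the definitions
   below is [enorm] or [opnorm]. *)

Definition enorm (R : realType) (d : nat) (v : 'rV[R]_d) : R :=
  Num.sqrt (\sum_(i < d) v ord0 i ^+ 2).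

Definition opnorm (R : realType) (d : nat) (A : 'M[R]_d) : R :=
  sup [set enorm (v *m A) | v in [set v : 'rV[R]_d | enorm v <= 1]].

Definition grad (R : realType) (d : nat) (h : 'rV[R]_d -> R) (x : 'rV[R]_d) :
  'rV[R]_d := \row_i 'D_(delta_mx ord0 i) h x.

(* The library's Jacobian acts on row vectors from the right, as does the
   matrix in [opnorm]. *)
Definition hess (R : realType) (d : nat) (h : 'rV[R]_d -> R) (x : 'rV[R]_d) :
  'M[R]_d := jacobian (grad h) x.

Definition borel (X : ptopologicalType) := g_sigma_algebraType (@open X).

Definition polish (R : realType) (X : topologicalType) : Prop :=
  (exists2 D : set X, countable D & dense D) /\
  exists dist : X -> X -> R,
  [/\ (forall x y, dist x y = 0 <-> x = y),
      (forall x y, dist x y = dist y x),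
      (forall x y z, dist x z <= dist x y + dist y z),
      (forall x (A : set X), nbhs x A <->
         exists2 e : R, 0 < e & [set y | dist x y < e] `<=` A) &
      (forall u : nat -> X,
         (forall e : R, 0 < e -> exists N : nat, forall m n : nat,
            (N <= m)%N -> (N <= n)%N -> dist (u m) (u n) < e) ->
         exists l : X, u @ \oo --> l)].

Section random_variables.
Context (disp disp' : measure_display) (T : measurableType disp)
  (E : measurableType disp') (R : realType) (P : probability T R).

Definition mutually_independent (Y : nat -> T -> E) : Prop :=
  forall (s : seq nat) (A : nat -> set E), uniq s ->
  (forall i, measurable (A i)) ->
  P (\bigcap_(i in [set` s]) (Y i @^-1` A i)) =
  (\prod_(i <- s) P (Y i @^-1` A i))%E.

Definition iid_copies (Y0 : T -> E) (Y : nat -> T -> E) : Prop :=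
  mutually_independent Y /\
  forall i (A : set E), measurable A -> P (Y i @^-1` A) = P (Y0 @^-1` A).

Definition is_oP1 (X : nat -> T -> R) : Prop :=
  forall e : R, 0 < e ->
  (fun B : nat => P [set w | e <= `|X B w|]) @ \oo --> 0%E.

Definition is_OP (X : nat -> T -> R) (a : nat -> R) : Prop :=
  forall e : R, 0 < e < 1 -> exists M : R,
  (limn_esup (fun B : nat => P [set w | (M <= `|X B w / a B|)%R]) <= e%:E)%E.

End random_variables.

Section objective.
Context (disp disp' : measure_display) (T : measurableType disp)
  (E : measurableType disp') (R : realType) (P : probability T R) (d : nat).

Definition risk (f : 'rV[R]_d -> E -> R) (Z : T -> E) (x : 'rV[R]_d) : R :=
  fine 'E_P[fun w => f x (Z w)].

(* z i is the (i+1)-st observation. *)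
Definition emp_risk (f : 'rV[R]_d -> E -> R) (z : nat -> E) (n : nat)
    (x : 'rV[R]_d) : R :=
  n%:R^-1 * \sum_(i < n) f x (z i).

Definition strictly_convex (F : 'rV[R]_d -> R) : Prop :=
  forall (x y : 'rV[R]_d) (a : R), x != y -> 0 < a < 1 ->
  F (a *: x + (1 - a) *: y) < a * F x + (1 - a) * F y.

Definition locally_strongly_convex (F : 'rV[R]_d -> R) : Prop :=
  forall K : set 'rV[R]_d, compact K -> exists2 c : R, 0 < c &
  forall (a : R) (x y : 'rV[R]_d), 0 <= a <= 1 -> K x -> K y ->
  F (a *: x + (1 - a) *: y) <=
    a * F x + (1 - a) * F y - c / 2 * a * (1 - a) * enorm (x - y) ^+ 2.

Definition smooth_moments (f : 'rV[R]_d -> E -> R) (Z : T -> E)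
    (xstar : 'rV[R]_d) (alpha : R) : Prop :=
  [/\ (forall z : E,
         [/\ (forall x, differentiable (f^~ z) x),
             (forall x, differentiable (grad (f^~ z)) x) &
             continuous (hess (f^~ z))]),
      ('E_P[fun w => opnorm (hess (f^~ (Z w)) xstar)] < +oo)%E,
      ('E_P[fun w => (enorm (grad (f^~ (Z w)) xstar) `^ (1 + alpha))%R]
         < +oo)%E &
      forall K : set 'rV[R]_d, compact K -> exists M : E -> R,
      [/\ measurable_fun setT M, (forall z, 0 <= M z),
          ('E_P[fun w => M (Z w)] < +oo)%E &
          {ae P, forall w, forall x y : 'rV[R]_d, K x -> K y ->
             opnorm (hess (f^~ (Z w)) x - hess (f^~ (Z w)) y) <=
             M (Z w) * enorm (x - y)}]].

End objective.

Section while.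
Context (S : Type) (m : S -> nat) (c : S -> bool) (body : S -> S).

Fixpoint while_fuel (k : nat) (s : S) : S :=
  if k is k'.+1 then if c s then while_fuel k' (body s) else s else s.

(* The loop "while c do body".  As soon as each pass decreases m, the fuel m s
   is never exhausted: see [whileE]. *)
Definition while (s : S) : S := while_fuel (m s) s.

Hypothesis body_lt : forall s, c s -> (m (body s) < m s)%N.

Lemma while_fuelE k s : (m s <= k)%N -> while_fuel k s = while s.
Proof.
rewrite /while; elim: k {-2}k (leqnn k) s => [|N IH] k.
  by rewrite leqn0 => /eqP -> s; rewrite leqn0 => /eqP ->.
case: k => [|k] kN s; first by rewrite leqn0 => /eqP ->.
move=> msk /=; case: (boolP (c s)) => cs; last first.
  by case: (m s) => //= ?; rewrite (negbTE cs).
have lt := body_lt cs.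
case E : (m s) lt => [|j] //= lt; rewrite cs.
rewrite (IH k) //; last by rewrite -ltnS (leq_trans lt)// -E.
rewrite (IH j) //; by rewrite -ltnS -E (leq_trans msk).
Qed.

Lemma whileE s : while s = if c s then while (body s) else s.
Proof.
rewrite -(@while_fuelE (m s).+1) //=; case: ifP => // cs.
by rewrite while_fuelE // ltnW // body_lt.
Qed.

End while.

Section gradient_descent.
Context (R : realType) (d : nat).
(* Costs of one evaluation of the gradient and of the value of f, at one
   parameter and one observation. *)
Variables (Cgrad Ceval : nat).

Section one_call.
(* Fn is the empirical objective of sample size n. *)
Variables (Fn : 'rV[R]_d -> R) (n : nat) (tau beta : R).

Section line_search.
Variables (x G : 'rV[R]_d) (g : R).

Record ls_state := LsState { ls_v : R; ls_g : R; ls_budget : nat }.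

Definition armijo (s : ls_state) : bool :=
  ls_g s <= g - ls_v s / 2 * enorm G ^+ 2.

Definition ls_guard (s : ls_state) : bool :=
  ~~ armijo s && (n * Ceval <= ls_budget s)%N.

Definition ls_body (s : ls_state) : ls_state :=
  let v := beta * ls_v s in
  LsState v (Fn (x - v *: G)) (ls_budget s - n * Ceval).

Definition line_search (b : nat) : ls_state :=
  while ls_budget ls_guard ls_body
    (LsState 1 (Fn (x - G)) (b - n * Ceval)).

End line_search.

(* Budgets are natural numbers: every subtraction is guarded, so none is
   truncated and the remaining budget is never negative.
   gd_G s = None means that the gradient at gd_x s has not been computed for
   lack of budget, in which case the main loop is left (or not entered). *)
Record gd_state := GdState {
  gd_x : 'rV[R]_d; gd_G : option 'rV[R]_d; gd_g : R; gd_budget : nat }.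

Definition gd_guard (s : gd_state) : bool :=
  if gd_G s is Some G then (tau < enorm G) && (n * Ceval <= gd_budget s)%N
  else false.

Definition gd_body (s : gd_state) : gd_state :=
  if gd_G s is Some G then
    let r := line_search (gd_x s) G (gd_g s) (gd_budget s) in
    if armijo G (gd_g s) r then
      let x := gd_x s - ls_v r *: G in
      if (n * Cgrad <= ls_budget r)%N
      then GdState x (Some (grad Fn x)) (ls_g r) (ls_budget r - n * Cgrad)
      else GdState x None (ls_g r) (ls_budget r)
    else GdState (gd_x s) (gd_G s) (gd_g s) (ls_budget r)
  else s.

(* When the value at x0 cannot be afforded, gd_g is set to 0; it is then never
   read, because gd_guard fails. *)
Definition gd_init (x0 : 'rV[R]_d) (B : nat) : gd_state :=
  let: (G0, B1) := if (n * Cgrad <= B)%N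
    then (Some (grad Fn x0), (B - n * Cgrad)%N) else (None, B) in
  let: (g0, B2) := if (n * Ceval <= B1)%N
    then (Fn x0, (B1 - n * Ceval)%N) else (0, B1) in
  GdState x0 G0 g0 B2.

Definition gd (x0 : 'rV[R]_d) (B : nat) : 'rV[R]_d * nat :=
  let s := while gd_budget gd_guard gd_body (gd_init x0 B) in
  (gd_x s, gd_budget s).

Lemma ls_body_lt x G g (s : ls_state) : (0 < n * Ceval)%N ->
  ls_guard G g s -> (ls_budget (ls_body x G s) < ls_budget s)%N.
Proof.
move=> c0 /andP[_ cs] /=.
by rewrite ltn_subrL c0 (leq_trans c0 cs).
Qed.

Lemma line_search_le x G g b : (ls_budget (line_search x G g b) <= b - n * Ceval)%N.
Proof.
have le k t : (ls_budget (while_fuel (ls_guard G g) (ls_body x G) k t) <=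
    ls_budget t)%N.
  elim: k t => //= k IH t; case: ifP => // _.
  by apply: (leq_trans (IH _)) => /=; rewrite leq_subr.
exact: le.
Qed.

Lemma gd_body_lt (s : gd_state) : (0 < n * Ceval)%N ->
  gd_guard s -> (gd_budget (gd_body s) < gd_budget s)%N.
Proof.
move=> c0; rewrite /gd_guard /gd_body; case: (gd_G s) => [G|//] /andP[_ cs].
have lt : (ls_budget (line_search (gd_x s) G (gd_g s) (gd_budget s)) <
    gd_budget s)%N.
  by rewrite (leq_ltn_trans (line_search_le _ _ _ _)) // ltn_subrL c0 (leq_trans c0).
case: ifP => //= _; case: ifP => //= _.
by rewrite (leq_ltn_trans (leq_subr _ _)).
Qed.

End one_call.

Definition stage_exponent (delta : R) (j : nat) : R := 1 - delta ^+ j.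

Definition stage_size (kappa delta : R) (B j : nat) : nat :=
  `|Num.ceil (kappa * B%:R `^ stage_exponent delta j)|%N.

Definition stage_tolerance (tau alpha' delta : R) (B j : nat) : R :=
  tau * B%:R `^ (- (alpha' / (1 + alpha')) * stage_exponent delta j).

(* The iterate and the remaining budget after at most j passes.  A pass with no
   budget left is skipped, which is the same as leaving the loop. *)
Fixpoint multi_state (F : nat -> 'rV[R]_d -> R) (x0 : 'rV[R]_d) (B : nat)
    (alpha' delta kappa tau beta : R) (j : nat) : 'rV[R]_d * nat :=
  if j is i.+1 then
    let: (x, b) := multi_state F x0 B alpha' delta kappa tau beta i in
    if (0 < b)%N then
      let n := stage_size kappa delta B j in
      gd (F n) n (stage_tolerance tau alpha' delta B j) beta x b
    else (x, b)
  else (x0, B).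

Definition multi (F : nat -> 'rV[R]_d -> R) (x0 : 'rV[R]_d) (B : nat)
    (alpha' delta : R) (J : nat) (kappa tau beta : R) : 'rV[R]_d :=
  (multi_state F x0 B alpha' delta kappa tau beta J).1.

End gradient_descent.

(* Main.v *)
From HB Require Import structures.
Require Import Defs.
From mathcomp Require Import all_boot all_order all_algebra.
From mathcomp Require Import all_classical all_reals all_analysis.
From mathcomp Require Import measurable_realfun.
From mathcomp Require Import ring lra zify.

(** Why the theorem holds.

    The procedure is a deterministic algorithm run on empirical risks, so the
    proof separates what a single sample must satisfy from the probability that
    it does.

    Deterministic part.  Suppose that a function h, here an empirical risk, has
    its Hessian between m and L on a ball around the target c, and a small
    gradient at c.  Then h need not be convex globally, but it grows linearly
    away from c inside the ball ([curved_growth]), so that the part of its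
    sublevel sets that a step can reach stays near c.  Backtracking therefore
    stops after a bounded number K of trials with a step of at least beta^K, the
    optimality gap contracts geometrically ([gd_loop]), and the tolerance tau_j
    of stage j, a negative power of B, is reached within O(ln B) passes.  All
    stages together cost O(n_J ln B) evaluations, and n_J is of the order of
    B^(1 - delta^J), so the budget B is never exhausted ([enough_budget]).
    Strong monotonicity of the gradient then yields
    m |thetahat - c| <= tau_J + |grad F_(n_J)(c)|     ([good_multi]).

    Probabilistic part.  Second differences of the risk show that the expected
    Hessian is bounded below by the modulus of strong convexity and that the
    expected gradient vanishes at the minimizer ([mean_hess_ge],
    [mean_grad_eq0]); nothing is differentiated under the expectation.  The law
    of large numbers on a finite net, extended by the integrable Lipschitz bound
    for the Hessian, gives the curvature hypothesis with probability tending to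
    1 on every ball ([whp_curved]).  Consistency then follows from the law of
    large numbers for the gradient at c, and the rate from the truncation
    inequality of Marcinkiewicz-Zygmund type [copies_moment_bound]:
    |grad F_n(c)| is of the order of n^(-alpha/(1+alpha)) when the gradient has
    a moment of order 1 + alpha, and with alpha = alpha' this is also the order
    of tau_J.

    Since the statement speaks of the probability of events about the output,
    the output must be a random variable; loops are measurable because they are
    glued from their truncations to a fixed number of passes
    ([measurable_multi]). *)

Set Implicit Arguments.
Unset Strict Implicit.
Unset Printing Implicit Defensive.

Import Order.TTheory GRing.Theory Num.Theory.
Import numFieldNormedType.Exports.

Local Open Scope classical_set_scope.
Local Open Scope ring_scope.


(** * The Euclidean inner product *)

Section euclidean.
Context {R : realType} {d : nat}.
Implicit Types (u v w x y : 'rV[R]_d) (a : R).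

Definition dot u v : R := \sum_(i < d) u ord0 i * v ord0 i.

Lemma dotC u v : dot u v = dot v u.
Proof. by apply: eq_bigr => i _; rewrite mulrC. Qed.

Lemma dotDl u v w : dot (u + v) w = dot u w + dot v w.
Proof. by rewrite -big_split; apply: eq_bigr => i _; rewrite mxE mulrDl. Qed.

Lemma dotDr u v w : dot w (u + v) = dot w u + dot w v.
Proof. by rewrite dotC dotDl !(dotC w). Qed.

Lemma dotZl a u v : dot (a *: u) v = a * dot u v.
Proof. by rewrite mulr_sumr; apply: eq_bigr => i _; rewrite mxE mulrA. Qed.

Lemma dotZr a u v : dot u (a *: v) = a * dot u v.
Proof. by rewrite dotC dotZl dotC. Qed.

Lemma dot0l v : dot 0 v = 0.
Proof. by rewrite -(scale0r v) dotZl mul0r. Qed.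

Lemma dotNl u v : dot (- u) v = - dot u v.
Proof. by rewrite -scaleN1r dotZl mulN1r. Qed.

Lemma dotNr u v : dot u (- v) = - dot u v.
Proof. by rewrite dotC dotNl dotC. Qed.

Definition dotE := (dotDl, dotDr, dotNl, dotNr, dotZl, dotZr).

Lemma dotvv_ge0 v : 0 <= dot v v.
Proof. by apply: sumr_ge0 => i _; rewrite -expr2 sqr_ge0. Qed.

Lemma enorm_ge0 v : 0 <= enorm v. Proof. exact: sqrtr_ge0. Qed.

Lemma enorm_sq v : enorm v ^+ 2 = dot v v.
Proof.
rewrite sqr_sqrtr; last by apply: sumr_ge0 => i _; exact: sqr_ge0.
by apply: eq_bigr => i _; rewrite expr2.
Qed.

Lemma enorm_eq0 v : enorm v = 0 -> v = 0.
Proof.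
move=> v0; have := enorm_sq v; rewrite v0 expr0n /= => /esym/eqP.
rewrite psumr_eq0 => [/allP h|i _]; last by rewrite -expr2 sqr_ge0.
apply/rowP => i; rewrite mxE; have := h i (mem_index_enum _).
by rewrite mulf_eq0 orbb => /eqP.
Qed.

Lemma enormZ a v : enorm (a *: v) = `|a| * enorm v.
Proof.
apply/eqP; rewrite -(@eqrXn2 _ 2) ?mulr_ge0 ?enorm_ge0 //.
by rewrite exprMn !enorm_sq real_normK ?num_real // !dotE expr2 mulrA.
Qed.

Lemma enormN v : enorm (- v) = enorm v.
Proof. by rewrite -scaleN1r enormZ normrN1 mul1r. Qed.

Lemma enorm0 : enorm (0 : 'rV[R]_d) = 0.
Proof. by rewrite -[0 in LHS](scale0r 0) enormZ normr0 mul0r. Qed.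

Lemma dot_le u v : dot u v <= enorm u * enorm v.
Proof.
have [v0|v0] := eqVneq (enorm v) 0.
  by rewrite v0 mulr0 (enorm_eq0 v0) dotC dot0l.
have vp : 0 < enorm v by rewrite lt_neqAle eq_sym v0 enorm_ge0.
have := dotvv_ge0 (enorm v *: u - enorm u *: v).
rewrite !dotE -!enorm_sq (dotC v u).
have [/enorm_eq0 -> |u0] := eqVneq (enorm u) 0.
  by move=> _; rewrite enorm0 mul0r dot0l lexx.
have up : 0 < enorm u by rewrite lt_neqAle eq_sym u0 enorm_ge0.
move=> h; have : 0 <= (enorm u * enorm v) * (2 * (enorm u * enorm v - dot u v)).
  apply: (le_trans h); nra.
by rewrite pmulr_rge0 ?mulr_gt0 // pmulr_rge0 // subr_ge0.
Qed.

Lemma ler_enormD u v : enorm (u + v) <= enorm u + enorm v.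
Proof.
rewrite -ler_sqr ?nnegrE ?addr_ge0 ?enorm_ge0 // enorm_sq !dotE -!enorm_sq (dotC v).
have := dot_le u v; nra.
Qed.

Lemma enormBC u v : enorm (u - v) = enorm (v - u).
Proof. by rewrite -enormN opprB. Qed.

Lemma enorm_coord v i : `|v ord0 i| <= enorm v.
Proof.
rewrite -ler_sqr ?nnegrE ?enorm_ge0 // enorm_sq real_normK ?num_real //.
rewrite /dot (bigD1 i) //= expr2 lerDl.
by apply: sumr_ge0 => j _; rewrite -expr2 sqr_ge0.
Qed.

Lemma enorm_le_sum v : enorm v <= \sum_(i < d) `|v ord0 i|.
Proof.
rewrite -ler_sqr ?nnegrE ?enorm_ge0 ?sumr_ge0 // enorm_sq expr2 mulr_suml.
apply: ler_sum => i _; apply: (le_trans (ler_norm _)); rewrite normrM.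
by apply: ler_wpM2l => //; rewrite (bigD1 i) //= lerDl sumr_ge0.
Qed.

Lemma enorm_convex (a r : R) (c x y : 'rV[R]_d) : 0 <= a <= 1 ->
  enorm (x - c) <= r -> enorm (y - c) <= r ->
  enorm (x + a *: (y - x) - c) <= r.
Proof.
move=> /andP[a0 a1] xr yr.
have -> : x + a *: (y - x) - c = (1 - a) *: (x - c) + a *: (y - c).
  by apply/rowP => i; rewrite !mxE; ring.
apply: (le_trans (ler_enormD _ _)); rewrite !enormZ ger0_norm ?subr_ge0 //.
rewrite ger0_norm //; nra.
Qed.

End euclidean.

(** * Gradient descent on a function of controlled curvature *)

(** [curved c r m L h] is the first-order form of
    m * I <= hess h <= L * I on the ball of centre c and radius r. *)
Definition curved {R : realType} {d : nat} (c : 'rV[R]_d) (r m L : R)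
    (h : 'rV[R]_d -> R) : Prop :=
  forall x y, enorm (x - c) <= r -> enorm (y - c) <= r ->
  m / 2 * enorm (y - x) ^+ 2 <= h y - h x - dot (grad h x) (y - x)
    <= L / 2 * enorm (y - x) ^+ 2.

Section curved_function.
Context {R : realType} {d : nat}.
Variables (c : 'rV[R]_d) (h : 'rV[R]_d -> R).
Implicit Types (x y : 'rV[R]_d) (r m L : R).

(** The Polyak-Lojasiewicz inequality. *)
Lemma curved_gap r m L x y : 0 < m -> curved c r m L h ->
  enorm (x - c) <= r -> enorm (y - c) <= r ->
  h x - h y <= enorm (grad h x) ^+ 2 / (2 * m).
Proof.
move=> m0 hc xr yr; have /andP[+ _] := hc _ _ xr yr.
rewrite ler_pdivlMr ?mulr_gt0 //.
have := dot_le (grad h x) (x - y).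
rewrite -opprB dotNr enormN.
set G := enorm _; set D := enorm _; set p := dot _ _.
move=> pD lo; have : 0 <= (G - m * D) ^+ 2 by exact: sqr_ge0.
rewrite expr2; nra.
Qed.

(** Strong monotonicity of the gradient between x and the centre. *)
Lemma curved_dist r m L x : 0 < m -> curved c r m L h ->
  enorm (x - c) <= r ->
  m * enorm (x - c) <= enorm (grad h x) + enorm (grad h c).
Proof.
move=> m0 hc xr.
have cr : enorm (c - c) <= r by rewrite subrr enorm0 (le_trans (enorm_ge0 _) xr).
have [->|xc] := eqVneq (enorm (x - c)) 0.
  by rewrite mulr0 addr_ge0 ?enorm_ge0.
have xp : 0 < enorm (x - c) by rewrite lt_neqAle eq_sym xc enorm_ge0.
have /andP[+ _] := hc _ _ xr cr; have /andP[+ _] := hc _ _ cr xr.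
have := dot_le (grad h x) (x - c); have := dot_le (- grad h c) (x - c).
rewrite dotNl enormN -(opprB x c) dotNr enormN => a1 a2 a3 a4.
rewrite -(ler_pM2l xp); nra.
Qed.

Lemma curved_le_start r m L x eps : 0 <= L ->
  curved c r m L h -> enorm (x - c) <= r -> enorm (grad h c) <= eps ->
  h x - h c <= eps * r + L / 2 * r ^+ 2.
Proof.
move=> L0 hc xr ge.
have r0 := le_trans (enorm_ge0 _) xr.
have cr : enorm (c - c) <= r by rewrite subrr enorm0.
have /andP[_ +] := hc _ _ cr xr; have := dot_le (grad h c) (x - c).
have : enorm (x - c) ^+ 2 <= r ^+ 2 by rewrite ler_sqr ?nnegrE ?enorm_ge0.
have := enorm_ge0 (grad h c); have := enorm_ge0 (x - c); nra.
Qed.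

(** Strong convexity near the centre forces linear growth away from it, by
    convexity along rays; the growth rate is governed by the unit ball only,
    whatever the radius on which h is convex. *)
Lemma curved_growth r1 m1 L1 r m L x : 1 <= r1 -> 0 < m1 -> 0 <= m ->
  curved c r1 m1 L1 h -> curved c r m L h ->
  enorm (grad h c) <= m1 / 4 -> enorm (x - c) <= r -> 1 <= enorm (x - c) ->
  m1 / 4 * enorm (x - c) <= h x - h c.
Proof.
move=> r11 m10 m0 h1 hr ge xr; set rho := enorm (x - c) => rho1.
have rho0 : 0 < rho by rewrite (lt_le_trans ltr01).
pose p := c + rho^-1 *: (x - c).
have pcE : p - c = rho^-1 *: (x - c) by rewrite /p addrC addKr.
have pc : enorm (p - c) = 1.
  by rewrite pcE enormZ ger0_norm ?invr_ge0 ?ltW // mulVf ?gt_eqF.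
have cr1 : enorm (c - c) <= r1 by rewrite subrr enorm0 (le_trans ler01).
have cr : enorm (c - c) <= r.
  by rewrite subrr enorm0 (le_trans _ xr) ?enorm_ge0.
have pr : enorm (p - c) <= r by rewrite pc (le_trans rho1).
have xpE : x - p = (rho - 1) *: (p - c).
  rewrite pcE scalerA mulrBl mul1r divff ?gt_eqF // scalerBl scale1r -pcE.
  by rewrite opprB addrA subrK.
have pr1 : enorm (p - c) <= r1 by rewrite pc.
have /andP[+ _] := h1 _ _ cr1 pr1; rewrite pc.
have := dot_le (- grad h c) (p - c); rewrite dotNl enormN pc => a1 a2.
have /andP[b1 _] := hr _ _ pr xr; have /andP[b2 _] := hr _ _ pr cr.
move: b1 b2; rewrite xpE dotZr -(opprB p c) dotNr enormN pc enormZ pc => b1 b2.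
have b1' : 0 <= h x - h p - (rho - 1) * dot (grad h p) (p - c).
  by apply: le_trans b1; rewrite mulr_ge0 ?divr_ge0 ?sqr_ge0.
have b2' : 0 <= h c - h p - - dot (grad h p) (p - c).
  by apply: le_trans b2; rewrite mulr_ge0 ?divr_ge0 ?sqr_ge0.
nra.
Qed.

(** A unit step against the gradient stays in the larger ball, where h is
    bounded below: the gradient cannot be large. *)
Lemma curved_grad_le r m L x eps : 0 <= m -> 0 <= L ->
  curved c (r + 1) m L h -> enorm (x - c) <= r -> enorm (grad h c) <= eps ->
  enorm (grad h x) <= eps * (2 * r + 2) + L / 2 * (r + 1) ^+ 2 + L / 2.
Proof.
move=> m0 L0 hc xr ge.
have r0 := le_trans (enorm_ge0 _) xr.
have e0 := le_trans (enorm_ge0 _) ge.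
have [->|g0] := eqVneq (enorm (grad h x)) 0.
  have : 0 <= eps * (2 * r + 2) by rewrite mulr_ge0 //; lra.
  have : 0 <= L / 2 * (r + 1) ^+ 2 by rewrite mulr_ge0 ?sqr_ge0 // divr_ge0.
  by lra.
have gp : 0 < enorm (grad h x) by rewrite lt_neqAle eq_sym g0 enorm_ge0.
pose y := x - (enorm (grad h x))^-1 *: grad h x.
have xr1 : enorm (x - c) <= r + 1 by lra.
have yxE : y - x = - ((enorm (grad h x))^-1 *: grad h x) by rewrite /y addrC addKr.
have yx : enorm (y - x) = 1.
  by rewrite yxE enormN enormZ ger0_norm ?invr_ge0 ?ltW // mulVf.
have yr1 : enorm (y - c) <= r + 1.
  rewrite (_ : y - c = (x - c) + (y - x)); last by rewrite [RHS]addrC subrKA.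
  by rewrite (le_trans (ler_enormD _ _)) // yx lerD2r.
have cr1 : enorm (c - c) <= r + 1 by rewrite subrr enorm0; lra.
have b := curved_le_start L0 hc xr1 ge.
have /andP[+ _] := hc _ _ cr1 yr1.
have := dot_le (- grad h c) (y - c); rewrite dotNl enormN => a1 a2.
have a3 : 0 <= h y - h c - dot (grad h c) (y - c).
  by apply: le_trans a2; rewrite mulr_ge0 ?sqr_ge0 // divr_ge0.
have a4 : enorm (grad h c) * enorm (y - c) <= eps * (r + 1).
  by apply: ler_pM => //; exact: enorm_ge0.
have /andP[_] := hc _ _ xr1 yr1; rewrite yx yxE dotNr dotZr -enorm_sq expr2.
rewrite mulrA mulVf // mul1r expr1n mulr1.
move: b; rewrite (_ : eps * (2 * r + 2) = eps * (r + 1) + eps * (r + 1)); first by lra.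
by ring.
Qed.

End curved_function.


Section descent.
Context {R : realType} {d : nat}.
Variables (Cgrad Ceval : nat) (c : 'rV[R]_d) (h : 'rV[R]_d -> R).
Variables (n : nat) (tau beta : R) (r0 r m L : R) (K : nat).
Hypothesis cost_gt0 : (0 < n * Ceval)%N.
Hypothesis beta_itv : 0 < beta < 1.
Hypothesis hcurved : curved c r m L h.
(* Every step of length at most 1 from the ball of radius r0 lands in the ball
   of radius r. *)
Hypothesis step_in : forall x, enorm (x - c) <= r0 -> r0 + enorm (grad h x) <= r.
(* K backtracks bring the step below 1 / L. *)
Hypothesis backtracks : beta ^+ K * L <= 1.

Let beta_ge0 : 0 <= beta. Proof. by case/andP: beta_itv => /ltW. Qed.

Lemma step_in_ball v x : 0 <= v <= 1 -> enorm (x - c) <= r0 ->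
  enorm (x - v *: grad h x - c) <= r.
Proof.
move=> /andP[v0 v1] xr; rewrite addrAC (le_trans (ler_enormD _ _)) //.
rewrite enormN enormZ ger0_norm // (le_trans _ (step_in xr)) // lerD //.
by rewrite ler_piMl ?enorm_ge0.
Qed.

Lemma small_step_armijo v x : 0 <= v <= 1 -> v * L <= 1 ->
  enorm (x - c) <= r0 ->
  h (x - v *: grad h x) <= h x - v / 2 * enorm (grad h x) ^+ 2.
Proof.
move=> v01 vL xr; have yr := step_in_ball v01 xr.
have xr' : enorm (x - c) <= r.
  by have := @step_in_ball 0 x; rewrite lexx ler01 scale0r subr0; apply.
have := hcurved xr' yr; have -> : x - v *: grad h x - x = - (v *: grad h x).
  by rewrite addrAC subrr add0r.
move=> /andP[_]; rewrite dotNr dotZr -enorm_sq enormN enormZ exprMn real_normK ?num_real //.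
case/andP: v01 => v0 _; set g := enorm _ ^+ 2; have g0 : 0 <= g by exact: sqr_ge0.
have : v * L * (v * g) <= v * g by rewrite ler_piMl // mulr_ge0.
rewrite !expr2; lra.
Qed.

(** The trial step number K is accepted at the latest: there v is at most 1 / L,
    where [small_step_armijo] applies. *)
Lemma backtracking_succeeds x k (s : ls_state R) (i : nat) : (i + k = K)%N ->
  enorm (x - c) <= r0 ->
  ls_v s = beta ^+ i -> ls_g s = h (x - ls_v s *: grad h x) ->
  (n * Ceval * k <= ls_budget s)%N ->
  let t := while (@ls_budget R) (ls_guard Ceval n (grad h x) (h x))
                 (ls_body Ceval h n beta x (grad h x)) s in
  [/\ armijo (grad h x) (h x) t, ls_g t = h (x - ls_v t *: grad h x),
      beta ^+ K <= ls_v t <= 1 & (ls_budget s <= ls_budget t + n * Ceval * k)%N].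
Proof.
move=> + xr; elim: k s i => [|k IH] s i ik sv sg sb t.
all: have K01 j : (j <= K)%N -> beta ^+ K <= beta ^+ j <= 1.
1,3: move=> jK; case/andP: beta_itv => _ /ltW b1;
     by rewrite exprn_ile1 // ler_wiXn2l.
all: have iK : (i <= K)%N by rewrite -ik leq_addr.
all: rewrite /t (whileE (fun s cs => ls_body_lt h beta x cost_gt0 cs)) /ls_guard.
all: have [ar|nar] := boolP (armijo _ _ s) => /=.
- by rewrite ar sg sv K01 // leq_addr.
- case/negP: nar; rewrite /armijo sg sv small_step_armijo //.
    by rewrite exprn_ge0 ?exprn_ile1 //; case/andP: beta_itv => _ /ltW.
  by rewrite -[i]addn0 ik.
- by rewrite ar sg sv K01 // leq_addr.
- have lb : (n * Ceval <= ls_budget s)%N by rewrite (leq_trans _ sb) // leq_pmulr.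
  rewrite lb; case: (IH (ls_body Ceval h n beta x (grad h x) s) i.+1) => //=.
  + by rewrite addSnnS.
  + by rewrite sv -exprS.
  + by rewrite leq_subRL // -mulnS.
  + by move=> -> -> -> l; split => //; rewrite mulnS addnCA -leq_subLR.
Qed.

(** The cost of a pass per observation: at most K.+1 values and a gradient. *)
Definition pass_cost : nat := (Ceval * K.+1 + Cgrad)%N.

Definition consistent (s : gd_state R d) : Prop :=
  [/\ gd_G s = Some (grad h (gd_x s)), gd_g s = h (gd_x s) &
      enorm (gd_x s - c) <= r0].

Variable x0 : 'rV[R]_d.
(* The sublevel set of the starting point may have other components far away,
   but none that a step can reach. *)
Hypothesis sublevel : forall x, enorm (x - c) <= r -> h x <= h x0 ->
  enorm (x - c) <= r0.

Lemma gd_pass s : consistent s -> h (gd_x s) <= h x0 ->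
  (n * pass_cost <= gd_budget s)%N ->
  let t := gd_body Cgrad Ceval h n beta s in
  [/\ consistent t,
      h (gd_x t) <= h (gd_x s) - beta ^+ K / 2 * enorm (grad h (gd_x s)) ^+ 2 &
      (gd_budget s <= gd_budget t + n * pass_cost)%N].
Proof.
case: s => x G g b [/= -> -> xr] hx bud.
rewrite /gd_body /=; set ls := line_search _ _ _ _ _ _ _ _.
have b1 : (n * Ceval <= b)%N.
  by rewrite (leq_trans _ bud) // leq_mul2l /pass_cost mulnS -addnA leq_addr orbT.
case: (@backtracking_succeeds x K (LsState 1 (h (x - grad h x)) (b - n * Ceval)) 0)
  => //=; rewrite ?scale1r //.
  rewrite leq_subRL // -mulnS -mulnA (leq_trans _ bud) // leq_mul2l.
  by rewrite /pass_cost leq_addr orbT.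
rewrite -[while _ _ _ _]/ls => ar lg /andP[v0 v1] lb.
rewrite -/ls in ar lg v0 v1 lb; rewrite ar.
have lb' : (b <= ls_budget ls + n * Ceval * K.+1)%N.
  by rewrite mulnS addnCA -leq_subLR.
have v00 : 0 <= ls_v ls by apply: le_trans v0; rewrite exprn_ge0.
have dec : h (x - ls_v ls *: grad h x) <= h x - beta ^+ K / 2 * enorm (grad h x) ^+ 2.
  rewrite -lg (le_trans ar) // lerD2l lerN2 ler_wpM2r ?sqr_ge0 //.
  by rewrite ler_wpM2r.
have xr' : enorm (x - ls_v ls *: grad h x - c) <= r0.
  apply: sublevel; first by apply: step_in_ball; rewrite ?v00.
  apply: (le_trans dec); apply: le_trans hx; rewrite gerDl oppr_le0.
  by rewrite mulr_ge0 ?sqr_ge0 // divr_ge0 ?exprn_ge0.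
have cg : (n * Cgrad <= ls_budget ls)%N.
  rewrite -(leq_add2r (n * Ceval * K.+1)) (leq_trans _ lb') //.
  by rewrite -mulnA -mulnDr addnC.
rewrite cg; split => //=.
by move: lb' cg; rewrite /pass_cost mulnDr mulnA; clear; lia.
Qed.

(** The gap to every point of the ball shrinks by the factor 1 - m beta^K at
    each pass, while a pass with gradient above tau lowers h by at least
    beta^K tau^2 / 2: no such pass remains once all gaps are smaller. *)
Lemma gd_loop N s : 0 < m -> 0 <= tau -> m * beta ^+ K <= 1 ->
  consistent s -> h (gd_x s) <= h x0 ->
  (forall y, enorm (y - c) <= r ->
    (h (gd_x s) - h y) * (1 - m * beta ^+ K) ^+ N < beta ^+ K / 2 * tau ^+ 2) ->
  (n * pass_cost * N.+1 <= gd_budget s)%N ->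
  let t := while (@gd_budget R d) (gd_guard Ceval n tau)
                 (gd_body Cgrad Ceval h n beta) s in
  [/\ enorm (gd_x t - c) <= r0, enorm (grad h (gd_x t)) <= tau &
      (gd_budget s <= gd_budget t + n * pass_cost * N.+1)%N].
Proof.
move=> m0 tau0 mK; elim: N s => [|N IH] s cs hs gap bud t.
all: rewrite /t (whileE (fun s cs => gd_body_lt Cgrad h beta cost_gt0 cs)) /gd_guard.
all: case: (cs) => sG sg sr; rewrite sG.
all: have [tau_lt|le_tau] := ltP tau (enorm _); last by split => //; rewrite leq_addr.
all: have n1 : (n * pass_cost <= gd_budget s)%N
  by rewrite (leq_trans _ bud) // leq_pmulr.
all: have bs : (n * Ceval <= gd_budget s)%N
  by rewrite (leq_trans _ n1) // leq_mul2l /pass_cost mulnS -addnA leq_addr orbT.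
all: rewrite bs /=; case: (gd_pass cs hs n1) => cs' dec bud'.
all: have v0 : 0 < beta ^+ K by rewrite exprn_gt0 //; case/andP: beta_itv.
all: have dec' : h (gd_x (gd_body Cgrad Ceval h n beta s)) <=
       h (gd_x s) - beta ^+ K / 2 * tau ^+ 2
  by apply: (le_trans dec); rewrite lerD2l lerN2 ler_wpM2l ?divr_ge0 ?(ltW v0) //
     ler_sqr ?nnegrE ?enorm_ge0 // ltW.
all: have rr x : enorm (x - c) <= r0 -> enorm (x - c) <= r
  by move=> xr; have := @step_in_ball 0 x; rewrite lexx ler01 scale0r subr0; apply.
- have := gap _ (rr _ (let: And3 _ _ p := cs' in p)); rewrite expr0 mulr1; lra.
- case: (IH _ cs') => [|||]; last by move=> a1 a2 a3; split => //;
    rewrite [X in (_ + X)%N]mulnS [X in (_ + X)%N]addnC addnA;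
    apply: (leq_trans bud'); rewrite leq_add2r.
  + apply: le_trans hs; apply: (le_trans dec'); rewrite gerDl oppr_le0.
    by rewrite mulr_ge0 ?sqr_ge0 // divr_ge0 // ltW.
  + move=> y yr; apply: le_lt_trans (gap _ yr); rewrite exprS mulrA.
    rewrite ler_wpM2r ?exprn_ge0 ?subr_ge0 //.
    have := curved_gap m0 hcurved (rr _ sr) yr.
    rewrite ler_pdivlMr ?mulr_gt0 //.
    set g := enorm _ ^+ 2 in dec *; nra.
  + by rewrite -(leq_add2r (n * pass_cost)) (leq_trans _ bud') // addnC -mulnS.
Qed.

(** By [curved_gap] the square of the initial gradient bounds every initial gap,
    so [gd_loop] applies from the start. *)
Lemma gd_converges N b : 0 < m -> 0 <= tau -> m * beta ^+ K <= 1 ->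
  enorm (x0 - c) <= r0 ->
  enorm (grad h x0) ^+ 2 / (2 * m) * (1 - m * beta ^+ K) ^+ N
    < beta ^+ K / 2 * tau ^+ 2 ->
  (n * (Cgrad + Ceval + pass_cost * N.+1) <= b)%N ->
  let: (x, b') := gd Cgrad Ceval h n tau beta x0 b in
  [/\ enorm (x - c) <= r0, enorm (grad h x) <= tau &
      (b <= b' + n * (Cgrad + Ceval + pass_cost * N.+1))%N].
Proof.
move=> m0 tau0 mK xr gap bud; rewrite /gd /gd_init.
have c1 : (n * Cgrad <= b)%N.
  by rewrite (leq_trans _ bud) // leq_mul2l -addnA leq_addr orbT.
have c2 : (n * Ceval <= b - n * Cgrad)%N.
  by rewrite leq_subRL // -mulnDr (leq_trans _ bud) // leq_mul2l leq_addr orbT.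
have rr x : enorm (x - c) <= r0 -> enorm (x - c) <= r.
  by move=> yr; have := @step_in_ball 0 x; rewrite lexx ler01 scale0r subr0; apply.
rewrite c1 c2; set s := GdState _ _ _ _.
have bE : b = (gd_budget s + n * (Cgrad + Ceval))%N.
  by rewrite /= -subnDA mulnDr subnK // -mulnDr (leq_trans _ bud) // leq_mul2l leq_addr orbT.
case: (@gd_loop N s) => //.
- move=> y yr; apply: le_lt_trans gap; rewrite ler_wpM2r ?exprn_ge0 ?subr_ge0 //.
  by apply: (curved_gap m0 hcurved) => //; exact: rr.
- by rewrite -(leq_add2r (n * (Cgrad + Ceval))) -bE -mulnA -mulnDr addnC.
- move=> a1 a2 a3; split => //; rewrite [X in (X <= _)%N]bE (mulnDr n (Cgrad + Ceval)%N) mulnA.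
  by rewrite (addnC (n * (Cgrad + Ceval))%N) addnA leq_add2r.
Qed.

End descent.


(** * The multi-stage procedure on good samples *)

Section stages.
Context {R : realType} {d : nat}.
Variables (Cgrad Ceval : nat) (c : 'rV[R]_d) (beta : R).
Variables (r R0 r1 m1 L1 m0 L0 m L eps : R) (K : nat).

(** What a single sample must satisfy for one call of gradient descent started
    in the ball of radius r to succeed: curvature bounds on three balls and a
    small gradient at c. *)
Definition good_sample (h : 'rV[R]_d -> R) : Prop :=
  [/\ curved c r m1 L1 h, curved c (R0 + 1) m0 L0 h, curved c r1 m L h &
      enorm (grad h c) <= eps].

(** The bound of [curved_grad_le] for the gradient on the ball of radius R0. *)
Definition grad_bound : R :=
  eps * (2 * R0 + 2) + L0 / 2 * (R0 + 1) ^+ 2 + L0 / 2.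

Hypothesis beta_itv : 0 < beta < 1.
Hypothesis r_ge1 : 1 <= r.
Hypothesis R0_ge : r <= R0.
Hypothesis R0_growth : eps * r + L1 / 2 * r ^+ 2 <= m1 / 4 * R0.
Hypothesis r1_ge : R0 + grad_bound <= r1.
Hypotheses (m1_gt0 : 0 < m1) (m0_ge0 : 0 <= m0) (m_gt0 : 0 < m).
Hypotheses (L1_ge0 : 0 <= L1) (L0_ge0 : 0 <= L0).
Hypotheses (eps_m1 : eps <= m1 / 4) (eps_m : eps <= m / 2).
Hypotheses (backtracks : beta ^+ K * L <= 1) (mK : m * beta ^+ K <= 1).

Definition call_cost N : nat := (Cgrad + Ceval + pass_cost Cgrad Ceval K * N.+1)%N.

(** Linear growth away from c confines the reachable part of the sublevel set of
    the start to the ball of radius R0, and the bound on the gradient there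
    confines all trial points to the ball of radius r1.  A gradient below the
    tolerance at the end brings the iterate back to the unit ball, hence to the
    ball from which the next call may start. *)
Lemma good_gd h n tau x b N : good_sample h ->
  (0 < n * Ceval)%N -> 0 <= tau <= m / 2 -> enorm (x - c) <= r ->
  grad_bound ^+ 2 / (2 * m) * (1 - m * beta ^+ K) ^+ N
    < beta ^+ K / 2 * tau ^+ 2 ->
  (n * call_cost N <= b)%N ->
  let g := gd Cgrad Ceval h n tau beta x b in
  [/\ enorm (g.1 - c) <= r, m * enorm (g.1 - c) <= tau + enorm (grad h c) &
      (b <= g.2 + n * call_cost N)%N].
Proof.
move=> [h1 h0 hr ge] cost /andP[tau0 taum] xr gap bud.
have R00 : 0 <= R0 by rewrite (le_trans _ R0_ge) // (le_trans _ r_ge1).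
have gradb y : enorm (y - c) <= R0 -> enorm (grad h y) <= grad_bound.
  by move=> yR0; exact: curved_grad_le h0 yR0 ge.
have gb0 : 0 <= grad_bound.
  by apply: le_trans (gradb c _); rewrite ?enorm_ge0 // subrr enorm0.
have R0r1 : R0 <= r1 by rewrite (le_trans _ r1_ge) // lerDl.
have step y : enorm (y - c) <= R0 -> R0 + enorm (grad h y) <= r1.
  by move=> yR0; rewrite (le_trans _ r1_ge) // lerD2l gradb.
have sub y : enorm (y - c) <= r1 -> h y <= h x -> enorm (y - c) <= R0.
  move=> yr1 hyx; have [y1|y1] := leP (enorm (y - c)) 1.
    by rewrite (le_trans y1) // (le_trans r_ge1).
  have := curved_growth r_ge1 m1_gt0 (ltW m_gt0) h1 hr (le_trans ge eps_m1) yr1 (ltW y1).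
  have := curved_le_start L1_ge0 h1 xr ge => a1 a2.
  rewrite -(ler_pM2l (_ : 0 < m1 / 4)) ?divr_gt0 // (le_trans a2) //.
  by rewrite (le_trans _ R0_growth) // (le_trans _ a1) // lerD2r.
have xR0 : enorm (x - c) <= R0 by rewrite (le_trans xr).
have := @gd_converges R d Cgrad Ceval c h n tau beta R0 r1 m L K cost beta_itv
  hr step backtracks x sub N b m_gt0 tau0 mK xR0.
case: gd => y b' H /=; case: H => //.
  apply: le_lt_trans gap; rewrite ler_wpM2r ?exprn_ge0 ?subr_ge0 //.
  rewrite ler_wpM2r ?invr_ge0 ?mulr_ge0 ?(ltW m_gt0) //.
  by rewrite ler_sqr ?nnegrE ?enorm_ge0 ?gradb.
move=> yR0 gy bb'.
have my : m * enorm (y - c) <= tau + enorm (grad h c).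
  rewrite (le_trans (curved_dist m_gt0 hr _)) ?(le_trans yR0) //.
  by rewrite lerD2r.
split => //; rewrite (le_trans _ r_ge1) //.
rewrite -(ler_pM2l m_gt0) mulr1 (le_trans my) // (_ : m = m / 2 + m / 2).
  by rewrite lerD // (le_trans ge).
by rewrite -splitr.
Qed.

(** No stage costs more than V, so that after j stages at least B - j V remains
    and the stage J still has its share. *)
Lemma good_multi F x0 B alpha' delta kappa tau N V J :
  (0 < Ceval)%N -> enorm (x0 - c) <= r -> (0 < V)%N -> (J * V <= B)%N ->
  (forall j, (1 <= j <= J)%N ->
    let n := stage_size kappa delta B j in
    let t := stage_tolerance tau alpha' delta B j in
    [/\ good_sample (F n), (0 < n)%N, 0 <= t <= m / 2,
        grad_bound ^+ 2 / (2 * m) * (1 - m * beta ^+ K) ^+ N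
          < beta ^+ K / 2 * t ^+ 2 &
        (n * call_cost N <= V)%N]) ->
  let: (y, b) := multi_state Cgrad Ceval F x0 B alpha' delta kappa tau beta J in
  [/\ enorm (y - c) <= r, (B <= b + J * V)%N &
      (0 < J)%N -> m * enorm (y - c) <= stage_tolerance tau alpha' delta B J
        + enorm (grad (F (stage_size kappa delta B J)) c)].
Proof.
move=> ce0 x0r V0; elim: J => [|J IH] JB H /=.
  by split; rewrite ?mul0n ?addn0.
have {IH} := IH (leq_trans (leq_mul (leqnSn J) (leqnn V)) JB)
  (fun j jJ => H j (let: conj a b := andP jJ in
      introT andP (conj a (leq_trans b (leqnSn J))))).
case: multi_state => y b [yr Bb _].
have Vb : (V <= b)%N.
  by rewrite -(leq_add2r (J * V)%N) (leq_trans _ Bb) // (leq_trans _ JB).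
rewrite (leq_trans V0 Vb).
have [good n0 t01 gap cost] := H J.+1 (leqnn _).
have nc : (0 < stage_size kappa delta B J.+1 * Ceval)%N by rewrite muln_gt0 n0.
have := good_gd good nc t01 yr gap (leq_trans cost Vb).
case: (gd _ _ _ _ _ _ _ _) => z b' [/= zr mz bb']; split => //; rewrite mulSn addnA (leq_trans Bb) //.
by rewrite leq_add2r (leq_trans bb') // leq_add2l.
Qed.

End stages.

Lemma near_powR_ge (R : realType) (p a : R) : 0 < p ->
  \forall B \near \oo, a <= B%:R `^ p.
Proof.
move=> p0; near=> B.
have a1 : 0 <= `|a| `^ p^-1 by exact: powR_ge0.
have B1 : `|a| `^ p^-1 <= B%:R by near: B; exact: nbhs_infty_ger.
apply: (le_trans (ler_norm a)).
have := ge0_ler_powR (ltW p0) a1 (ler0n _ _) B1.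
by rewrite -powRrM mulVf ?gt_eqF // powRr1.
Unshelve. all: by end_near. Qed.

(** The inequality ln y <= y - 1 at y = x ^ s. *)
Lemma ln_le_powR (R : realType) (s x : R) : 0 < s -> 0 < x -> ln x <= x `^ s / s.
Proof.
move=> s0 x0; rewrite ler_pdivlMr // mulrC -ln_powR.
have := powR_gt0 s x0; move: (x `^ s) => y y0.
rewrite (_ : y = 1 + (y - 1)); last by rewrite addrC subrK.
by rewrite (le_trans (le_ln1Dx _)) //; lra.
Qed.

Lemma powR_ge1 (R : realType) (x p : R) : 1 <= x -> 0 <= p -> 1 <= x `^ p.
Proof. by move=> x1 p0; rewrite -[leLHS](powRr0 x) ler_powR. Qed.

Lemma ceil_leD1 (R : realType) (x : R) : (Num.ceil x)%:~R <= x + 1.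
Proof. by rewrite -lerBlDr ltW // (_ : _ - 1 = (Num.ceil x - 1)%:~R) ?ceilB1_lt // intrB. Qed.

Section asymptotics.
Context {R : realType}.
Variables (kappa tau alpha' delta : R).
Hypotheses (kappa_gt0 : 0 < kappa) (tau_gt0 : 0 < tau).
Hypotheses (alpha'_itv : 0 < alpha' <= 1) (delta_itv : 0 < delta < 1).

Lemma stage_exponent_gt0 j : (0 < j)%N -> 0 < stage_exponent delta j.
Proof.
move=> j0; case/andP: delta_itv => d0 d1.
by rewrite subr_gt0 exprn_ilt1 ?ltW // -lt0n.
Qed.

Lemma stage_exponent_mono i j : (i <= j)%N ->
  stage_exponent delta i <= stage_exponent delta j.
Proof.
move=> ij; case/andP: delta_itv => d0 d1.
by rewrite lerD2l lerN2 ler_wiXn2l // ltW.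
Qed.

Lemma stage_size_ge (B j : nat) :
  kappa * B%:R `^ stage_exponent delta j <= (stage_size kappa delta B j)%:R.
Proof.
rewrite /stage_size natr_absz ger0_norm ?ceil_ge //.
by rewrite ceil_ge0 (lt_le_trans (ltrN10 _)) // mulr_ge0 ?powR_ge0 // ltW.
Qed.

Lemma stage_size_gt0 (B j : nat) : (0 < B)%N -> (0 < stage_size kappa delta B j)%N.
Proof.
move=> B0; rewrite -(ltr0n R) (lt_le_trans _ (stage_size_ge B j)) //.
by rewrite mulr_gt0 ?powR_gt0 ?ltr0n.
Qed.

Lemma stage_size_le (B j : nat) :
  (stage_size kappa delta B j)%:R <= kappa * B%:R `^ stage_exponent delta j + 1.
Proof.
rewrite /stage_size natr_absz ger0_norm; last first.
  by rewrite ceil_ge0 (lt_le_trans (ltrN10 _)) // mulr_ge0 ?powR_ge0 // ltW.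
exact: ceil_leD1.
Qed.

Lemma stage_size_near (j N0 : nat) : (0 < j)%N ->
  \forall B \near \oo, (N0 <= stage_size kappa delta B j)%N.
Proof.
move=> j0; near=> B; rewrite -(ler_nat R) (le_trans _ (stage_size_ge B j)) //.
rewrite -ler_pdivrMl //; near: B; apply: near_powR_ge.
exact: stage_exponent_gt0.
Unshelve. all: by end_near. Qed.

Let e : R := alpha' / (1 + alpha').

Lemma rate_gt0 : 0 < alpha' / (1 + alpha').
Proof. by case/andP: alpha'_itv => a0 _; rewrite divr_gt0 // addr_gt0. Qed.

Lemma rate_le_half : alpha' / (1 + alpha') <= 1 / 2.
Proof.
by case/andP: alpha'_itv => a0 a1; rewrite ler_pdivrMr ?addr_gt0 //; lra.
Qed.

Lemma stage_tolerance_le (a : R) : 0 < a ->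
  \forall B \near \oo, forall j, (0 < j)%N ->
    0 <= stage_tolerance tau alpha' delta B j <= a.
Proof.
move=> a0; near=> B => j j0.
rewrite mulr_ge0 ?powR_ge0 ?(ltW tau_gt0) //= /stage_tolerance mulNr powRN.
have B1 : (1 : R) <= B%:R by near: B; exact: nbhs_infty_ger.
rewrite ler_pdivrMr; last by rewrite powR_gt0 // (lt_le_trans ltr01).
rewrite -ler_pdivrMl // (@le_trans _ _ (B%:R `^ (e * stage_exponent delta 1))) //.
  near: B; apply: near_powR_ge; rewrite mulr_gt0 ?rate_gt0 //.
  exact: stage_exponent_gt0.
by rewrite ler_powR // ler_wpM2l ?(ltW rate_gt0) // stage_exponent_mono.
Unshelve. all: by end_near. Qed.

(** The exponent alpha' / (1 + alpha') is at most 1 / 2, so that no tolerance is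
    below the order of B ^ (- 1 / 2). *)
Lemma stage_tolerance_sqr_ge (B j : nat) : (0 < B)%N ->
  tau ^+ 2 / B%:R <= stage_tolerance tau alpha' delta B j ^+ 2.
Proof.
move=> B0; rewrite exprMn ler_wpM2l ?sqr_ge0 // mulNr powRN exprVn.
have B1 : (1 : R) <= B%:R by rewrite ler1n.
have p0 : 0 < B%:R `^ (e * stage_exponent delta j) by rewrite powR_gt0 ?ltr0n.
rewrite lef_pV2 ?posrE ?exprn_gt0 ?ltr0n // -/e -powR_mulrn ?(ltW p0) // -powRrM.
rewrite -[leRHS]powRr1 ?ler0n // ler_powR //.
have := rate_le_half; have := rate_gt0; rewrite -/e => e0 e1.
have s1 : stage_exponent delta j <= 1.
  by rewrite lerBlDl lerDr exprn_ge0 //; case/andP: delta_itv => /ltW.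
have : e * stage_exponent delta j <= e by rewrite ler_piMr // ltW.
by lra.
Qed.

(** Since the gradient contracts geometrically, of the order of ln B passes
    suffice to reach a tolerance that is polynomial in B; all stages together
    then cost a factor ln B more than one evaluation of the largest sample,
    which is of the order of B ^ (1 - delta ^ J) and hence negligible before
    B. *)
Lemma enough_budget (J C1 C2 : nat) (a G g : R) : 0 < a <= 1 -> 0 <= G -> 0 < g ->
  \forall B \near \oo, exists N V : nat,
  [/\ (0 < V)%N, (J * V <= B)%N &
   forall j, (1 <= j <= J)%N ->
    G * (1 - a) ^+ N < g * stage_tolerance tau alpha' delta B j ^+ 2 /\
    (stage_size kappa delta B j * (C1 + C2 * N.+1) <= V)%N].
Proof.
move=> /andP[a0 a1] G0 g0.
have [dl0 dl1] := andP delta_itv.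
(* The factor ln B is absorbed by B ^ s, with half of the room delta ^ J that
   the largest sample leaves below B. *)
pose s := delta ^+ J / 2; have s0 : 0 < s by rewrite divr_gt0 ?exprn_gt0.
pose D : R := C1%:R + C2%:R * (2 / a / s + 2) + 1.
have as0 : 0 <= 2 / a / s by apply: divr_ge0 (ltW s0); apply: divr_ge0 (ltW a0).
have D1 : 1 <= D by rewrite lerDr addr_ge0 // mulr_ge0 // addr_ge0.
near=> B.
have B1 : (1 : R) <= B%:R by near: B; exact: nbhs_infty_ger.
have B0 : (0 : R) < B%:R by rewrite (lt_le_trans ltr01).
have lnB : 0 <= 2 / a * ln B%:R by rewrite mulr_ge0 ?ln_ge0 // divr_ge0 ?(ltW a0).
(* With this N, (1 - a) ^ N <= exp (- a N) <= B ^ -2, which beats the squared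
   tolerance of order at least B ^ -1. *)
pose N := `|Num.ceil (2 / a * ln (B%:R : R))|%N.
have NE : N%:R = (Num.ceil (2 / a * ln (B%:R : R)))%:~R :> R.
  by rewrite /N natr_absz ger0_norm // ceil_ge0 (lt_le_trans (ltrN10 _)).
have N_ge : 2 / a * ln B%:R <= N%:R :> R by rewrite NE ceil_ge.
have N_le : N.+1%:R <= (2 / a / s + 2) * B%:R `^ s :> R.
  have : N%:R <= 2 / a * ln B%:R + 1 :> R by rewrite NE ceil_leD1.
  have : 2 / a * ln B%:R <= 2 / a * (B%:R `^ s / s) :> R.
    by rewrite ler_wpM2l ?ln_le_powR // divr_ge0 // ltW.
  have : 1 <= B%:R `^ s :> R by rewrite powR_ge1 // ltW.
  rewrite -[N.+1]addn1 natrD mulrA => ? ? ?; nra.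
exists N, (\max_(j < J.+1) (stage_size kappa delta B j * (C1 + C2 * N.+1)) + 1)%N.
split; first by rewrite addn1.
  rewrite -(ler_nat R) natrM.
  have bound (j : 'I_J.+1) :
      (stage_size kappa delta B j * (C1 + C2 * N.+1))%:R + 1 <=
        (kappa + 2) * D * B%:R `^ (stage_exponent delta J + s).
    rewrite natrM powRD; last by rewrite (gt_eqF B0) implybT.
    have e0 : 1 <= B%:R `^ stage_exponent delta J :> R.
      rewrite powR_ge1 // subr_ge0 exprn_ile1 ?(ltW dl0) ?(ltW dl1) //.
    have s1 : 1 <= B%:R `^ s :> R by rewrite powR_ge1 // ltW.
    have n_le : (stage_size kappa delta B j)%:R <= (kappa + 1) * B%:R `^ stage_exponent delta J :> R.
      rewrite (le_trans (stage_size_le _ _)) // mulrDl mul1r lerD // ler_wpM2l ?(ltW kappa_gt0) //.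
      by rewrite ler_powR // stage_exponent_mono // -ltnS.
    have c_le : (C1 + C2 * N.+1)%:R <= D * B%:R `^ s :> R.
      rewrite natrD natrM /D mulrDl mulrDl mul1r -[leLHS]addr0 lerD ?powR_ge0 //.
      by apply: lerD; [rewrite ler_peMr|rewrite -[leRHS]mulrA ler_wpM2l].
    have := ler_pM (ler0n _ _) (ler0n _ _) n_le c_le.
    set u := B%:R `^ _ in e0 *; set v := B%:R `^ s in s1 *.
    have uv1 : 1 <= D * (u * v) by rewrite -[1]mulr1 ler_pM // -[1]mulr1 ler_pM.
    move=> ?; nra.
  have maxb : (\max_(j < J.+1) (stage_size kappa delta B j * (C1 + C2 * N.+1)) + 1)%:R
      <= (kappa + 2) * D * B%:R `^ (stage_exponent delta J + s).
    have [|i ->] := @bigop.eq_bigmax 'I_J.+1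
      (fun j => stage_size kappa delta B j * (C1 + C2 * N.+1))%N.
      by rewrite card_ord.
    by rewrite natrD bound.
  have JB : J%:R * ((kappa + 2) * D) <= B%:R `^ s by near: B; exact: near_powR_ge.
  rewrite (le_trans (ler_wpM2l (ler0n _ _) maxb)) // mulrA.
  rewrite (le_trans (ler_wpM2r _ JB)) ?powR_ge0 // -powRD; last by rewrite (gt_eqF B0) implybT.
  rewrite (_ : s + _ = 1) ?powRr1 // /s /stage_exponent; lra.
move=> j /andP[j1 jJ]; split; last first.
  apply: leq_trans (leq_addr _ _).
  exact: (@bigop.leq_bigmax _ (fun i : 'I_J.+1 =>
    stage_size kappa delta B i * (C1 + C2 * N.+1))%N (Ordinal (jJ : (j < J.+1)%N))).
have qN : (1 - a) ^+ N <= B%:R ^- 2.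
  have e1 : 1 - a <= expR (- a) by exact: expR_ge1Dx.
  apply: le_trans (_ : expR (- a) ^+ N <= _); first by rewrite lerXn2r ?nnegrE ?expR_ge0 ?subr_ge0.
  rewrite -expRM_natl -(@lnK _ B%:R) ?posrE // -expRM_natl -expRN ler_expR.
  rewrite mulrN lerN2 (_ : 2 * _ = 2 / a * ln B%:R * a); first by rewrite ler_pM2r.
  by field; rewrite gt_eqF.
have B2 : G * tau ^- 2 / g < B%:R.
  near: B; exact: nbhs_infty_gtr.
apply: le_lt_trans (ler_wpM2l G0 qN) _.
apply: lt_le_trans (ler_wpM2l (ltW g0) (stage_tolerance_sqr_ge j _)); last by rewrite -(ltr0n R).
rewrite expr2 invfM mulrA mulrA ltr_pM2r ?invr_gt0 //.
rewrite ltr_pdivrMr // mulrC -ltr_pdivrMr ?mulr_gt0 ?exprn_gt0 //.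
by rewrite invfM mulrA mulrAC.
Unshelve. all: by end_near. Qed.

End asymptotics.


(** * Second-order expansions along segments *)

Section lines.
Context {R : realType} {d : nat}.
Implicit Types (h : 'rV[R]_d -> R) (x y u v : 'rV[R]_d).

Definition hess_form h x u : R := dot (u *m hess h x) u.

Lemma derive_grad h x u : differentiable h x -> 'D_u h x = dot (grad h x) u.
Proof.
move=> hx; rewrite deriveE // [u in LHS]row_sum_delta linear_sum /=.
by apply: eq_bigr => i _; rewrite linearZ /= mxE -deriveE //; exact: mulrC.
Qed.

Lemma is_derive_grad h x u : differentiable h x ->
  is_derive x u h (dot (grad h x) u).
Proof. by move=> hx; rewrite -derive_grad //; exact/derivableP/diff_derivable. Qed.

Lemma is_derive_dot_grad h x u v : differentiable (grad h) x ->
  is_derive x u (fun y => dot (grad h y) v) (dot (u *m hess h x) v).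
Proof.
move=> hx; have dx : derivable (grad h) x u by exact: diff_derivable.
have dj j : is_derive x u (fun y => grad h y ord0 j) ((u *m hess h x) ord0 j).
  rewrite -deriveEjacobian // derive_mx // mxE; apply: derivableP.
  exact: (derivable_mxP _ _ _).1.
rewrite (_ : (fun y => _) = \sum_(j < d) (fun y => v ord0 j *: grad h y ord0 j)).
  rewrite (_ : dot _ _ = \sum_(j < d) v ord0 j *: (u *m hess h x) ord0 j).
    by apply: is_derive_sum => j; exact: is_deriveZ.
  by apply: eq_bigr => j _; exact: mulrC.
by apply/funext => y; rewrite fct_sumE; apply: eq_bigr => j _; rewrite mulrC.
Qed.

Lemma is_derive_line h x u (s D : R) : is_derive (x + s *: u) u h D ->
  is_derive s (1 : R) (fun t : R => h (x + t *: u)) D.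
Proof.
move=> [hd hD].
have E : (fun t : R => t^-1 *: (h (x + (t *: (1 : R) + s) *: u) - h (x + s *: u)))
       = (fun t : R => t^-1 *: ((h \o shift (x + s *: u)) (t *: u) - h (x + s *: u))).
  apply/funext => t /=; congr (_ *: (h _ - _)).
  by rewrite scalerDl [t *: 1]mulr1 [LHS]addrCA.
split; first by rewrite /derivable /= E.
by rewrite /derive /= E.
Qed.

(** A lower bound for the second derivative, integrated twice. *)
Lemma taylor2_ge (f f' f'' : R -> R) (a : R) :
  (forall s : R, is_derive s (1 : R) f (f' s)) -> (forall s : R, is_derive s (1 : R) f' (f'' s)) ->
  (forall s, 0 <= s <= 1 -> a <= f'' s) -> f 0 + f' 0 + a / 2 <= f 1.
Proof.
move=> df df' af.
have cont (g g' : R -> R) (a0 b0 : R) : (forall s : R, is_derive s (1 : R) g (g' s)) ->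
    {within `[a0, b0], continuous g}.
  move=> dg; apply: continuous_subspaceT => s.
  by apply: differentiable_continuous; apply/derivable1_diffP; case: (dg s).
pose g s := f s - a / 2 * s ^+ 2; pose g' s := f' s - a * s.
have dlin (k s : R) : is_derive s (1 : R) (fun t => k * t) k.
  by rewrite -[k in is_derive _ _ _ k]mulr1; exact: (@is_deriveZ _ _ _ id k s 1 1).
have dsq (s : R) : is_derive s (1 : R) (fun t => a / 2 * t ^+ 2) (a * s).
  rewrite (_ : (fun t => _) = (a / 2) *: ((id : R -> R) * id)).
    apply: is_derive_eq; rewrite /GRing.scale /=; lra.
  by apply/funext => t; rewrite expr2.
have dg (s : R) : is_derive s (1 : R) g (g' s) by exact: is_deriveB.
have dg' (s : R) : is_derive s (1 : R) g' (f'' s - a) by exact: is_deriveB.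
have [c c01 Ec] := MVT ltr01 (fun s _ => dg s) (cont _ _ 0 1 dg).
move: c01; rewrite in_itv /= => /andP[c0 c1].
have [e e0c Ee] := MVT c0 (fun s _ => dg' s) (cont _ _ 0 c dg').
move: e0c; rewrite in_itv /= => /andP[e0 ec].
have := af e; rewrite (ltW e0) (ltW (lt_trans ec c1)) => /(_ isT) ae.
have : 0 <= (f'' e - a) * (c - 0) by rewrite subr0 mulr_ge0 ?subr_ge0 // ltW.
rewrite -Ee; move: Ec; rewrite /g /g' subr0 mulr1 mulr0 subr0 expr0n expr1n /=.
by move=> *; lra.
Qed.

Lemma taylor2_le (f f' f'' : R -> R) (b : R) :
  (forall s : R, is_derive s (1 : R) f (f' s)) -> (forall s : R, is_derive s (1 : R) f' (f'' s)) ->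
  (forall s, 0 <= s <= 1 -> f'' s <= b) -> f 1 <= f 0 + f' 0 + b / 2.
Proof.
move=> df df' bf.
have H s : 0 <= s <= 1 -> - b <= - f'' s by move=> s01; rewrite lerN2 bf.
have := @taylor2_ge (fun s => - f s) (fun s => - f' s) (fun s => - f'' s) (- b)
  (fun s => is_deriveN (df s)) (fun s => is_deriveN (df' s)) H.
by lra.
Qed.

End lines.

Section empirical_risk.
Context {R : realType} {d : nat} {disp : measure_display} {E : measurableType disp}.
Variables (f : 'rV[R]_d -> E -> R) (z : nat -> E).
Hypothesis df : forall z x, differentiable (f^~ z) x.
Hypothesis ddf : forall z x, differentiable (grad (f^~ z)) x.
Implicit Types (x y u v : 'rV[R]_d).

Lemma emp_riskE n : emp_risk f z n =
  n%:R^-1 *: \sum_(i < n) (f^~ (z i)) :> ('rV[R]_d -> R).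
Proof. by apply/funext => x; rewrite /emp_risk [RHS]/(_ * _) fct_sumE. Qed.

Lemma emp_risk_diff n x : differentiable (emp_risk f z n) x.
Proof. by rewrite emp_riskE; apply/differentiableZ/differentiable_sum. Qed.

Lemma grad_emp_risk n x :
  grad (emp_risk f z n) x = n%:R^-1 *: \sum_(i < n) grad (f^~ (z i)) x.
Proof.
apply/rowP => j; rewrite !mxE emp_riskE deriveZ; last exact/diff_derivable/differentiable_sum.
rewrite derive_sum; last by move=> i; exact: diff_derivable.
by congr (_ * _); rewrite summxE; apply: eq_bigr => i _; rewrite mxE.
Qed.

Definition emp_hess n x u : R := n%:R^-1 * \sum_(i < n) hess_form (f^~ (z i)) x u.

(** Taylor's formula along the segment from x to y, where the second derivative
    is the empirical Hessian form. *)
Lemma curved_emp_risk n c r m L :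
  (forall x u, enorm (x - c) <= r ->
     m * enorm u ^+ 2 <= emp_hess n x u <= L * enorm u ^+ 2) ->
  curved c r m L (emp_risk f z n).
Proof.
move=> H x y xr yr.
pose u := y - x.
pose p s := emp_risk f z n (x + s *: u).
pose p' s := dot (grad (emp_risk f z n) (x + s *: u)) u.
pose p'' s := emp_hess n (x + s *: u) u.
have dp (s : R) : is_derive s (1 : R) p (p' s).
  by apply: is_derive_line; apply: is_derive_grad; exact: emp_risk_diff.
have dp' (s : R) : is_derive s (1 : R) p' (p'' s).
  rewrite /p' /p'' /emp_hess.
  apply: (@is_derive_line _ _ (fun y => dot (grad (emp_risk f z n) y) u)).
  rewrite (_ : (fun y => _) =
      n%:R^-1 *: \sum_(i < n) (fun y => dot (grad (f^~ (z i)) y) u)).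
    apply: is_deriveZ; apply: is_derive_sum => i; exact: is_derive_dot_grad.
  apply/funext => v; rewrite grad_emp_risk dotZl [RHS]/(_ * _) fct_sumE; congr (_ * _).
  rewrite /dot exchange_big /=; apply: eq_bigr => j _.
  by rewrite summxE mulr_suml.
have b s : 0 <= s <= 1 -> m * enorm u ^+ 2 <= p'' s <= L * enorm u ^+ 2.
  by move=> s01; apply: H; exact: enorm_convex.
have := taylor2_ge dp dp' (fun s s01 => proj1 (andP (b s s01))).
have := taylor2_le dp dp' (fun s s01 => proj2 (andP (b s s01))).
rewrite /p /p' scale0r scale1r addr0 (_ : x + u = y); last by rewrite /u addrC subrK.
move=> lo hi; apply/andP; split; lra.
Qed.

End empirical_risk.


(** * Measurability of the output of the procedure *)

Section vector_measurability.
Context {R : realType} {d : nat} {disp : measure_display} {T : measurableType disp}.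

Definition mvec (g : T -> 'rV[R]_d) : Prop :=
  measurable_fun [set: T] (g : T -> borel 'rV[R]_d).

Lemma mvec_coord (g : T -> 'rV[R]_d) i : mvec g ->
  measurable_fun [set: T] (fun w => g w ord0 i).
Proof.
move=> mg; apply: (@measurableT_comp _ _ _ _ _ _
  (fun x : borel 'rV[R]_d => (x : 'rV[R]_d) ord0 i)) mg.
apply: (measurability _ (RGenOInfty.measurableE R)) => _ [_ [y ->] <-].
rewrite setTI; apply: sub_sigma_algebra.
rewrite (_ : _ @^-1` _ = (fun x : 'rV[R]_d => x ord0 i) @^-1` [set t | y < t]).
  by apply: open_comp; [move=> x _; exact: coord_continuous|exact: open_gt].
by apply/seteqP; split => x /=; rewrite in_itv /= andbT.
Qed.

(** Every open set is a countable union of boxes with rational data. *)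
Lemma mvecP (g : T -> 'rV[R]_d) :
  (forall i, measurable_fun [set: T] (fun w => g w ord0 i)) -> mvec g.
Proof.
move=> mg; apply: (@measurability _ _ T (borel 'rV[R]_d) setT g (@open 'rV[R]_d)) => // _ [U oU <-].
rewrite setTI.
pose box (p : 'rV[rat]_d * rat) : set 'rV[R]_d :=
  [set x | forall i, `|ratr (p.1 ord0 i) - x ord0 i| < ratr p.2].
pose F p := if `[< box p `<=` U >] then g @^-1` box p else set0.
rewrite (_ : g @^-1` U = \bigcup_p F p).
  apply: countable_bigcupT_measurable => [|p]; first exact: countableP.
  rewrite /F; case: asboolP => _; last exact: measurable0.
  rewrite (_ : _ @^-1` _ = \bigcap_(i in [set: 'I_d])
     ((fun w => `|ratr (p.1 ord0 i) - g w ord0 i|) @^-1` [set` `]-oo, ratr p.2[])).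
    apply: fin_bigcap_measurable; first exact: finite_finset.
    move=> i _; rewrite -[X in measurable X]setTI.
    apply: (measurableT_comp (@normr_measurable R setT)) => //.
    by apply: measurable_funB => //; exact: mg.
  apply/seteqP; split => w /=.
    by move=> H i _ /=; rewrite in_itv /= H.
  by move=> H i; have := H i I; rewrite /= in_itv.
apply/seteqP; split => [w /= Uw|w [p _]]; last first.
  by rewrite /F; case: asboolP => // pU /= /pU.
have /nbhs_ballP[e /= e0 eU] : nbhs (g w) U by exact: open_nbhs_nbhs.
have [q q0 qe] : exists2 q : rat, 0 < ratr q :> R & ratr q < e / 2.
  have /rat_in_itvoo[q] : 0 < e / 2 by rewrite divr_gt0.
  by rewrite in_itv /= => /andP[q0 qe]; exists q.
have near i : exists t : rat, `|ratr t - g w ord0 i| < ratr q.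
  have /rat_in_itvoo[t] : g w ord0 i - ratr q < g w ord0 i + ratr q by lra.
  by rewrite in_itv /= => /andP[t1 t2]; exists t; rewrite ltr_distl t1 t2.
have [t tP] := boolp.choice near.
exists (\row_i t i, q) => //; rewrite /F; case: asboolP => [_|[]].
  by move=> i; rewrite mxE.
move=> x /= xt; apply: eU; split => // i j.
rewrite (ord1 i) -ball_normE /= -(subrKA (ratr (t j))).
rewrite (le_lt_trans (ler_normD _ _)) // (splitr e) ltrD //.
  by rewrite distrC (lt_trans (tP j)).
by have := xt j; rewrite mxE => /lt_trans; apply.
Qed.

Lemma mvec_cst x : mvec (fun=> x).
Proof. by apply: mvecP => i; exact: measurable_cst. Qed.

Lemma mvecD f g : mvec f -> mvec g -> mvec (fun w => f w + g w).
Proof.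
move=> mf mg; apply: mvecP => i; under eq_fun do rewrite mxE.
by apply: measurable_funD; exact: mvec_coord.
Qed.

Lemma mvecZ (a : T -> R) g : measurable_fun [set: T] a -> mvec g ->
  mvec (fun w => a w *: g w).
Proof.
move=> ma mg; apply: mvecP => i; under eq_fun do rewrite mxE.
by apply: measurable_funM => //; exact: mvec_coord.
Qed.

Lemma mvecB f g : mvec f -> mvec g -> mvec (fun w => f w - g w).
Proof.
move=> mf mg; apply: mvecP => i; under eq_fun do rewrite !mxE.
by apply: measurable_funB; exact: mvec_coord.
Qed.

Lemma measurable_enorm g : mvec g -> measurable_fun [set: T] (fun w => enorm (g w)).
Proof.
move=> mg; apply: (@measurableT_comp _ _ _ _ _ _ (@Num.sqrt R)).
  by apply: nondecreasing_measurable => // x y; exact: ler_wsqrtr.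
apply: measurable_sum => i; apply: measurable_funX; exact: mvec_coord.
Qed.

(** Used for the loops, which run for a random number of passes. *)
Lemma measurable_glue (disp' : measure_display) (U : measurableType disp')
    (g : nat -> T -> U) (N : T -> nat) :
  measurable_fun [set: T] N -> (forall k, measurable_fun [set: T] (g k)) ->
  measurable_fun [set: T] (fun w => g (N w) w).
Proof.
move=> mN mg _ A mA; rewrite setTI.
rewrite (_ : _ @^-1` _ = \bigcup_k ((N @^-1` [set k]) `&` (g k @^-1` A))).
  apply: bigcupT_measurable => k; apply: measurableI.
    by rewrite -[X in measurable X]setTI; exact: mN.
  by rewrite -[X in measurable X]setTI; exact: mg.
apply/seteqP; split => w /=; first by move=> ?; exists (N w).
by move=> [k _ [/= <-]].
Qed.

Lemma measurable_nat_comp (disp' : measure_display) (U : measurableType disp')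
    (h : nat -> U) (N : T -> nat) :
  measurable_fun [set: T] N -> measurable_fun [set: T] (fun w => h (N w)).
Proof.
by move=> mN; apply: (measurable_glue (g := fun k _ => h k)) => // k;
  exact: measurable_cst.
Qed.

End vector_measurability.

Section joint_measurability.
Context {R : realType} {d : nat} {disp : measure_display} {E : measurableType disp}.

(** Equivalent to measurability on the product space, in a form that composes. *)
Definition jointly_measurable (f : 'rV[R]_d -> E -> R) : Prop :=
  forall (disp' : measure_display) (T : measurableType disp')
    (x : T -> 'rV[R]_d) (z : T -> E),
  mvec x -> measurable_fun [set: T] z ->
  measurable_fun [set: T] (fun w => f (x w) (z w)).

(** A limit of difference quotients along the steps 1 / (k + 1). *)
Lemma jointly_measurable_derive f v : jointly_measurable f ->
  (forall z x, derivable (f^~ z) x v) ->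
  jointly_measurable (fun x z => 'D_v (f^~ z) x).
Proof.
move=> mf df disp' T x z mx mz.
apply: (@measurable_fun_cvg _ _ _ _ (fun k w => k.+1%:R *
   (f (k.+1%:R^-1 *: v + x w) (z w) - f (x w) (z w)))) => [k|w _].
  apply: measurable_funM; first exact: measurable_cst.
  apply: measurable_funB; last exact: mf.
  by apply: mf => //; apply: mvecD => //; exact: mvec_cst.
have h0 : k.+1%:R^-1 @[k --> \oo] --> (0 : R)^'.
  move=> A A0.
  have H : \forall k \near \oo, (harmonic k : R) != 0 -> A (harmonic k).
    exact: (@cvg_harmonic R _ A0).
  rewrite /nbhs /=; apply: filterS H => k; apply.
  by apply: lt0r_neq0; exact: harmonic_gt0.
have := df (z w) (x w) => /(cvg_comp _ _ h0).
rewrite /= => H.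
have E1 : (fun k : nat => k.+1%:R * (f (k.+1%:R^-1 *: v + x w) (z w) - f (x w) (z w)))
  = (fun k : nat => (k.+1%:R^-1)^-1 *: (f (k.+1%:R^-1 *: v + x w) (z w) - f (x w) (z w))).
  by apply/funext => k; rewrite invrK.
rewrite E1; exact: H.
Qed.

End joint_measurability.


Section derivatives_measurability.
Context {R : realType} {d : nat} {disp : measure_display} {E : measurableType disp}.
Variable f : 'rV[R]_d -> E -> R.
Hypothesis mf : jointly_measurable f.
Hypothesis df : forall z x, differentiable (f^~ z) x.
Hypothesis ddf : forall z x, differentiable (grad (f^~ z)) x.

Lemma jointly_measurable_dot_grad v :
  jointly_measurable (fun x z => dot (grad (f^~ z) x) v).
Proof.
have := jointly_measurable_derive (v := v) mf
  (fun z x => diff_derivable (df z x)).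
by under eq_fun do under eq_fun do rewrite derive_grad //.
Qed.

Lemma jointly_measurable_hess u v :
  jointly_measurable (fun x z => dot (u *m hess (f^~ z) x) v).
Proof.
have D z x := is_derive_dot_grad u v (ddf z x).
have := jointly_measurable_derive (v := u) (jointly_measurable_dot_grad v)
  (fun z x => @ex_derive _ _ _ _ _ _ _ (D z x)).
by under eq_fun do under eq_fun do rewrite (@derive_val _ _ _ _ _ _ _ (D _ _)).
Qed.

Lemma mvec_grad (disp' : measure_display) (T : measurableType disp')
    (x : T -> 'rV[R]_d) (z : T -> E) : mvec x -> measurable_fun [set: T] z ->
  mvec (fun w => grad (f^~ (z w)) (x w)).
Proof.
move=> mx mz; apply: mvecP => i.
have := jointly_measurable_dot_grad (delta_mx ord0 i) mx mz.
congr (measurable_fun _ _); apply/funext => w; rewrite /dot (bigD1 i) //= big1.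
  by rewrite addr0 [delta_mx _ _ _ _]mxE !eqxx mulr1.
by move=> j /negbTE ji; rewrite [delta_mx _ _ _ _]mxE eqxx ji mulr0.
Qed.

End derivatives_measurability.

Section algorithm_measurability.
Context {R : realType} {d : nat} {disp : measure_display} {T : measurableType disp}.

Definition random_objective (F : T -> 'rV[R]_d -> R) : Prop :=
  (forall x, mvec x -> measurable_fun [set: T] (fun w => F w (x w))) /\
  (forall x, mvec x -> mvec (fun w => grad (F w) (x w))).

(** A class of random states that is closed under gluing along a measurable
    index is closed under loops, because a loop is glued from its truncations
    to a fixed number of passes. *)
Lemma measurable_while (S : Type) (MS : (T -> S) -> Prop)
    (m : S -> nat) (c : T -> S -> bool) (body : T -> S -> S) :
  (forall (g : nat -> T -> S) N, measurable_fun [set: T] N ->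
     (forall k, MS (g k)) -> MS (fun w => g (N w) w)) ->
  (forall s, MS s -> measurable_fun [set: T] (fun w => m (s w))) ->
  (forall s, MS s -> measurable_fun [set: T] (fun w => c w (s w))) ->
  (forall s, MS s -> MS (fun w => body w (s w))) ->
  forall s, MS s -> MS (fun w => while m (c w) (body w) (s w)).
Proof.
move=> glue mm mc mb s ms.
have MS_if b s1 s2 : measurable_fun [set: T] b -> MS s1 -> MS s2 ->
    MS (fun w => if b w then s1 w else s2 w).
  move=> mb' ms1 ms2.
  rewrite (_ : (fun w => _) =
    (fun w => (fun k => if k is 0%N then s2 else s1) (nat_of_bool (b w)) w)).
    apply: (glue (fun k => if k is 0%N then s2 else s1) (fun w => nat_of_bool (b w))) => [|[]] //.
    by apply: (@measurableT_comp _ _ _ _ _ _ nat_of_bool).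
  by apply/funext => w; case: (b w).
apply: (glue (fun k w => while_fuel (c w) (body w) k (s w)) (fun w => m (s w))).
  exact: mm.
move=> k; elim: k s ms => [|k IH] s ms //=.
by apply: MS_if => //; [exact: mc|exact: (IH (fun w => body w (s w)) (mb _ ms))].
Qed.


Section one_call.
Variables (Cgrad Ceval n : nat) (tau beta : R) (F : T -> 'rV[R]_d -> R).
Hypothesis mF : random_objective F.

Definition mls (s : T -> ls_state R) : Prop :=
  [/\ measurable_fun [set: T] (fun w => ls_v (s w)),
      measurable_fun [set: T] (fun w => ls_g (s w)) &
      measurable_fun [set: T] (fun w => ls_budget (s w))].

(** An optional gradient is measured through its tag and its content, with the
    content 0 when there is none. *)
Definition mgd (s : T -> gd_state R d) : Prop :=
  [/\ mvec (fun w => gd_x (s w)),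
      measurable_fun [set: T] (fun w => isSome (gd_G (s w))) /\
        mvec (fun w => odflt 0 (gd_G (s w))),
      measurable_fun [set: T] (fun w => gd_g (s w)) &
      measurable_fun [set: T] (fun w => gd_budget (s w))].

Lemma mls_glue (g : nat -> T -> ls_state R) N : measurable_fun [set: T] N ->
  (forall k, mls (g k)) -> mls (fun w => g (N w) w).
Proof.
move=> mN mg; split.
- by apply: (measurable_glue (g := fun k w => ls_v (g k w))) => // k; case: (mg k).
- by apply: (measurable_glue (g := fun k w => ls_g (g k w))) => // k; case: (mg k).
- by apply: (measurable_glue (g := fun k w => ls_budget (g k w))) => // k; case: (mg k).
Qed.

Lemma mgd_glue (g : nat -> T -> gd_state R d) N : measurable_fun [set: T] N ->
  (forall k, mgd (g k)) -> mgd (fun w => g (N w) w).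
Proof.
move=> mN mg; split.
- by apply: (measurable_glue (g := fun k w => gd_x (g k w) : borel _)) => // k;
    case: (mg k).
- split.
    apply: (measurable_glue (g := fun k w => isSome (gd_G (g k w)))) => // k.
    by case: (mg k) => _ [].
  apply: (measurable_glue (g := fun k w => odflt 0 (gd_G (g k w)) : borel _)) => // k.
  by case: (mg k) => _ [].
- by apply: (measurable_glue (g := fun k w => gd_g (g k w))) => // k; case: (mg k).
- by apply: (measurable_glue (g := fun k w => gd_budget (g k w))) => // k; case: (mg k).
Qed.

Lemma mgd_if b s1 s2 : measurable_fun [set: T] b -> mgd s1 -> mgd s2 ->
  mgd (fun w => if b w then s1 w else s2 w).
Proof.
move=> mb ms1 ms2.
rewrite (_ : (fun w => _) =
  (fun w => (fun k => if k is 0%N then s2 else s1) (nat_of_bool (b w)) w)).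
  apply: (mgd_glue (g := fun k => if k is 0%N then s2 else s1) (N := fun w => nat_of_bool (b w))) => [|[]] //.
  by apply: (@measurableT_comp _ _ _ _ _ _ nat_of_bool).
by apply/funext => w; case: (b w).
Qed.

Lemma measurable_armijo (G : T -> 'rV[R]_d) g s : mvec G -> measurable_fun [set: T] g -> mls s ->
  measurable_fun [set: T] (fun w => armijo (G w) (g w) (s w)).
Proof.
move=> mG mg [mv mls_g _]; apply: measurable_fun_ler => //.
apply: measurable_funB => //; apply: measurable_funM.
  by apply: measurable_funM => //; exact: measurable_cst.
by apply: measurable_funX; exact: measurable_enorm.
Qed.

Lemma measurable_leq_nat (k : nat) (N : T -> nat) : measurable_fun [set: T] N ->
  measurable_fun [set: T] (fun w => (k <= N w)%N).
Proof. exact: (measurable_nat_comp (fun b => (k <= b)%N)). Qed.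

Lemma mls_line_search (x G : T -> 'rV[R]_d) g b : mvec x -> mvec G -> measurable_fun [set: T] g ->
  measurable_fun [set: T] b ->
  mls (fun w => line_search Ceval (F w) n beta (x w) (G w) (g w) (b w)).
Proof.
move=> mx mG mg mb; have [mF1 mF2] := mF.
apply: (measurable_while (c := fun w => ls_guard Ceval n (G w) (g w))
  (body := fun w => ls_body Ceval (F w) n beta (x w) (G w))).
- exact: mls_glue.
- by move=> s [].
- move=> s ms; apply: measurable_and; last by apply: measurable_leq_nat; case: ms.
  apply: (@measurableT_comp _ _ _ _ _ _ negb) => //; exact: measurable_armijo.
- move=> s [mv ms1 ms2].
  have mbv : measurable_fun [set: T] (fun w => beta * ls_v (s w)).
    by apply: measurable_funM => //; exact: measurable_cst.
  split => //=.
    by apply: mF1; apply: mvecB => //; exact: mvecZ.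
  exact: (measurable_nat_comp (fun b => (b - n * Ceval)%N)).
- split => //=; first by apply: mF1; exact: mvecB.
  exact: (measurable_nat_comp (fun b => (b - n * Ceval)%N)).
Qed.

Lemma mgd_body s : mgd s -> mgd (fun w => gd_body Cgrad Ceval (F w) n beta (s w)).
Proof.
move=> ms; have [mx [mS mG] mg mb] := ms; have [mF1 mF2] := mF.
pose G w := odflt 0 (gd_G (s w)).
pose r w := line_search Ceval (F w) n beta (gd_x (s w)) (G w) (gd_g (s w)) (gd_budget (s w)).
have mr : mls r by exact: mls_line_search.
pose x w := gd_x (s w) - ls_v (r w) *: G w.
have mx' : mvec x by apply: mvecB => //; apply: mvecZ => //; case: mr.
rewrite (_ : (fun w => _) = (fun w =>
  if isSome (gd_G (s w)) then
    if armijo (G w) (gd_g (s w)) (r w) then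
      if (n * Cgrad <= ls_budget (r w))%N
      then GdState (x w) (Some (grad (F w) (x w))) (ls_g (r w)) (ls_budget (r w) - n * Cgrad)
      else GdState (x w) None (ls_g (r w)) (ls_budget (r w))
    else GdState (gd_x (s w)) (gd_G (s w)) (gd_g (s w)) (ls_budget (r w))
  else s w)); last first.
  by apply/funext => w; rewrite /gd_body /x /r /G; case: (gd_G (s w)).
have [_ mr2 mr3] := mr.
apply: mgd_if => //; apply: mgd_if; first exact: measurable_armijo; last first.
  by split => //=.
apply: mgd_if; first exact: measurable_leq_nat.
- split => //=; first by split; [exact: measurable_cst|exact: mF2].
  exact: (measurable_nat_comp (fun b => (b - n * Cgrad)%N)).
- by split => //=; split; [exact: measurable_cst|exact: mvec_cst].
Qed.

Lemma mgd_init x b : mvec x -> measurable_fun [set: T] b ->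
  mgd (fun w => gd_init Cgrad Ceval (F w) n (x w) (b w)).
Proof.
move=> mx mb; have [mF1 mF2] := mF.
have mB k : measurable_fun [set: T] (fun w => (b w - k)%N).
  exact: (measurable_nat_comp (fun b => (b - k)%N)).
rewrite (_ : (fun w => _) = (fun w =>
  if (n * Cgrad <= b w)%N then
    if (n * Ceval <= b w - n * Cgrad)%N
    then GdState (x w) (Some (grad (F w) (x w))) (F w (x w)) (b w - n * Cgrad - n * Ceval)
    else GdState (x w) (Some (grad (F w) (x w))) 0 (b w - n * Cgrad)
  else if (n * Ceval <= b w)%N
    then GdState (x w) None (F w (x w)) (b w - n * Ceval)
    else GdState (x w) None 0 (b w))); last first.
  by apply/funext => w; rewrite /gd_init; do 2 case: ifP => ?.
apply: mgd_if; first exact: measurable_leq_nat.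
- apply: mgd_if; first exact: measurable_leq_nat.
  + split => //=; first by split; [exact: measurable_cst|exact: mF2].
      exact: mF1.
    exact: (measurable_nat_comp (fun b => (b - n * Cgrad - n * Ceval)%N)).
  + split => //=; first by split; [exact: measurable_cst|exact: mF2].
- apply: mgd_if; first exact: measurable_leq_nat.
  + split => //=; first by split; [exact: measurable_cst|exact: mvec_cst].
    exact: mF1.
  + split => //=; first by split; [exact: measurable_cst|exact: mvec_cst].
Qed.

Lemma measurable_gd x b : mvec x -> measurable_fun [set: T] b ->
  let g w := gd Cgrad Ceval (F w) n tau beta (x w) (b w) in
  mvec (fun w => (g w).1) /\ measurable_fun [set: T] (fun w => (g w).2).
Proof.
move=> mx mb g.
suff [] : mgd (fun w => while (@gd_budget R d) (gd_guard Ceval n tau)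
  (gd_body Cgrad Ceval (F w) n beta) (gd_init Cgrad Ceval (F w) n (x w) (b w))) by [].
apply: (measurable_while (c := fun w => gd_guard Ceval n tau)
  (body := fun w => gd_body Cgrad Ceval (F w) n beta)).
- exact: mgd_glue.
- by move=> s [].
- move=> s [_ [mS mG] _ mb'].
  rewrite (_ : (fun w => _) = (fun w => isSome (gd_G (s w)) &&
    ((tau < enorm (odflt 0 (gd_G (s w)))) && (n * Ceval <= gd_budget (s w))%N))).
    apply: measurable_and => //; apply: measurable_and; last exact: measurable_leq_nat.
    by apply: measurable_fun_ltr; [exact: measurable_cst|exact: measurable_enorm].
  by apply/funext => w; rewrite /gd_guard; case: (gd_G (s w)).
- exact: mgd_body.
- exact: mgd_init.
Qed.

End one_call.

Lemma measurable_multi (Cgrad Ceval : nat) (F : nat -> T -> 'rV[R]_d -> R)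
    x0 B (alpha' delta kappa tau beta : R) J :
  (forall n, random_objective (F n)) ->
  mvec (fun w => multi Cgrad Ceval (fun n => F n w) x0 B alpha' delta J kappa tau beta).
Proof.
move=> mF; rewrite /multi.
pose S j w := multi_state Cgrad Ceval (fun n => F n w) x0 B alpha' delta kappa tau beta j.
suff [] : mvec (fun w => (S J w).1) /\ measurable_fun [set: T] (fun w => (S J w).2) by [].
elim: J => [|j [IH1 IH2]].
  by split; [exact: mvec_cst|exact: measurable_cst].
have [g1 g2] := measurable_gd Cgrad Ceval (stage_size kappa delta B j.+1)
  (stage_tolerance tau alpha' delta B j.+1) beta
  (mF (stage_size kappa delta B j.+1)) IH1 IH2.
have E w : S j.+1 w = if (0 < (S j w).2)%N then
    gd Cgrad Ceval (F (stage_size kappa delta B j.+1) w) (stage_size kappa delta B j.+1)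
     (stage_tolerance tau alpha' delta B j.+1) beta (S j w).1 (S j w).2
    else S j w.
  by rewrite {1}/S /= -/(S j w); case: (S j w).
split.
- under eq_fun do rewrite E (fun_if fst).
  by apply: measurable_fun_ifT => //; exact: measurable_leq_nat.
- under eq_fun do rewrite E (fun_if snd).
  by apply: measurable_fun_ifT => //; exact: measurable_leq_nat.
Qed.

End algorithm_measurability.


(** * Sums of independent copies *)

Section real_probability.
Context {R : realType} {disp : measure_display} {T : measurableType disp}.
Variable P : probability T R.
Implicit Types (A B : set T) (X Y : T -> R).

Definition pr A : R := fine (P A).
Definition intg X : Prop := P.-integrable setT (EFin \o X).
Definition Ex X : R := \int[P]_w X w.

Lemma prE A : measurable A -> P A = (pr A)%:E.
Proof. by move=> mA; rewrite /pr fineK // fin_num_measure. Qed.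

Lemma pr_ge0 A : 0 <= pr A. Proof. by rewrite fine_ge0. Qed.

Lemma pr_le A B : measurable A -> measurable B -> A `<=` B -> pr A <= pr B.
Proof.
by move=> mA mB AB; rewrite -lee_fin -!prE // le_measure // inE.
Qed.

Lemma pr_setU A B : measurable A -> measurable B -> pr (A `|` B) <= pr A + pr B.
Proof.
move=> mA mB; rewrite -lee_fin EFinD -!prE //; last exact: measurableU.
exact: measureU2.
Qed.

Lemma pr_bigU (I : Type) (s : seq I) (A : I -> set T) : (forall i, measurable (A i)) ->
  pr (\big[setU/set0]_(i <- s) A i) <= \sum_(i <- s) pr (A i).
Proof.
move=> mA; elim: s => [|i s IH]; first by rewrite !big_nil /pr measure0.
rewrite !big_cons (le_trans (pr_setU _ _)) //; last by rewrite lerD2l.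
by apply: bigsetU_measurable.
Qed.

Lemma intg_bounded X c : measurable_fun setT X -> (forall w, `|X w| <= c) -> intg X.
Proof.
move=> mX Xc; apply: measurable_bounded_integrable => //.
  by rewrite ltey_eq fin_num_measure.
by exists c; split; [exact: num_real|move=> t ct w _; exact: le_trans (Xc w) (ltW ct)].
Qed.

Lemma intg_meas X : intg X -> measurable_fun setT X.
Proof. by move=> /integrableP[/measurable_EFinP]. Qed.

Lemma intg_le X Y : measurable_fun setT X -> (forall w, `|X w| <= `|Y w|) ->
  intg Y -> intg X.
Proof.
move=> mX XY; apply: le_integrable => //; first exact/measurable_EFinP.
by move=> w _; rewrite /= lee_fin.
Qed.

Lemma intgD X Y : intg X -> intg Y -> intg (fun w => X w + Y w).
Proof. by move=> iX iY; exact: (integrableD measurableT iX iY). Qed.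

Lemma intgZ k X : intg X -> intg (fun w => k * X w).
Proof. by move=> iX; exact: (integrableZl measurableT k iX). Qed.

Lemma intgB X Y : intg X -> intg Y -> intg (fun w => X w - Y w).
Proof. by move=> iX iY; exact: (integrableB measurableT iX iY). Qed.

Lemma intg_cst k : intg (fun=> k).
Proof. exact: finite_measure_integrable_cst. Qed.

Lemma intg_norm X : intg X -> intg (fun w => `|X w|).
Proof. by move=> iX; exact: (integrable_abse iX). Qed.

Lemma intg_sum (I : Type) (s : seq I) (X : I -> T -> R) :
  (forall i, intg (X i)) -> intg (fun w => \sum_(i <- s) X i w).
Proof.
move=> iX; elim: s => [|i s IH].
  by under eq_fun do rewrite big_nil; exact: intg_cst.
by under eq_fun do rewrite big_cons; exact: intgD.
Qed.

Lemma ExD X Y : intg X -> intg Y -> Ex (fun w => X w + Y w) = Ex X + Ex Y.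
Proof. by move=> iX iY; rewrite /Ex RintegralD. Qed.

Lemma ExB X Y : intg X -> intg Y -> Ex (fun w => X w - Y w) = Ex X - Ex Y.
Proof. by move=> iX iY; rewrite /Ex RintegralB. Qed.

Lemma ExZ k X : intg X -> Ex (fun w => k * X w) = k * Ex X.
Proof. by move=> iX; rewrite /Ex RintegralZl. Qed.

Lemma Ex_cst k : Ex (fun=> k) = k.
Proof. by rewrite /Ex Rintegral_cst // [fine _](congr1 fine (probability_setT P)) mulr1. Qed.

Lemma Ex_sum (I : Type) (s : seq I) (X : I -> T -> R) : (forall i, intg (X i)) ->
  Ex (fun w => \sum_(i <- s) X i w) = \sum_(i <- s) Ex (X i).
Proof.
move=> iX; elim: s => [|i s IH].
  by rewrite big_nil; under [Ex _]eq_Rintegral do rewrite big_nil; exact: Ex_cst.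
rewrite big_cons -IH -ExD //; last exact: intg_sum.
by apply: eq_Rintegral => w _; rewrite big_cons.
Qed.

Lemma Ex_le X Y : intg X -> intg Y -> (forall w, X w <= Y w) -> Ex X <= Ex Y.
Proof. by move=> iX iY XY; apply: le_Rintegral. Qed.

(** Both variables are cut off to 0 on the exceptional null set. *)
Lemma Ex_le_ae X Y : intg X -> intg Y -> {ae P, forall w, X w <= Y w} ->
  Ex X <= Ex Y.
Proof.
move=> iX iY [N [mN N0 XY]].
pose cut (Z : T -> R) w := Z w * \1_(~` N) w.
have mC : measurable (~` N) by exact: measurableC.
have icut Z : intg Z -> intg (cut Z).
  move=> iZ; apply: (intg_le _ _ iZ).
    by apply: measurable_funM; [exact: intg_meas|exact: measurable_indic].
  move=> w; rewrite normrM ler_piMr // indicE.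
  by case: (_ \in _); rewrite ?normr1 ?normr0.
have Ecut Z : intg Z -> Ex Z = Ex (cut Z).
  move=> iZ; congr fine; apply: ae_eq_integral => //.
  - by apply/measurable_EFinP; exact: intg_meas.
  - by apply/measurable_EFinP; apply: intg_meas; exact: icut.
  exists N; split => // w /= H; apply: contrapT => Nw; apply: H => _.
  by rewrite /cut indicE mem_set // mulr1.
rewrite (Ecut X) // (Ecut Y) //; apply: Ex_le; [exact: icut|exact: icut|].
move=> w; rewrite /cut indicE; have [wN|wN] := pselect (N w).
  by rewrite memNset; [rewrite !mulr0|move=> /(_ wN)].
rewrite mem_set // !mulr1; apply: contrapT => XYw; apply: wN; exact: XY.
Qed.

Lemma Ex_ge0 X : (forall w, 0 <= X w) -> 0 <= Ex X.
Proof. by move=> X0; apply: Rintegral_ge0. Qed.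

Lemma Ex_indic A : measurable A -> Ex (\1_A) = pr A.
Proof. by move=> mA; rewrite /Ex /Rintegral integral_indic // setIT. Qed.

Lemma intg_indic A : measurable A -> intg (\1_A).
Proof.
move=> mA; apply: (@intg_bounded _ 1) => [|w]; first exact: measurable_indic.
by rewrite indicE; case: (_ \in _); rewrite ?normr1 ?normr0.
Qed.

Lemma pr_markov X u : 0 < u -> intg X -> (forall w, 0 <= X w) ->
  pr [set w | u <= X w] <= Ex X / u.
Proof.
move=> u0 iX X0; have mA : measurable [set w | u <= X w].
  by rewrite -[X in measurable X]setTI; apply: measurable_fun_le => //; exact: intg_meas.
rewrite ler_pdivlMr // mulrC -Ex_indic // -ExZ; last exact: intg_indic.
apply: Ex_le => //; first by apply: intgZ; exact: intg_indic.
move=> w; rewrite indicE; have [|] := boolP (w \in _).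
  by rewrite inE mulr1.
by rewrite mulr0.
Qed.

Lemma Ex_dominated (X : nat -> T -> R) (Y : T -> R) : intg Y ->
  (forall n, measurable_fun setT (X n)) -> (forall n w, `|X n w| <= Y w) ->
  (forall w, X n w @[n --> \oo] --> 0) -> Ex (X n) @[n --> \oo] --> 0.
Proof.
move=> iY mX XY X0.
have := @dominated_cvg _ _ _ P setT measurableT (fun n => EFin \o X n) (cst 0%E)
  (EFin \o Y).
rewrite integral_cst // mul0e => H.
apply: fine_cvg; apply: H => //.
- by move=> n; exact/measurable_EFinP.
- by move=> w _; apply/fine_cvgP; split; [near=> n|exact: X0].
- by move=> n w _; rewrite /= lee_fin.
Unshelve. all: by end_near. Qed.

End real_probability.


Lemma measurable_gt_set {R : realType} (disp : measure_display)
    (T : measurableType disp) (X : T -> R) t :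
  measurable_fun setT X -> measurable [set w | t < X w].
Proof.
move=> mX; rewrite (_ : [set w | _] = setT `&` X @^-1` `]t, +oo[); first exact: mX.
by rewrite setTI; apply/seteqP; split => w /=; rewrite in_itv /= andbT.
Qed.

Lemma measurable_ge_set {R : realType} (disp : measure_display)
    (T : measurableType disp) (X : T -> R) t :
  measurable_fun setT X -> measurable [set w | t <= X w].
Proof.
move=> mX; rewrite (_ : [set w | _] = setT `&` X @^-1` `[t, +oo[); first exact: mX.
by rewrite setTI; apply/seteqP; split => w /=; rewrite in_itv /= andbT.
Qed.

Lemma measurable_abs {R : realType} (disp : measure_display)
    (T : measurableType disp) (X : T -> R) :
  measurable_fun setT X -> measurable_fun setT (fun w => `|X w|).
Proof. exact: (measurableT_comp (@normr_measurable R setT)). Qed.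

Section copies.
Context {R : realType} {disp disp' : measure_display} {T : measurableType disp}
  {E : measurableType disp'}.
Variable P : probability T R.
Variables (Z : {RV P >-> E}) (Zs : nat -> {RV P >-> E}).
Hypothesis Ziid : iid_copies P Z (fun i => Zs i : T -> E).
Local Notation Ex := (Ex P).
Local Notation pr := (pr P).
Local Notation intg := (intg P).
Implicit Types (g : E -> R) (n : nat) (t u : R).

Let mZ (W : {RV P >-> E}) : measurable_fun setT W. Proof. exact: measurable_funP. Qed.

Lemma meas_copy g i : measurable_fun setT g -> measurable_fun setT (fun w => g (Zs i w)).
Proof. by move=> mg; apply: (measurableT_comp mg). Qed.

Lemma meas_orig g : measurable_fun setT g -> measurable_fun setT (fun w => g (Z w)).
Proof. by move=> mg; apply: (measurableT_comp mg). Qed.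

Lemma copy_pr i (A : set E) : measurable A -> pr (Zs i @^-1` A) = pr (Z @^-1` A).
Proof. by move=> mA; rewrite /pr; case: Ziid => _ ->. Qed.

Let pushE i (A : set E) : measurable A -> A `<=` setT ->
  pushforward P (Zs i) A = pushforward P Z A.
Proof. by move=> mA _; case: Ziid => _; apply. Qed.

Let lawE i (h : E -> \bar R) :
  (\int[pushforward P (Zs i)]_y h y = \int[pushforward P Z]_y h y)%E.
Proof.
exact: (@eq_measure_integral _ _ _ setT (distribution P Z) (distribution P (Zs i)) h
  (pushE i)).
Qed.

Lemma copy_intg g i : measurable_fun setT g -> intg (fun w => g (Z w)) ->
  intg (fun w => g (Zs i w)).
Proof.
move=> mg /integrableP[_ ig]; apply/integrableP; split.
  by apply/measurable_EFinP; exact: meas_copy.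
have mag : measurable_fun setT (fun y => `|(g y)%:E|%E).
  by apply: measurableT_comp => //; exact/measurable_EFinP.
have := @ge0_integral_pushforward _ _ _ _ _ _ (mZ (Zs i)) P setT _ measurableT mag
  (fun _ _ => abse_ge0 _).
have := @ge0_integral_pushforward _ _ _ _ _ _ (mZ Z) P setT _ measurableT mag
  (fun _ _ => abse_ge0 _).
rewrite lawE => -> /= H; move: ig.
by rewrite -H.
Qed.

Lemma copy_Ex g i : measurable_fun setT g -> intg (fun w => g (Z w)) ->
  Ex (fun w => g (Zs i w)) = Ex (fun w => g (Z w)).
Proof.
move=> mg ig; have igi := copy_intg i mg ig.
have mg' : measurable_fun setT (EFin \o g) by exact/measurable_EFinP.
have := @integral_pushforward _ _ _ _ _ _ (mZ (Zs i)) P setT _ mg' igi measurableT.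
have := @integral_pushforward _ _ _ _ _ _ (mZ Z) P setT _ mg' ig measurableT.
by rewrite lawE => -> /= H; congr fine.
Qed.

(** The joint law of two distinct copies is the product law, so that
    expectations of products factor. *)
Lemma copy_prod g c i j : i != j -> measurable_fun setT g ->
  (forall z, `|g z| <= c) ->
  Ex (fun w => g (Zs i w) * g (Zs j w)) = Ex (fun w => g (Z w)) ^+ 2.
Proof.
move=> ij mg gc.
pose XY w := (Zs i w, Zs j w).
have mXY : measurable_fun setT XY by exact: measurable_fun_pair.
pose pXY : {mfun T >-> (E * E)%type} := HB.pack XY (isMeasurableFun.Build _ _ _ _ _ mXY).
pose m1 := distribution P (Zs i); pose m2 := distribution P (Zs j).
pose m' := distribution P pXY.
have m12 : forall S : set (E * E), measurable S -> (m1 \x m2)%E S = m' S.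
  apply: product_measure_unique => A B mA mB.
  have [/(_ [:: i; j] (fun k => if k == i then A else B))] := Ziid.
  rewrite /= inE ij /= => /(_ isT) H _.
  have := H (fun k => match k == i as b return measurable (if b then A else B) with
    true => mA | false => mB end).
  rewrite !big_cons big_nil mule1 eqxx eq_sym (negbTE ij) => <-.
  congr (P _); apply/seteqP; split => w /=.
    move=> [wA wB] k /=; rewrite !inE => /orP[/eqP->|/eqP->]; first by rewrite eqxx.
    by rewrite eq_sym (negbTE ij).
  move=> H'; split.
    by have := H' i; rewrite /= !inE eqxx => /(_ isT).
  by have := H' j; rewrite /= !inE eqxx orbT eq_sym (negbTE ij) => /(_ isT).
pose G (z : E * E) := (g z.1 * g z.2)%:E.
have mG : measurable_fun setT (fun z : E * E => g z.1 * g z.2).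
  by apply: measurable_funM; apply: measurableT_comp.
have mGE : measurable_fun setT G by exact/measurable_EFinP.
have c0 : 0 <= c by apply: le_trans (gc point).
have Gc z : `|g z.1 * g z.2| <= c * c by rewrite normrM ler_pM.
have iG : (m1 \x m2)%E.-integrable setT G.
  apply: measurable_bounded_integrable => //.
    by rewrite [X in (X < _)%E](m12 _ measurableT) ltey_eq fin_num_measure.
  by exists (c * c); split; [exact: num_real|move=> t ct z _; exact: le_trans (Gc z) (ltW ct)].
have igi k : intg (fun w => g (Zs k w)).
  by apply: (@intg_bounded _ _ _ _ _ c); [exact: meas_copy|].
have ig : intg (fun w => g (Z w)).
  by apply: (@intg_bounded _ _ _ _ _ c); [exact: meas_orig|].
have iGX : P.-integrable (XY @^-1` setT) (G \o XY).
  by apply: (@intg_bounded _ _ _ _ (fun w => g (Zs i w) * g (Zs j w)) (c * c));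
    [apply: measurable_funM; exact: meas_copy|move=> w; exact: (Gc (XY w))].
have mg' : measurable_fun setT (EFin \o g) by exact/measurable_EFinP.
have e1 := @integral_pushforward _ _ _ _ _ _ mXY P setT _ mGE iGX measurableT.
have e2 := integral12_prod_meas1 iG.
have e3 k : (\int[distribution P (Zs k)]_y (g y)%:E)%E = (Ex (fun w => g (Z w)))%:E.
  rewrite /distribution
    (@integral_pushforward _ _ _ _ _ _ (mZ (Zs k)) P setT _ mg' (igi k) measurableT).
  rewrite -(copy_Ex k mg ig) /Ex /Rintegral fineK //.
  by apply: integrable_fin_num => //; exact: igi.
rewrite /Ex /Rintegral [X in fine X](_ : _ = (Ex (fun w => g (Z w)) ^+ 2)%:E) //.
rewrite -[LHS]/(\int[P]_(x in XY @^-1` setT) (G \o XY) x)%E -e1.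
have -> : (\int[pushforward P XY]_y G y = \int[m1 \x m2]_y G y)%E.
  by apply: (@eq_measure_integral _ _ _ setT (m1 \x m2)%E m') => A mA _; exact/esym/m12.
rewrite -e2 expr2.
under eq_integral => x _.
  rewrite /fubini_F /G /=.
  under eq_integral do rewrite EFinM.
  rewrite integralZl //; last first.
    apply: measurable_bounded_integrable => //.
      by rewrite /m2 ltey_eq fin_num_measure.
    by exists c; split; [exact: num_real|move=> t ct z _; exact: le_trans (gc z) (ltW ct)].
  rewrite e3 muleC.
  over.
rewrite integralZl //; last first.
  apply: measurable_bounded_integrable => //.
    by rewrite /m1 ltey_eq fin_num_measure.
  by exists c; split; [exact: num_real|move=> t ct z _; exact: le_trans (gc z) (ltW ct)].
by rewrite e3 EFinM.
Qed.


(** Uncorrelated summands: the variance of the sum is the sum of variances. *)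
Lemma copies_chebyshev g c n u : measurable_fun setT g -> (forall z, `|g z| <= c) ->
  0 < u ->
  pr [set w | u <= `|\sum_(i < n) g (Zs i w) - n%:R * Ex (fun w => g (Z w))|]
    <= n%:R * Ex (fun w => g (Z w) ^+ 2) / u ^+ 2.
Proof.
move=> mg gc u0; set mu := Ex (fun w => g (Z w)).
have c0 : 0 <= c by apply: le_trans (gc point).
have ig : intg (fun w => g (Z w)).
  by apply: (@intg_bounded _ _ _ _ _ c); [exact: meas_orig|].
have mug : `|mu| <= c.
  apply: (le_trans (le_normr_Rintegral measurableT ig)).
  rewrite -[leRHS](@Ex_cst _ _ _ P); apply: Ex_le => //; first exact: intg_norm.
  exact: intg_cst.
pose G z := g z - mu.
have mG : measurable_fun setT G by apply: measurable_funB.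
have Gc z : `|G z| <= c + c by rewrite (le_trans (ler_normB _ _)) // lerD.
have iG2 : intg (fun w => G (Z w) ^+ 2).
  apply: (@intg_bounded _ _ _ _ _ ((c + c) ^+ 2)).
    by apply: measurable_funX; exact: meas_orig.
  by move=> w; rewrite normrX lerXn2r // nnegrE addr_ge0.
have iGZ : intg (fun w => G (Z w)).
  by apply: (@intg_bounded _ _ _ _ _ (c + c)); [exact: meas_orig|].
have EG0 : Ex (fun w => G (Z w)) = 0.
  by rewrite /G ExB ?Ex_cst ?subrr //; exact: intg_cst.
have ig2 : intg (fun w => g (Z w) ^+ 2).
  apply: (@intg_bounded _ _ _ _ _ (c ^+ 2)).
    by apply: measurable_funX; exact: meas_orig.
  by move=> w; rewrite normrX lerXn2r // nnegrE.
have EG2 : Ex (fun w => G (Z w) ^+ 2) <= Ex (fun w => g (Z w) ^+ 2).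
  rewrite (_ : Ex (fun w => G (Z w) ^+ 2) =
    Ex (fun w => (g (Z w) ^+ 2 - (2 * mu) * g (Z w)) + mu ^+ 2)).
    have i1 : intg (fun w => 2 * mu * g (Z w)) by exact: intgZ.
    have i2 : intg (fun w => g (Z w) ^+ 2 - 2 * mu * g (Z w)) by exact: intgB.
    rewrite (ExD i2 (intg_cst P _)) (ExB ig2 i1) (ExZ _ ig) Ex_cst -/mu.
    by have := sqr_ge0 mu; rewrite expr2; lra.
  by apply: eq_Rintegral => w _; rewrite /G; ring.
pose S w := \sum_(i < n) G (Zs i w).
have SE w : \sum_(i < n) g (Zs i w) - n%:R * mu = S w.
  by rewrite /S /G sumrB sumr_const card_ord mulr_natl.
have iGG i j : intg (fun w => G (Zs i w) * G (Zs j w)).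
  apply: (@intg_bounded _ _ _ _ _ ((c + c) * (c + c))).
    by apply: measurable_funM; exact: meas_copy.
  by move=> w; rewrite normrM ler_pM.
have S2E w : S w ^+ 2 = \sum_(i < n) \sum_(j < n) G (Zs i w) * G (Zs j w).
  by rewrite expr2 mulr_suml; apply: eq_bigr => i _; rewrite mulr_sumr.
have iS2 : intg (fun w => S w ^+ 2).
  by under eq_fun do rewrite S2E; apply: intg_sum => i; exact: intg_sum.
have ES2 : Ex (fun w => S w ^+ 2) = n%:R * Ex (fun w => G (Z w) ^+ 2).
  transitivity (Ex (fun w => \sum_(i < n) \sum_(j < n) G (Zs i w) * G (Zs j w))).
    by apply: eq_Rintegral => w _; exact: S2E.
  rewrite Ex_sum; last by move=> i; exact: intg_sum.
  rewrite mulr_natl -[n in RHS]card_ord -sumr_const; apply: eq_bigr => i _.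
  rewrite Ex_sum // (bigD1 i) //= big1 ?addr0 => [|j ji].
    rewrite -(@copy_Ex (fun z => G z ^+ 2) i) //; first exact: measurable_funX.
  by rewrite (copy_prod _ mG Gc) ?EG0 ?expr0n // eq_sym; apply: contra ji => /eqP/ord_inj ->.
rewrite (_ : [set w | _] = [set w | u ^+ 2 <= S w ^+ 2]); last first.
  apply/seteqP; split => w /=; rewrite SE => H.
    by rewrite -[S w ^+ 2]real_normK ?num_real // lerXn2r ?nnegrE // ltW.
  rewrite -ler_sqr ?nnegrE ?(ltW u0) // real_normK ?num_real //.
apply: (le_trans (pr_markov (exprn_gt0 2 u0) iS2 (fun w => sqr_ge0 _))).
by rewrite ES2 ler_wpM2r ?invr_ge0 ?sqr_ge0 // ler_wpM2l.
Qed.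

Definition trunc_at t g z : R := if `|g z| <= t then g z else 0.

Lemma trunc_at_le t g z : 0 <= t -> `|trunc_at t g z| <= t.
Proof. by rewrite /trunc_at; case: ifP => //; rewrite normr0. Qed.

Lemma measurable_trunc_at t g : measurable_fun setT g -> measurable_fun setT (trunc_at t g).
Proof.
move=> mg; apply: measurable_fun_ifT => //.
by apply: measurable_fun_ler => //; exact: measurable_abs.
Qed.

(** A sum of n copies deviates from n times the truncated mean only if a
    summand exceeds the truncation level or the truncated sum deviates. *)
Lemma copies_truncation g n t u : measurable_fun setT g -> 0 <= t -> 0 < u ->
  pr [set w | u <= `|\sum_(i < n) g (Zs i w) - n%:R * Ex (fun w => trunc_at t g (Z w))|]
    <= n%:R * pr [set w | t < `|g (Z w)|]
       + n%:R * Ex (fun w => trunc_at t g (Z w) ^+ 2) / u ^+ 2.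
Proof.
move=> mg t0 u0; have mtg := measurable_trunc_at t mg.
pose A i := [set w | t < `|g (Zs i w)|].
have mlt : measurable [set z : E | t < `|g z|].
  by apply: measurable_gt_set; exact: measurable_abs.
have mA i : measurable (A i).
  rewrite (_ : A i = Zs i @^-1` [set z : E | t < `|g z|]) //.
  by rewrite -[X in measurable X]setTI; exact: mZ.
have mabs (X : T -> R) a : measurable_fun setT X -> measurable [set w | u <= `|X w - a|].
  by move=> mX; apply/measurable_ge_set/measurable_abs/measurable_funB.
set a := n%:R * _.
pose B := [set w | u <= `|\sum_(i < n) trunc_at t g (Zs i w) - a|].
have mB : measurable B by apply: mabs; apply: measurable_sum => i; exact: meas_copy.
apply: (@le_trans _ _ (pr ((\big[setU/set0]_(i < n) A i) `|` B))).
  apply: pr_le.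
  - by apply: mabs; apply: measurable_sum => i; exact: meas_copy.
  - by apply: measurableU => //; exact: bigsetU_measurable.
  move=> w /= H; have [wA|wA] := pselect ((\big[setU/set0]_(i < n) A i) w); first by left.
  right; move: H; rewrite /B /= (eq_bigr (fun i : 'I_n => trunc_at t g (Zs i w))) //.
  move=> i _; rewrite /trunc_at; case: leP => // tg; case: wA.
  by rewrite -bigcup_mkord; exists i => /=.
apply: (le_trans (pr_setU P _ mB)); first exact: bigsetU_measurable.
apply: lerD; last exact: (copies_chebyshev n mtg (fun z => trunc_at_le g z t0) u0).
apply: (le_trans (pr_bigU P _ (fun i : 'I_n => mA i))).
rewrite (eq_bigr (fun=> pr [set w | t < `|g (Z w)|])) => [|i _].
  by rewrite sumr_const card_ord mulr_natl.
exact: (copy_pr i mlt).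
Qed.

End copies.


(** * Events of high probability *)

Section high_probability.
Context {R : realType} {disp : measure_display} {T : measurableType disp}.
Variable P : probability T R.

(** The exceptional sets are part of the definition because Q n need not be
    measurable, and P is meaningful on measurable sets only. *)
Definition whp (Q : nat -> T -> Prop) : Prop := exists A : nat -> set T,
  [/\ forall n, measurable (A n), pr P (A n) @[n --> \oo] --> (0 : R) &
      \forall n \near \oo, forall w, ~ A n w -> Q n w].

Lemma whp_sub Q Q' : whp Q ->
  (\forall n \near \oo, forall w, Q n w -> Q' n w) -> whp Q'.
Proof.
move=> [A [mA A0 AQ]] QQ'; exists A; split => //.
by apply: filterS2 AQ QQ' => n AQ QQ' w /AQ /QQ'.
Qed.

Lemma whp_and Q Q' : whp Q -> whp Q' -> whp (fun n w => Q n w /\ Q' n w).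
Proof.
move=> [A [mA A0 AQ]] [B [mB B0 BQ]]; exists (fun n => A n `|` B n); split.
- by move=> n; exact: measurableU.
- apply: (@squeeze_cvgr _ _ _ _ (fun=> 0) (fun n => pr P (A n) + pr P (B n))).
  + by near=> n; rewrite pr_ge0 pr_setU.
  + exact: cvg_cst.
  + by rewrite -[X in _ --> X]addr0; exact: cvgD.
- apply: filterS2 AQ BQ => n AQ BQ w /not_orP[nA nB].
  by split; [exact: AQ|exact: BQ].
Unshelve. all: by end_near. Qed.

Lemma whp_true Q : (forall n w, Q n w) -> whp Q.
Proof.
move=> HQ; exists (fun=> set0); split => //.
- by rewrite /pr measure0 /=; exact: cvg_cst.
- by near=> n => w _; exact: HQ.
Unshelve. all: by end_near. Qed.

Lemma whp_all_seq (I : eqType) (s : seq I) (Q : I -> nat -> T -> Prop) :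
  (forall i, i \in s -> whp (Q i)) -> whp (fun n w => forall i, i \in s -> Q i n w).
Proof.
elim: s => [|i s IH] H; first exact: whp_true.
have H1 : whp (Q i) by apply: H; rewrite inE eqxx.
have H2 : whp (fun n w => forall i, i \in s -> Q i n w).
  by apply: IH => j js; apply: H; rewrite inE js orbT.
apply: whp_sub (whp_and H1 H2) _; near=> n => w [Qi Qs] j.
by rewrite inE => /orP[/eqP ->|/Qs].
Unshelve. all: by end_near. Qed.

Lemma whp_all (I : finType) (Q : I -> nat -> T -> Prop) :
  (forall i, whp (Q i)) -> whp (fun n w => forall i, Q i n w).
Proof.
move=> H; have := @whp_all_seq I (enum I) Q (fun i _ => H i).
move=> /whp_sub; apply; near=> n => w Hw i; apply: Hw.
by rewrite mem_enum.
Unshelve. all: by end_near. Qed.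

Lemma whp_comp Q (s : nat -> nat) : whp Q ->
  (forall N, \forall n \near \oo, (N <= s n)%N) -> whp (fun n => Q (s n)).
Proof.
move=> [A [mA A0 [N _ AQ]]] sinf; exists (fun n => A (s n)); split => //.
- have so : s @ \oo --> \oo.
    by move=> X [k _ kX]; have := sinf k; apply: filterS => n /kX.
  exact: (cvg_comp _ _ so A0).
- by have := sinf N; apply: filterS => n /AQ.
Qed.

Lemma whp_ae (Q : T -> Prop) : {ae P, forall w, Q w} -> whp (fun _ => Q).
Proof.
move=> [N [mN N0 QN]]; exists (fun=> N); split => //.
- by rewrite /pr N0 /=; exact: cvg_cst.
- by near=> n => w nN; apply: contrapT => nQ; apply: nN; exact: QN.
Unshelve. all: by end_near. Qed.

Lemma whp_bound (Q : nat -> T -> Prop) (A : nat -> set T) (b : nat -> R) :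
  (forall n, measurable (A n)) -> (\forall n \near \oo, pr P (A n) <= b n) ->
  b n @[n --> \oo] --> (0 : R) ->
  (\forall n \near \oo, forall w, ~ A n w -> Q n w) -> whp Q.
Proof.
move=> mA Ab b0 AQ; exists A; split => //.
apply: (@squeeze_cvgr _ _ _ _ (fun=> 0) b) => //; last exact: cvg_cst.
by apply: filterS Ab => n; rewrite pr_ge0.
Qed.

End high_probability.

(** * Laws of large numbers *)

Section laws_of_large_numbers.
Context {R : realType} {disp disp' : measure_display} {T : measurableType disp}
  {E : measurableType disp'}.
Variable P : probability T R.
Variables (Z : {RV P >-> E}) (Zs : nat -> {RV P >-> E}).
Hypothesis Ziid : iid_copies P Z (fun i => Zs i : T -> E).
Local Notation Ex := (Ex P).
Local Notation pr := (pr P).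
Local Notation intg := (intg P).
Implicit Types (g : E -> R) (n : nat) (t u : R).

Lemma truncation_tail_cvg0 g : measurable_fun setT g -> intg (fun w => g (Z w)) ->
  Ex (fun w => `|g (Z w) - trunc_at n%:R g (Z w)|) @[n --> \oo] --> (0 : R).
Proof.
move=> mg ig; apply: (Ex_dominated (intg_norm ig)) => [n|n w|w].
- apply: measurable_abs; apply: measurable_funB; first exact: (meas_orig Z).
  by apply: (meas_orig Z); exact: measurable_trunc_at.
- rewrite normr_id /trunc_at; case: ifP => _; last by rewrite subr0.
  by rewrite subrr normr0.
apply: cvg_near_cst; near=> n; rewrite /trunc_at ifT ?subrr ?normr0 //.
by near: n; exact: nbhs_infty_ger.
Unshelve. all: by end_near. Qed.

Lemma truncation_square_cvg0 g : measurable_fun setT g -> intg (fun w => g (Z w)) ->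
  Ex (fun w => n%:R^-1 * trunc_at n%:R g (Z w) ^+ 2) @[n --> \oo] --> (0 : R).
Proof.
move=> mg ig; apply: (Ex_dominated (intg_norm ig)) => [n|n w|w].
- apply: measurable_funM => //; apply: measurable_funX; apply: (meas_orig Z).
  exact: measurable_trunc_at.
- rewrite normrM normrX ger0_norm ?invr_ge0 // /trunc_at; case: ifP => [gn|_]; last first.
    by rewrite normr0 expr0n mulr0.
  have [->|n0] := eqVneq n 0%N; first by rewrite invr0 mul0r.
  by rewrite ler_pdivrMl ?ltr0n ?lt0n // expr2 ler_wpM2r.
apply/cvgr0Pnorm_le => e e0; near=> n.
have n1 : 1 <= n%:R :> R by near: n; exact: nbhs_infty_ger.
have n0 : 0 < n%:R :> R by rewrite (lt_le_trans ltr01).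
rewrite normrM normrX ger0_norm ?invr_ge0 // ler_pdivrMl //.
apply: (@le_trans _ _ (`|g (Z w)| ^+ 2)).
  rewrite lerXn2r ?nnegrE // /trunc_at; case: ifP => // _; by rewrite normr0.
rewrite -ler_pdivrMr //; near: n; exact: nbhs_infty_ger.
Unshelve. all: by end_near. Qed.

(** The weak law of large numbers under a first moment only: truncated at the
    level n, the tail and the variance terms of [copies_truncation] both vanish
    by dominated convergence. *)
Lemma lln g (e : R) : measurable_fun setT g -> intg (fun w => g (Z w)) -> 0 < e ->
  whp P (fun n w => `|n%:R^-1 * \sum_(i < n) g (Zs i w) - Ex (fun w => g (Z w))| <= e).
Proof.
move=> mg ig e0.
pose mt n := Ex (fun w => trunc_at n%:R g (Z w)).
have e20 : 0 < e / 2 by rewrite divr_gt0.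
have itr n : intg (fun w => trunc_at n%:R g (Z w)).
  apply: (@intg_bounded _ _ _ _ _ n%:R); last by move=> w; exact: trunc_at_le.
  by apply: (meas_orig Z); exact: measurable_trunc_at.
have itr2 n : intg (fun w => trunc_at n%:R g (Z w) ^+ 2).
  apply: (@intg_bounded _ _ _ _ _ (n%:R ^+ 2)).
    by apply: measurable_funX; apply: (meas_orig Z); exact: measurable_trunc_at.
  by move=> w; rewrite normrX lerXn2r ?nnegrE // trunc_at_le.
have itail n : intg (fun w => `|g (Z w) - trunc_at n%:R g (Z w)|).
  by apply: intg_norm; exact: intgB.
apply: (@whp_bound _ _ _ _ _
  (fun n => [set w | n%:R * (e / 2) <= `|\sum_(i < n) g (Zs i w) - n%:R * mt n|])
  (fun n => Ex (fun w => `|g (Z w) - trunc_at n%:R g (Z w)|) +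
    (e / 2) ^- 2 * Ex (fun w => n%:R^-1 * trunc_at n%:R g (Z w) ^+ 2))).
- move=> n; apply/measurable_ge_set/measurable_abs/measurable_funB => //.
  by apply: measurable_sum => i; exact: (meas_copy Zs).
- near=> n.
  have n0 : 0 < n%:R :> R by near: n; exact: nbhs_infty_gtr.
  rewrite /mt; apply: (le_trans (copies_truncation Ziid n mg (ltW n0) (mulr_gt0 n0 e20))).
  apply: lerD.
    rewrite -Ex_indic; last by apply/measurable_gt_set/measurable_abs; exact: (meas_orig Z).
    have ii : intg (\1_[set w | n%:R < `|g (Z w)|]).
      by apply: intg_indic; apply/measurable_gt_set/measurable_abs; exact: (meas_orig Z).
    rewrite -ExZ //; apply: Ex_le => // [|w]; first exact: intgZ.
    rewrite indicE; have [|] := boolP (w \in _); last by rewrite mulr0.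
    by rewrite inE /= mulr1 /trunc_at => ng; rewrite (lt_geF ng) subr0 ltW.
  rewrite ExZ // exprMn invfM; set a := Ex _.
  by rewrite (_ : n%:R * a * _ = (e / 2) ^- 2 * (n%:R^-1 * a)) //; field; rewrite !gt_eqF.
- rewrite -[X in _ --> X]addr0; apply: cvgD; first exact: truncation_tail_cvg0.
  rewrite -[X in _ --> X](mulr0 ((e / 2) ^- 2)); apply: cvgMr.
  exact: truncation_square_cvg0.
have tail := truncation_tail_cvg0 mg ig.
near=> n => w /= /negP; rewrite -ltNge => H.
have n0 : 0 < n%:R :> R by near: n; exact: nbhs_infty_gtr.
have tl : Ex (fun w => `|g (Z w) - trunc_at n%:R g (Z w)|) <= e / 2.
  rewrite -[leLHS]ger0_norm ?Ex_ge0 //; near: n.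
  by move/cvgr0Pnorm_le : tail; apply.
have mtE : `|mt n - Ex (fun w => g (Z w))| <= e / 2.
  rewrite distrC -ExB //; apply: le_trans tl.
  by apply: le_normr_Rintegral => //; exact: intgB.
rewrite (_ : _ - _ = n%:R^-1 * (\sum_(i < n) g (Zs i w) - n%:R * mt n) +
   (mt n - Ex (fun w => g (Z w)))); last by rewrite mulrBr mulKf ?gt_eqF // subrKA.
rewrite (le_trans (ler_normD _ _)) // (splitr e) lerD //.
by rewrite normrM ger0_norm ?invr_ge0 // ?ltW // ltr_pdivrMl.
Unshelve. all: by end_near. Qed.

Lemma lln_le g (e : R) : measurable_fun setT g -> intg (fun w => g (Z w)) -> 0 < e ->
  whp P (fun n w => n%:R^-1 * \sum_(i < n) g (Zs i w) <= Ex (fun w => g (Z w)) + e).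
Proof.
move=> mg ig e0; apply: whp_sub (lln mg ig e0) _; near=> n => w.
by rewrite ler_distl => /andP[_].
Unshelve. all: by end_near. Qed.

(** For a moment of order p <= 2, truncation at the level t = M n^(1/p) balances
    all three error terms: the tail, the variance and the bias are each
    controlled by the expectation of (|g| / t)^p. *)
Lemma copies_moment_bound g p M n : measurable_fun setT g ->
  intg (fun w => g (Z w)) -> Ex (fun w => g (Z w)) = 0 -> 1 <= p <= 2 ->
  intg (fun w => `|g (Z w)| `^ p) -> 0 < M -> (0 < n)%N ->
  Ex (fun w => `|g (Z w)| `^ p) <= M `^ p ->
  pr [set w | 2 * (M * n%:R `^ p^-1) <= `|\sum_(i < n) g (Zs i w)|]
    <= 2 * (Ex (fun w => `|g (Z w)| `^ p) / M `^ p).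
Proof.
move=> mg ig Eg0 /andP[p1 p2] igp M0 n0 mpM.
have p0 : 0 < p by rewrite (lt_le_trans ltr01).
have n0R : 0 < n%:R :> R by rewrite ltr0n.
set mp := Ex _ in mpM *; pose t := M * n%:R `^ p^-1.
have t0 : 0 < t by rewrite mulr_gt0 // powR_gt0.
have Mp0 : 0 < M `^ p by rewrite powR_gt0.
have tp : t `^ p = M `^ p * n%:R.
  by rewrite /t powRM ?(ltW M0) ?powR_ge0 // -powRrM mulVf ?gt_eqF // powRr1 // ltW.
pose q w := (t `^ p)^-1 * `|g (Z w)| `^ p.
have qE w : q w = (`|g (Z w)| / t) `^ p.
  rewrite /q mulrC (@powRM _ `|g (Z w)| t^-1) ?invr_ge0 ?(ltW t0) //; congr (_ * _).
  by rewrite -powR_inv1 ?powR_ge0 // -powR_inv1 ?(ltW t0) // -!powRrM mulrC.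
have iq : intg q by exact: intgZ.
have Eq : n%:R * Ex q = mp / M `^ p.
  by rewrite ExZ // -/mp tp; field; rewrite !gt_eqF.
have q0 w : 0 <= q w by rewrite qE powR_ge0.
have mtr : measurable_fun setT (fun w => trunc_at t g (Z w)).
  by apply: (meas_orig Z); exact: measurable_trunc_at.
have itr : intg (fun w => trunc_at t g (Z w)).
  by apply: (@intg_bounded _ _ _ _ _ t) => // w; exact: trunc_at_le (ltW t0).
have q_tail w : t < `|g (Z w)| -> 1 <= `|g (Z w)| / t /\ `|g (Z w)| / t <= q w.
  move=> tg; have s1 : 1 <= `|g (Z w)| / t by rewrite ler_pdivlMr // mul1r ltW.
  split => //; rewrite qE -[leLHS]powRr1 ?ler_powR //.
  by rewrite (le_trans _ s1).
have b1 : pr [set w | t < `|g (Z w)|] <= Ex q.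
  have mA : measurable [set w | t < `|g (Z w)|].
    by apply/measurable_gt_set/measurable_abs; exact: (meas_orig Z).
  rewrite -Ex_indic //; apply: Ex_le => //; first exact: intg_indic.
  move=> w; rewrite indicE; have [|] := boolP (w \in _); last by rewrite q0.
  by rewrite inE /= => /q_tail[a b]; exact: le_trans b.
have b2 : Ex (fun w => trunc_at t g (Z w) ^+ 2) <= t ^+ 2 * Ex q.
  rewrite -ExZ //; apply: Ex_le.
  - apply: (@intg_bounded _ _ _ _ _ (t ^+ 2)); first exact: measurable_funX.
    by move=> w; rewrite normrX lerXn2r ?nnegrE ?(ltW t0) // trunc_at_le // ltW.
  - exact: intgZ.
  move=> w; rewrite /trunc_at; case: ifP => [gt|_]; last first.
    by rewrite expr0n mulr_ge0 ?sqr_ge0.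
  rewrite -ler_pdivrMl ?exprn_gt0 // mulrC -[g _ ^+ 2]real_normK ?num_real //.
  rewrite -exprVn -exprMn qE.
  have s1 : `|g (Z w)| / t <= 1 by rewrite ler_pdivrMr // mul1r.
  have [->|s0] := eqVneq (`|g (Z w)| / t) 0.
    by rewrite expr0n powR_ge0.
  have sp : 0 < `|g (Z w)| / t by rewrite lt_neqAle eq_sym s0 divr_ge0 // ltW.
  by rewrite -powR_mulrn ?(ltW sp) // ger_powR // sp.
have b3 : `|Ex (fun w => trunc_at t g (Z w))| <= t * Ex q.
  rewrite -[Ex _](subr0) -Eg0 -ExB // -ExZ //.
  apply: (le_trans (le_normr_Rintegral measurableT (intgB itr ig))).
  apply: Ex_le; [by apply: intg_norm; exact: intgB|exact: intgZ|].
  move=> w; rewrite /trunc_at; case: (leP `|g (Z w)| t) => gt.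
    by rewrite subrr normr0 mulr_ge0 // ltW.
  by have [_ sq] := q_tail _ gt; rewrite sub0r normrN -ler_pdivrMl // mulrC.
have rho1 : mp / M `^ p <= 1 by rewrite ler_pdivrMr // mul1r.
have b3' : `|n%:R * Ex (fun w => trunc_at t g (Z w))| <= t.
  rewrite normrM ger0_norm // (le_trans (ler_wpM2l (ltW n0R) b3)) //.
  by rewrite mulrCA Eq ler_piMr // ltW.
have msum : measurable_fun setT (fun w => \sum_(i < n) g (Zs i w)).
  by apply: measurable_sum => i; exact: (meas_copy Zs).
apply: le_trans (_ : pr [set w | t <= `|\sum_(i < n) g (Zs i w) -
    n%:R * Ex (fun w => trunc_at t g (Z w))|] <= _).
  apply: pr_le.
  - by apply/measurable_ge_set/measurable_abs.
  - by apply/measurable_ge_set/measurable_abs/measurable_funB.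
  move=> w /=; set S := \sum_(i < n) _; set b := n%:R * _ in b3' *.
  rewrite -/t => tS; have := ler_normD (S - b) b; rewrite subrK; lra.
apply: (le_trans (copies_truncation Ziid n mg (ltW t0) t0)).
rewrite mulr2n mulrDl mul1r; apply: lerD.
  by rewrite -Eq ler_wpM2l // ltW.
rewrite ler_pdivrMr ?exprn_gt0 // -Eq -mulrA ler_wpM2l ?(ltW n0R) //.
by rewrite mulrC.
Qed.

End laws_of_large_numbers.


(** * The Hessian on Euclidean balls *)

Section euclidean_topology.
Context {R : realType} {d : nat}.
Implicit Types (x y c u v : 'rV[R]_d) (r e : R).

Lemma normr_le_enorm v : `|v| <= enorm v.
Proof.
rewrite [leLHS]/Num.norm /= mx_normrE bigmax_le ?enorm_ge0 // => -[i j] _ /=.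
by rewrite (ord1 i) enorm_coord.
Qed.

Lemma ler_enormB x y : `|enorm x - enorm y| <= enorm (x - y).
Proof.
rewrite ler_distl; apply/andP; split.
  by rewrite lerBlDr -[in leLHS](subrK x y) enormBC addrC ler_enormD.
by rewrite addrC -[in leLHS](subrK y x) ler_enormD.
Qed.

Lemma edist_continuous c : continuous (fun x => enorm (x - c)).
Proof.
move=> x; apply/(@cvgrPdist_le _ _ _ _ (nbhs_filter x)) => e e0.
have d0 : 0 < d%:R + 1 :> R by rewrite ltr_pwDr.
have e1 : 0 < e / (d%:R + 1) by rewrite divr_gt0.
apply: (filterS _ (nbhsx_ballx x (e / (d%:R + 1)) e1)) => y [_ xy].
rewrite (le_trans (ler_enormB _ _)) // (_ : x - c - (y - c) = x - y); last first.
  by rewrite opprB addrA subrK.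
rewrite (le_trans (enorm_le_sum _)) //.
apply: (@le_trans _ _ (\sum_(i < d) e / (d%:R + 1))).
  by apply: ler_sum => i _; rewrite !mxE; have := xy ord0 i; rewrite -ball_normE => /ltW.
rewrite sumr_const card_ord -[X in X <= _]mulr_natl mulrCA ler_piMr ?(ltW e0) //.
by rewrite ler_pdivrMr // mul1r lerDl.
Qed.

Definition eball c r : set 'rV[R]_d := [set x | enorm (x - c) <= r].

Lemma eball_compact c r : compact (eball c r).
Proof.
apply: bounded_closed_compact.
  exists (enorm c + r); split; [exact: num_real|move=> t rt x xr].
  rewrite /= (le_trans (normr_le_enorm _)) // (le_trans _ (ltW rt)) //.
  by rewrite -[in leLHS](subrK c x) addrC (le_trans (ler_enormD _ _)) // lerD2l.
rewrite (_ : eball c r = (fun x => enorm (x - c)) @^-1` [set t | t <= r]) //.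
apply: preimage_closed; last exact: closed_le.
by move=> x _; exact: edist_continuous.
Qed.

Lemma eball_net c r e : 0 < e -> exists S : seq 'rV[R]_d,
  (forall p, p \in S -> eball c r p) /\
  (forall x, eball c r x -> exists2 p, p \in S & enorm (x - p) <= e).
Proof.
move=> e0; have := @eball_compact c r; rewrite compact_cover.
move=> /(_ _ (eball c r) (fun p => [set x | enorm (x - p) < e])) [].
- move=> p _; rewrite (_ : [set x | _] = (fun x => enorm (x - p)) @^-1` [set t | t < e]) //.
  apply: open_comp; last exact: open_lt.
  by move=> x _; exact: edist_continuous.
- by move=> x xr; exists x => //=; rewrite subrr enorm0.
move=> D DK KD; exists (finmap.enum_fset D); split=> [p pD|x /KD[p pD xp]].
  by have := DK p pD; rewrite inE.
by exists p => //; exact: ltW.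
Qed.

Lemma rational_approx x e : 0 < e ->
  exists q : 'rV[rat]_d, enorm (map_mx ratr q - x) <= e.
Proof.
move=> e0; have e1 : 0 < e / (d%:R + 1) by rewrite divr_gt0 // ltr_pwDr.
have near i : exists t : rat, `|ratr t - x ord0 i| < e / (d%:R + 1).
  have /rat_in_itvoo[t] : x ord0 i - e / (d%:R + 1) < x ord0 i + e / (d%:R + 1) by lra.
  by rewrite in_itv /= => /andP[t1 t2]; exists t; rewrite ltr_distl t1 t2.
have [t tP] := boolp.choice near.
exists (\row_i t i); rewrite (le_trans (enorm_le_sum _)) //.
apply: (@le_trans _ _ (\sum_(i < d) e / (d%:R + 1))).
  by apply: ler_sum => i _; rewrite !mxE ltW.
rewrite sumr_const card_ord -[X in X <= _]mulr_natl mulrCA ler_piMr ?(ltW e0) //.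
by rewrite ler_pdivrMr ?mul1r ?lerDl // ltr_pwDr.
Qed.

Lemma opnorm_le (A : 'M[R]_d) v : enorm v <= 1 -> enorm (v *m A) <= opnorm A.
Proof.
move=> v1; apply: ub_le_sup; last by exists v.
exists (\sum_(j < d) \sum_(i < d) `|A i j|) => _ [u /= u1 <-].
rewrite (le_trans (enorm_le_sum _)) //; apply: ler_sum => j _.
rewrite mxE (le_trans (ler_norm_sum _ _ _)) //; apply: ler_sum => i _.
by rewrite normrM ler_piMl // (le_trans (enorm_coord _ _)).
Qed.

Lemma enorm_delta i : enorm (delta_mx ord0 i : 'rV[R]_d) = 1.
Proof.
apply/eqP; rewrite -(@eqrXn2 _ 2) ?enorm_ge0 // enorm_sq expr1n /dot (bigD1 i) //=.
rewrite big1 => [|j /negbTE ji]; last by rewrite !mxE eqxx ji mul0r.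
by rewrite !mxE !eqxx mulr1 addr0.
Qed.

Lemma opnorm_entry (A : 'M[R]_d) i j : `|A i j| <= opnorm A.
Proof.
apply: le_trans (opnorm_le A (_ : enorm (delta_mx ord0 i : 'rV[R]_d) <= 1)).
  by rewrite -rowE (le_trans _ (enorm_coord _ j)) // mxE.
by rewrite enorm_delta.
Qed.

Lemma quadratic_form_le (A : 'M[R]_d) u (b : R) : (forall i j, `|A i j| <= b) ->
  `|dot (u *m A) u| <= d%:R ^+ 2 * b * enorm u ^+ 2.
Proof.
move=> Ab; rewrite /dot (le_trans (ler_norm_sum _ _ _)) //.
rewrite [leRHS](_ : _ = \sum_(j < d) \sum_(i < d) b * enorm u ^+ 2); last first.
  by rewrite !sumr_const card_ord -mulrnA -[RHS]mulr_natl natrM expr2 !mulrA.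
apply: ler_sum => j _; rewrite mxE mulr_suml (le_trans (ler_norm_sum _ _ _)) //.
apply: ler_sum => i _; rewrite !normrM mulrAC mulrC expr2 ler_pM ?mulr_ge0 //.
by rewrite ler_pM // enorm_coord.
Qed.

End euclidean_topology.


Section integrability.
Context {R : realType} {disp : measure_display} {T : measurableType disp}.
Variable P : probability T R.
Implicit Types X Y : T -> R.

Lemma expectationE X : 'E_P[X]%E = (\int[P]_w (X w)%:E)%E.
Proof. by rewrite unlock. Qed.

(** For a dominating function of unclear measurability, such as an operator norm:
    the integral of a nonnegative function is a supremum over the simple
    functions below it. *)
Lemma intg_of_expectation X Y : measurable_fun setT X ->
  (forall w, `|X w| <= Y w) -> ('E_P[Y] < +oo)%E -> intg P X.
Proof.
move=> mX XY; rewrite expectationE => Yoo; apply/integrableP; split.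
  exact/measurable_EFinP.
apply: le_lt_trans Yoo; rewrite !ge0_integralE //; last first.
  by move=> w _; rewrite lee_fin (le_trans _ (XY w)).
apply: le_ereal_sup => _ [h /= hX <-]; exists h => //= w.
rewrite (le_trans (hX w)) // !patch_setT lee_fin.
exact: XY.
Qed.

Lemma intg_le_ae X Y : measurable_fun setT X ->
  {ae P, forall w, `|X w| <= Y w} -> intg P Y -> intg P X.
Proof.
move=> mX XY iY; have mY := intg_meas iY.
apply/integrableP; split; first exact/measurable_EFinP.
have /integrableP[_ Yoo] := intg_norm iY.
apply: le_lt_trans Yoo; apply: ae_ge0_le_integral => //.
- by apply: measurableT_comp => //; exact/measurable_EFinP.
- by apply: measurableT_comp => //; exact/measurable_EFinP/measurable_abs.
apply: filterS XY => w XY _; rewrite /= lee_fin normr_id.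
by rewrite (le_trans XY) // ler_norm.
Qed.

End integrability.

Lemma perturbed_lipschitz (R : realType) (a b p q M N D e e' : R) :
  `|p - a| <= e' -> `|q - b| <= e' -> `|p - q| <= M * N -> N <= D + 2 * e' ->
  0 <= M -> (2 * M + 2) * e' = e -> `|a - b| <= M * D + e.
Proof.
move=> pa qb pq ND M0 <-; have MN := ler_wpM2l M0 ND.
rewrite (_ : a - b = - (p - a) + ((p - q) + (q - b))); last by ring.
have := ler_normD (- (p - a)) ((p - q) + (q - b)); rewrite normrN.
have := ler_normD (p - q) (q - b); lra.
Qed.

(** * Curvature and gradient of the empirical risk *)

Section smooth_model.
Context {R : realType} {disp disp' : measure_display} {T : measurableType disp}
  {E : measurableType disp'}.
Variable P : probability T R.
Variables (Z : {RV P >-> E}) (Zs : nat -> {RV P >-> E}).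
Hypothesis Ziid : iid_copies P Z (fun i => Zs i : T -> E).
Variables (d : nat) (f : 'rV[R]_d -> E -> R) (c : 'rV[R]_d).
Hypothesis mf : jointly_measurable f.
Hypothesis df : forall z x, differentiable (f^~ z) x.
Hypothesis F_fin : forall x, intg P (fun w => f x (Z w)).
Variable alpha : R.
Hypothesis alpha_itv : 0 < alpha <= 1.
Hypothesis smooth : smooth_moments P f Z c alpha.
Implicit Types (x y u v : 'rV[R]_d) (z : E) (r : R).
Local Notation Ex := (Ex P).
Local Notation intg := (intg P).

Definition hess_entry i j x z : R := hess (f^~ z) x i j.

Lemma ddf z x : differentiable (grad (f^~ z)) x.
Proof. by have [/(_ z)[]] := smooth. Qed.

Lemma hess_continuous z : continuous (hess (f^~ z)).
Proof. by have [/(_ z)[]] := smooth. Qed.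

Lemma dot_delta u j : dot u (delta_mx ord0 j) = u ord0 j.
Proof.
rewrite /dot (bigD1 j) //= big1 => [|k /negbTE kj]; last by rewrite mxE eqxx kj mulr0.
by rewrite addr0 mxE !eqxx mulr1.
Qed.

Lemma meas_hess_entry i j x : measurable_fun setT (hess_entry i j x).
Proof.
have := jointly_measurable_hess mf df ddf (delta_mx ord0 i) (delta_mx ord0 j)
  (mvec_cst x) (@measurable_id _ E setT).
congr (measurable_fun _ _); apply/funext => z.
by rewrite dot_delta -rowE mxE.
Qed.

Definition grad_entry i z : R := grad (f^~ z) c ord0 i.

Lemma meas_grad_entry i : measurable_fun setT (grad_entry i).
Proof.
have := jointly_measurable_dot_grad mf df (delta_mx ord0 i)
  (mvec_cst c) (@measurable_id _ E setT).
by congr (measurable_fun _ _); apply/funext => z; rewrite dot_delta.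
Qed.

Lemma hess_formE z x u :
  hess_form (f^~ z) x u = \sum_(j < d) \sum_(i < d) u ord0 i * u ord0 j * hess_entry i j x z.
Proof.
rewrite /hess_form /dot; apply: eq_bigr => j _; rewrite mxE mulr_suml.
by apply: eq_bigr => i _; rewrite mulrAC.
Qed.

(** The Lipschitz bound for the Hessian holds outside a null set of samples that
    need not be the preimage of a measurable set of observations. Tested on
    rational points only, it defines a measurable set of observations, which is
    then of full measure for every copy of Z; continuity of the Hessian gives
    the bound back at all points. *)
Lemma hess_lipschitz r : exists M : E -> R, exists G : set E,
  [/\ measurable_fun setT M, (forall z, 0 <= M z), intg (fun w => M (Z w)),
      measurable G /\ P (Z @^-1` (~` G)) = 0%E &
      forall z x y i j, G z -> enorm (x - c) <= r -> enorm (y - c) <= r ->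
        `|hess_entry i j x z - hess_entry i j y z| <= M z * enorm (x - y)].
Proof.
have [_ _ _ /(_ _ (@eball_compact _ _ c (r + 1)))[M [mM M0 Moo aeM]]] := smooth.
exists M.
(* Radius r + 1 leaves room for rational points near every point of the ball of
   radius r. *)
pose q (p : 'rV[rat]_d) : 'rV[R]_d := map_mx ratr p.
pose ok (p : ('rV[rat]_d * 'rV[rat]_d) * ('I_d * 'I_d)) : set E :=
  if `[< enorm (q p.1.1 - c) <= r + 1 /\ enorm (q p.1.2 - c) <= r + 1 >]
  then [set z | 0 <= M z * enorm (q p.1.1 - q p.1.2) -
    `|hess_entry p.2.1 p.2.2 (q p.1.1) z - hess_entry p.2.1 p.2.2 (q p.1.2) z| ]
  else setT.
have mok p : measurable (ok p).
  rewrite /ok; case: asboolP => // _; apply: measurable_ge_set.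
  apply: measurable_funB; first by apply: measurable_funM.
  by apply: measurable_abs; apply: measurable_funB; exact: meas_hess_entry.
exists (~` (\bigcup_p ~` ok p)).
have mU : measurable (\bigcup_p ~` ok p).
  apply: countable_bigcupT_measurable => [|p]; first exact: countableP.
  exact: measurableC.
split => //.
- apply: (intg_of_expectation _ _ Moo); first exact: (meas_orig Z).
  by move=> w; rewrite ger0_norm.
- split; first exact: measurableC.
  rewrite setCK; have [N [mN N0 NM]] := aeM.
  apply/eqP; rewrite eq_le measure_ge0 andbT -N0; apply: le_measure; rewrite ?inE //.
    by rewrite -[X in measurable X]setTI; exact: measurable_funP.
  move=> w [p _] /= nok; apply: NM => /= H; apply: nok.
  rewrite /ok; case: asboolP => // -[p1 p2] /=.
  rewrite subr_ge0 (le_trans _ (H _ _ p1 p2)) //.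
  apply: le_trans (opnorm_entry _ p.2.1 p.2.2).
  by rewrite [X in _ <= `|X|]mxE [X in _ <= `|_ + X|]mxE.
move=> z x y i j Gz xr yr.
have ctn v (e : R) : 0 < e -> enorm (v - c) <= r -> exists p : 'rV[rat]_d,
    [/\ enorm (q p - v) <= e, enorm (q p - c) <= r + 1 &
        `|hess_entry i j (q p) z - hess_entry i j v z| <= e].
  move=> e0 vr.
  have := @continuous_comp _ _ _ (hess (f^~ z)) (fun (A : 'M[R]_d) => A i j) v
    (@hess_continuous z v) (@coord_continuous R d d i j (hess (f^~ z) v)).
  move=> /(@cvgrPdist_le _ _ _ _ (nbhs_filter v)) /(_ e e0) /nbhs_ballP[a /= a0 Ha].
  have m0 : 0 < Num.min (a / 2) (Num.min e 1) by rewrite !lt_min divr_gt0 // e0 ltr01.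
  have [p pv] := rational_approx v m0; exists p.
  move: pv; rewrite !le_min => /and3P[pa pe p1]; split => //.
    rewrite (_ : q p - c = (q p - v) + (v - c)); last by rewrite subrKA.
    by rewrite (le_trans (ler_enormD _ _)) // addrC lerD.
  rewrite distrC; apply: Ha; split => // k l; rewrite (ord1 k) -ball_normE /=.
  apply: le_lt_trans (_ : a / 2 < a); last by rewrite ltr_pdivrMr // ltr_pMr // ltr1n.
  apply: le_trans pa; rewrite enormBC (le_trans _ (enorm_coord _ l)) //.
  by rewrite !mxE.
apply/ler_addgt0Pr => e e0.
pose e' := e / (2 * M z + 2).
have den0 : 0 < 2 * M z + 2 by rewrite ltr_wpDl // mulr_ge0.
have e'0 : 0 < e' by rewrite divr_gt0.
have [p1 [a1 b1 c1]] := ctn x e' e'0 xr.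
have [p2 [a2 b2 c2]] := ctn y e' e'0 yr.
have : ok ((p1, p2), (i, j)) z.
  by apply: contrapT => nok; apply: Gz; exists ((p1, p2), (i, j)).
rewrite /ok; case: asboolP => [_ /=|[]//]; rewrite subr_ge0 => H.
have e1 : enorm (q p1 - q p2) <= enorm (x - y) + 2 * e'.
  rewrite (_ : q p1 - q p2 = (q p1 - x) + ((x - y) - (q p2 - y))); last first.
    by move: (q p1) (q p2) => ? ?; apply/rowP => k; rewrite !mxE; ring.
  rewrite (le_trans (ler_enormD _ _)) // (le_trans (lerD (lexx _) (ler_enormD _ _))) //.
  by rewrite enormN addrCA lerD2l mulr_natl mulr2n lerD.
have h3 : (2 * M z + 2) * e' = e by rewrite /e' mulrC divfK // gt_eqF.
exact: perturbed_lipschitz c1 c2 H e1 (M0 z) h3.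
Qed.


Lemma ae_orig (G : set E) : measurable G -> P (Z @^-1` (~` G)) = 0%E ->
  {ae P, forall w, G (Z w)}.
Proof.
move=> mG G0; exists (Z @^-1` (~` G)); split => //.
by rewrite -[X in measurable X]setTI; apply: measurable_funP => //; exact: measurableC.
Qed.

Lemma meas_hess_entryZ i j x : measurable_fun setT (fun w => hess_entry i j x (Z w)).
Proof. by apply: (meas_orig Z); exact: meas_hess_entry. Qed.

Lemma intg_hess_entry_centre i j : intg (fun w => hess_entry i j c (Z w)).
Proof.
have [_ h0 _ _] := smooth; apply: intg_of_expectation h0; first exact: meas_hess_entryZ.
by move=> w; exact: opnorm_entry.
Qed.

Lemma intg_hess_entry i j x : intg (fun w => hess_entry i j x (Z w)).
Proof.
have [M [G [mM M0 iM [mG G0] HG]]] := hess_lipschitz (enorm (x - c)).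
have iY : intg (fun w => `|hess_entry i j c (Z w)| + enorm (x - c) * M (Z w)).
  by apply: intgD; [exact: intg_norm (intg_hess_entry_centre i j)|exact: intgZ].
apply: intg_le_ae iY; first exact: meas_hess_entryZ.
apply: filterS (ae_orig mG G0) => w Gw.
have := HG (Z w) x c i j Gw (lexx _); rewrite subrr enorm0 enorm_ge0 => /(_ isT).
have := ler_normD (hess_entry i j x (Z w) - hess_entry i j c (Z w)) (hess_entry i j c (Z w)).
by rewrite subrK => h1 h2; rewrite (le_trans h1) // addrC lerD2l mulrC.
Qed.

Lemma intg_hess_form x u : intg (fun w => hess_form (f^~ (Z w)) x u).
Proof.
under eq_fun do rewrite hess_formE; apply: intg_sum => j; apply: intg_sum => i.
by apply: intgZ; exact: intg_hess_entry.
Qed.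

Definition mean_hess x u : R := Ex (fun w => hess_form (f^~ (Z w)) x u).

Lemma hess_form_diff z x y u b : (forall i j, `|hess_entry i j x z - hess_entry i j y z| <= b) ->
  `|hess_form (f^~ z) x u - hess_form (f^~ z) y u| <= d%:R ^+ 2 * b * enorm u ^+ 2.
Proof.
move=> H; rewrite /hess_form -dotNl -dotDl -mulmxBr; apply: quadratic_form_le => i j.
by rewrite [X in `|X|]mxE [X in `|_ + X|]mxE; exact: H.
Qed.

Lemma hess_formZ z x u (s : R) : hess_form (f^~ z) x (s *: u) = s ^+ 2 * hess_form (f^~ z) x u.
Proof. by rewrite /hess_form -scalemxAl dotZl dotZr mulrA expr2. Qed.

Lemma mean_hessZ x u (s : R) : mean_hess x (s *: u) = s ^+ 2 * mean_hess x u.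
Proof.
rewrite /mean_hess -ExZ; last exact: intg_hess_form.
by apply: eq_Rintegral => w _; rewrite hess_formZ.
Qed.

(** The error term of the expansion is cubic because the Hessian is Lipschitz. *)
Lemma taylor_upper z x v r b : enorm (x - c) <= r -> enorm (x + v - c) <= r ->
  (forall y i j, enorm (y - c) <= r -> `|hess_entry i j y z - hess_entry i j x z| <= b * enorm (y - x)) ->
  0 <= b ->
  f (x + v) z <= f x z + dot (grad (f^~ z) x) v +
     (hess_form (f^~ z) x v + d%:R ^+ 2 * (b * enorm v) * enorm v ^+ 2) / 2.
Proof.
move=> xr xvr H b0.
have d1 (s : R) : is_derive s (1 : R) (fun s : R => f (x + s *: v) z)
    (dot (grad (f^~ z) (x + s *: v)) v).
  by apply: (@is_derive_line _ _ (f^~ z)); exact: is_derive_grad.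
have d2 (s : R) : is_derive s (1 : R) (fun s : R => dot (grad (f^~ z) (x + s *: v)) v)
    (hess_form (f^~ z) (x + s *: v) v).
  apply: (@is_derive_line _ _ (fun y => dot (grad (f^~ z) y) v)).
  exact: (is_derive_dot_grad v v (ddf z _)).
have := taylor2_le d1 d2; rewrite scale0r addr0 scale1r; apply => s s01.
have sv : enorm (x + s *: v - c) <= r.
  have := enorm_convex s01 xr xvr; rewrite (_ : x + v - x = v) //.
  by rewrite addrAC subrr add0r.
rewrite -lerBlDl (le_trans (ler_norm _)) //; apply: hess_form_diff => i j.
apply: (le_trans (H _ i j sv)); rewrite ler_wpM2l // addrAC subrr add0r enormZ.
by case/andP: s01 => s0 s1; rewrite ger0_norm // ler_piMl // enorm_ge0.
Qed.

Definition mean x : R := Ex (fun w => f x (Z w)).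

(** Second differences transfer strong convexity of the mean to the mean of the
    Hessians without differentiating under the expectation. *)
Lemma mean_hess_ge r : locally_strongly_convex mean -> exists2 m : R, 0 < m &
  forall x u, enorm (x - c) <= r -> m * enorm u ^+ 2 <= mean_hess x u.
Proof.
move=> /(_ _ (@eball_compact _ _ c (r + 1)))[m m0 Hm]; exists m => // x u xr.
have [M [G [mM M0 iM [mG G0] HG]]] := hess_lipschitz (r + 1).
pose EM := Ex (fun w => M (Z w)).
have EM0 : 0 <= EM by apply: Ex_ge0.
pose B := d%:R ^+ 2 * EM * enorm u ^+ 3.
have B0 : 0 <= B by rewrite !mulr_ge0 ?exprn_ge0 ?enorm_ge0.
have step (s : R) : 0 < s -> s * enorm u <= 1 -> m * enorm u ^+ 2 <= mean_hess x u + s * B.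
  move=> s0 su; pose v := s *: u.
  have ev : enorm v = s * enorm u by rewrite enormZ gtr0_norm.
  have vr (w : 'rV[R]_d) : enorm w = s * enorm u -> enorm (x + w - c) <= r + 1.
    by move=> ew; rewrite addrAC (le_trans (ler_enormD _ _)) // lerD // ew.
  have xr1 : enorm (x - c) <= r + 1 by rewrite (le_trans xr) // lerDl.
  have xv1 := vr v ev; have xv2 : enorm (x - v - c) <= r + 1 by apply: vr; rewrite enormN.
  have half01 : 0 <= (2^-1 : R) <= 1 by rewrite invr_ge0 ler0n invf_le1 ?ler1n.
  have := Hm 2^-1 (x + v) (x - v) half01 xv1 xv2.
  rewrite (_ : 2^-1 *: (x + v) + (1 - 2^-1) *: (x - v) = x); last first.
    by apply/rowP => k; rewrite !mxE; field.
  rewrite (_ : x + v - (x - v) = 2 *: v); last by apply/rowP => k; rewrite !mxE; ring.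
  rewrite enormZ ger0_norm // ev => convex.
  have iQ : intg (fun w => hess_form (f^~ (Z w)) x v + d%:R ^+ 2 * enorm v ^+ 3 * M (Z w)).
    by apply: intgD; [exact: intg_hess_form|exact: intgZ].
  have iL : intg (fun w => f (x + v) (Z w) + f (x - v) (Z w) - 2 * f x (Z w)).
    by apply: intgB; [exact: intgD|exact: intgZ].
  have : Ex (fun w => f (x + v) (Z w) + f (x - v) (Z w) - 2 * f x (Z w)) <=
      Ex (fun w => hess_form (f^~ (Z w)) x v + d%:R ^+ 2 * enorm v ^+ 3 * M (Z w)).
    apply: Ex_le_ae => //; apply: filterS (ae_orig mG G0) => w Gw.
    have Hx y i j : enorm (y - c) <= r + 1 ->
        `|hess_entry i j y (Z w) - hess_entry i j x (Z w)| <= M (Z w) * enorm (y - x).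
      by move=> yr; exact: HG.
    have := taylor_upper xr1 xv1 Hx (M0 _); have := taylor_upper xr1 xv2 Hx (M0 _).
    rewrite -[- v]scaleN1r hess_formZ dotZr enormZ normrN1 mul1r sqrrN expr1n mul1r.
    rewrite (_ : d%:R ^+ 2 * (M (Z w) * enorm v) * enorm v ^+ 2 =
      d%:R ^+ 2 * enorm v ^+ 3 * M (Z w)); last by ring.
    by lra.
  have iD : intg (fun w => f (x + v) (Z w) + f (x - v) (Z w)) by exact: intgD.
  have i2 : intg (fun w => 2 * f x (Z w)) by exact: intgZ.
  have i3 : intg (fun w => d%:R ^+ 2 * enorm v ^+ 3 * M (Z w)) by exact: intgZ.
  rewrite (ExB iD i2) (ExD (F_fin _) (F_fin _)) (ExZ _ (F_fin x)).
  rewrite (ExD (intg_hess_form x v) i3) (ExZ _ iM) -/EM -/(mean_hess x v).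
  rewrite -/(mean x) -/(mean (x + v)) -/(mean (x - v)).
  rewrite mean_hessZ ev => upper.
  have : s ^+ 2 * (m * enorm u ^+ 2) <= s ^+ 2 * (mean_hess x u + s * B).
    rewrite /B; move: convex upper.
    set a := mean (x + v); set b := mean (x - v); set a0 := mean x.
    move: (enorm u) (mean_hess x u) => U H; nra.
  by rewrite ler_pM2l // exprn_gt0.
apply/ler_addgt0Pr => e e0.
have B1 : 0 < B + 1 by rewrite ltr_wpDl.
have u1 : 0 < enorm u + 1 by rewrite ltr_wpDl // enorm_ge0.
pose s := Num.min (e / (B + 1)) (enorm u + 1)^-1.
have s0 : 0 < s by rewrite lt_min divr_gt0 //= invr_gt0.
have su : s * enorm u <= 1.
  apply: (@le_trans _ _ ((enorm u + 1)^-1 * (enorm u + 1))); last by rewrite mulVf ?gt_eqF.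
  by rewrite ler_pM ?enorm_ge0 ?(ltW s0) ?ge_min ?lexx ?orbT // lerDl.
rewrite (le_trans (step s s0 su)) // lerD2l.
apply: (@le_trans _ _ (e / (B + 1) * (B + 1))); last by rewrite divfK ?gt_eqF.
by rewrite ler_pM ?(ltW s0) ?ge_min ?lexx // lerDl.
Qed.


Lemma meas_grad_entryZ i : measurable_fun setT (fun w => grad_entry i (Z w)).
Proof. by apply: (meas_orig Z); exact: meas_grad_entry. Qed.

Lemma intg_grad_entry_pow i : intg (fun w => `|grad_entry i (Z w)| `^ (1 + alpha)).
Proof.
case/andP: alpha_itv => a0 _.
have [_ _ g0 _] := smooth; apply: intg_of_expectation g0.
  apply: (measurableT_comp (measurable_powR (1 + alpha))).
  by apply: measurable_abs; exact: meas_grad_entryZ.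
move=> w; rewrite ger0_norm ?powR_ge0 // ge0_ler_powR ?nnegrE ?enorm_ge0 ?addr_ge0 ?(ltW a0) //.
exact: enorm_coord.
Qed.

Lemma intg_grad_entry i : intg (fun w => grad_entry i (Z w)).
Proof.
have i1 : intg (fun w => 1 + `|grad_entry i (Z w)| `^ (1 + alpha)).
  by apply: intgD; [exact: intg_cst|exact: intg_grad_entry_pow].
apply: intg_le i1; first exact: meas_grad_entryZ.
move=> w; rewrite [leRHS]ger0_norm ?addr_ge0 ?powR_ge0 //.
have [h|h] := leP `|grad_entry i (Z w)| 1; first by rewrite ler_wpDr ?powR_ge0.
rewrite ler_wpDl // -[leLHS]powRr1 ?normr_ge0 // ler_powR ?(ltW h) // lerDl.
by case/andP: alpha_itv => /ltW.
Qed.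

(** The first-order condition at the minimizer, read off the expansion at
    distance s of the risk in the directions of the axes, divided by s. *)
Lemma mean_grad_eq0 i : (forall x, mean c <= mean x) ->
  Ex (fun w => grad_entry i (Z w)) = 0.
Proof.
move=> cmin.
have [M [G [mM M0 iM [mG G0] HG]]] := hess_lipschitz 1.
pose D := Ex (fun w => grad_entry i (Z w)).
suff sgn (sg : R) : `|sg| = 1 -> 0 <= sg * D.
  apply/eqP; rewrite eq_le -/D; have := sgn 1; have := sgn (-1).
  by rewrite normrN1 normr1 mulN1r mul1r oppr_ge0 => -> // ->.
move=> sg1; pose u : 'rV[R]_d := sg *: delta_mx ord0 i.
have eu : enorm u = 1 by rewrite enormZ sg1 enorm_delta mulr1.
pose B := (mean_hess c u + d%:R ^+ 2 * Ex (fun w => M (Z w))) / 2.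
have step (s : R) : 0 < s -> s <= 1 -> 0 <= sg * D + s * `|B|.
  move=> s0 s1; pose v := s *: u.
  have ev : enorm v = s by rewrite enormZ eu mulr1 gtr0_norm.
  have cr : enorm (c - c) <= 1 by rewrite subrr enorm0.
  have vr : enorm (c + v - c) <= 1 by rewrite addrAC subrr add0r ev.
  have i2 : intg (fun w => (hess_form (f^~ (Z w)) c v + d%:R ^+ 2 * s ^+ 3 * M (Z w))).
    by apply: intgD; [exact: intg_hess_form|exact: intgZ].
  have i3 : intg (fun w => s * sg * grad_entry i (Z w)) by apply: intgZ; exact: intg_grad_entry.
  have i4 : intg (fun w => f c (Z w) + s * sg * grad_entry i (Z w)) by exact: intgD.
  have i5 : intg (fun w => 2^-1 * (hess_form (f^~ (Z w)) c v + d%:R ^+ 2 * s ^+ 3 * M (Z w))).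
    exact: intgZ.
  have : mean (c + v) <= Ex (fun w => f c (Z w) + s * sg * grad_entry i (Z w) +
      2^-1 * (hess_form (f^~ (Z w)) c v + d%:R ^+ 2 * s ^+ 3 * M (Z w))).
    apply: Ex_le_ae => //; first exact: intgD.
    apply: filterS (ae_orig mG G0) => w Gw.
    have Hc y k l : enorm (y - c) <= 1 ->
        `|hess_entry k l y (Z w) - hess_entry k l c (Z w)| <= M (Z w) * enorm (y - c).
      by move=> yr; exact: HG.
    have := taylor_upper cr vr Hc (M0 _); rewrite ev /v /u !dotZr dot_delta.
    rewrite -/(grad_entry i (Z w)) => H; rewrite (le_trans H) //.
    by rewrite le_eqVlt; apply/orP; left; apply/eqP; field.
  have i6 : intg (fun w => d%:R ^+ 2 * s ^+ 3 * M (Z w)) by exact: intgZ.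
  rewrite (ExD i4 i5) (ExD (F_fin c) i3) (ExZ _ (intg_grad_entry i)) (ExZ _ i2).
  rewrite (ExD (intg_hess_form c v) i6) (ExZ _ iM) -/D -/(mean c) -/(mean_hess c v).
  rewrite mean_hessZ => H; have := le_trans (cmin (c + v)) H => {}H.
  have EM0 : 0 <= Ex (fun w => M (Z w)) by apply: Ex_ge0.
  have : 0 <= s * (sg * D + s * `|B|).
    have B1 : s ^+ 2 * mean_hess c u + d%:R ^+ 2 * s ^+ 3 * Ex (fun w => M (Z w)) <=
        2 * (s ^+ 2 * `|B|).
      have := ler_wpM2l (sqr_ge0 s) (ler_norm B).
      have : s ^+ 3 * (d%:R ^+ 2 * Ex (fun w => M (Z w))) <=
             s ^+ 2 * (d%:R ^+ 2 * Ex (fun w => M (Z w))).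
        by rewrite ler_wpM2r ?mulr_ge0 ?sqr_ge0 // ler_wiXn2l // ltW.
      have -> : mean_hess c u = 2 * B - d%:R ^+ 2 * Ex (fun w => M (Z w)).
        by rewrite /B; field.
      clearbody B; move: B (Ex (fun w => M (Z w))) => b e1.
      by move: `|b| (s ^+ 3) (s ^+ 2) => e3 s3 s2 h2 h3; lra.
    by move: H B1; move: (Ex _) (mean c) `|B| => e1 e2 e3; lra.
  by rewrite pmulr_rge0.
apply/ler_addgt0Pr => e e0.
have B1 : 0 < `|B| + 1 by rewrite ltr_wpDl.
pose s := Num.min (e / (`|B| + 1)) 1.
have s0 : 0 < s by rewrite lt_min divr_gt0 //= ltr01.
have s1 : s <= 1 by rewrite ge_min lexx orbT.
rewrite (le_trans (step s s0 s1)) // lerD2l.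
apply: (@le_trans _ _ (e / (`|B| + 1) * (`|B| + 1))); last by rewrite divfK ?gt_eqF.
by rewrite ler_pM ?(ltW s0) ?ge_min ?lexx // lerDl.
Qed.

Local Notation Fn n w := (emp_risk f (fun i => Zs i w) n).

Lemma grad_emp_coord n w i :
  grad (Fn n w) c ord0 i = n%:R^-1 * \sum_(k < n) grad_entry i (Zs k w).
Proof.
by rewrite grad_emp_risk // [LHS]mxE summxE.
Qed.

Lemma whp_grad_small (e : R) : (forall x, mean c <= mean x) -> 0 < e ->
  whp P (fun n w => enorm (grad (Fn n w) c) <= e).
Proof.
move=> cmin e0.
have e1 : 0 < e / (d%:R + 1) by rewrite divr_gt0 // ltr_pwDr.
have := whp_all (fun i => lln Ziid (meas_grad_entry i) (intg_grad_entry i) e1).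
move=> /whp_sub; apply; near=> n => w H.
rewrite (le_trans (enorm_le_sum _)) //.
apply: (@le_trans _ _ (\sum_(i < d) e / (d%:R + 1))).
  apply: ler_sum => i _; rewrite grad_emp_coord.
  by have := H i; rewrite (mean_grad_eq0 i cmin) subr0.
rewrite sumr_const card_ord -[X in X <= _]mulr_natl mulrCA ler_piMr ?(ltW e0) //.
by rewrite ler_pdivrMr ?mul1r ?lerDl // ltr_pwDr.
Unshelve. all: by end_near. Qed.

(** The order - alpha / (1 + alpha) is 1 / p - 1 for p = 1 + alpha: an average of
    n copies with a moment of order p is of the order of n^(1/p) / n. *)
Lemma grad_rate (e : R) : (forall x, mean c <= mean x) -> 0 < e ->
  exists2 M : R, 0 <= M & forall n, (0 < n)%N -> exists A : set T,
  [/\ measurable A, pr P A <= e & forall w, ~ A w ->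
    enorm (grad (Fn n w) c) <= M * n%:R `^ (- (alpha / (1 + alpha)))].
Proof.
move=> cmin e0; have [a0 a1] := andP alpha_itv.
pose p := 1 + alpha; have p0 : 0 < p by rewrite addr_gt0.
have p12 : 1 <= p <= 2 by rewrite /p; lra.
pose mp i := Ex (fun w => `|grad_entry i (Z w)| `^ p).
pose ms := \sum_(i < d) mp i.
have mp0 i : 0 <= mp i by apply: Ex_ge0 => w; exact: powR_ge0.
have mps i : mp i <= ms by rewrite /ms (bigD1 i) //= lerDl sumr_ge0.
have ms0 : 0 <= ms by apply: sumr_ge0.
have d0 : 0 < d%:R + 1 :> R by rewrite ltr_pwDr.
(* The level M of [copies_moment_bound], with M ^ p = K, large enough for its
   hypothesis (the term ms) and for a bound e / (d + 1) in each coordinate. *)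
pose K := 2 * ms * (d%:R + 1) / e + ms + 1.
have Ke : 0 <= 2 * ms * (d%:R + 1) / e.
  by rewrite divr_ge0 ?(ltW e0) // mulr_ge0 ?mulr_ge0 // ltW.
have K0 : 0 < K by rewrite ltr_pwDr // addr_ge0.
pose M := K `^ p^-1; have M0 : 0 < M by rewrite powR_gt0.
have MpE : M `^ p = K by rewrite -powRrM mulVf ?gt_eqF // powRr1 // ltW.
exists (d%:R * (2 * M)); first by rewrite mulr_ge0 // mulr_ge0 // ltW.
move=> n n0; have n0R : 0 < n%:R :> R by rewrite ltr0n.
pose A i := [set w | 2 * (M * n%:R `^ p^-1) <= `|\sum_(k < n) grad_entry i (Zs k w)|].
have mA i : measurable (A i).
  apply/measurable_ge_set/measurable_abs; apply: measurable_sum => k.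
  by apply: (meas_copy Zs); exact: meas_grad_entry.
exists (\big[setU/set0]_(i < d) A i); split; first exact: bigsetU_measurable.
  apply: (le_trans (pr_bigU P _ mA)).
  apply: (@le_trans _ _ (\sum_(i < d) e / (d%:R + 1))).
    apply: ler_sum => i _.
    have mpM : mp i <= M `^ p.
      by rewrite MpE (le_trans (mps i)) // /K -addrA ler_wpDl // lerDl.
    apply: (le_trans (copies_moment_bound Ziid (meas_grad_entry i) (intg_grad_entry i)
      (mean_grad_eq0 i cmin) p12 (intg_grad_entry_pow i) M0 n0 mpM)).
    rewrite MpE mulrA ler_pdivrMr // mulrAC ler_pdivlMr //.
    apply: (@le_trans _ _ (2 * ms * (d%:R + 1))).
      by rewrite ler_wpM2r ?(ltW d0) // ler_wpM2l //; exact: mps.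
    rewrite -ler_pdivrMl // mulrC /K -addrA lerDl addr_ge0 //.
  rewrite sumr_const card_ord -[X in X <= _]mulr_natl mulrCA ler_piMr ?(ltW e0) //.
  by rewrite ler_pdivrMr // mul1r lerDl.
move=> w nA; rewrite (le_trans (enorm_le_sum _)) //.
rewrite -mulrA mulr_natl -[d in _ *+ d]card_ord -sumr_const; apply: ler_sum => i _.
rewrite grad_emp_coord normrM ger0_norm ?invr_ge0 // ler_pdivrMl //.
have : ~ A i w by move=> Aw; apply: nA; rewrite -bigcup_seq; exists i => //=; exact: mem_index_enum.
move=> /negP; rewrite -ltNge => /ltW H; rewrite (le_trans H) //.
rewrite (_ : - (alpha / (1 + alpha)) = p^-1 - 1); last first.
  by rewrite /p; field; rewrite gt_eqF.
rewrite powRD ?(gt_eqF n0R) ?implybT // powRN powRr1 //.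
rewrite le_eqVlt; apply/orP; left; apply/eqP; field.
by rewrite gt_eqF.
Qed.


Definition emp_hess_entry i j x n w : R := n%:R^-1 * \sum_(k < n) hess_entry i j x (Zs k w).

Lemma emp_hessE n w x u : emp_hess f (fun i => Zs i w) n x u =
  dot (u *m \matrix_(i, j) emp_hess_entry i j x n w) u.
Proof.
rewrite /emp_hess /dot (eq_bigr _ (fun k _ => hess_formE _ _ _)).
rewrite exchange_big mulr_sumr; apply: eq_bigr => j _ /=.
rewrite exchange_big mulr_sumr mxE mulr_suml; apply: eq_bigr => i _ /=.
rewrite mxE /emp_hess_entry -mulr_sumr; ring.
Qed.

Lemma mean_hessE x u :
  mean_hess x u = dot (u *m \matrix_(i, j) Ex (fun w => hess_entry i j x (Z w))) u.
Proof.
have ih i j : intg (fun w => u ord0 i * u ord0 j * hess_entry i j x (Z w)).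
  by apply: intgZ; exact: intg_hess_entry.
rewrite /mean_hess (_ : Ex _ = Ex (fun w =>
    \sum_(j < d) \sum_(i < d) u ord0 i * u ord0 j * hess_entry i j x (Z w))); last first.
  by apply: eq_Rintegral => w _; exact: hess_formE.
rewrite Ex_sum; last by move=> j; exact: intg_sum.
rewrite /dot; apply: eq_bigr => j _; rewrite Ex_sum // mxE mulr_suml.
apply: eq_bigr => i _; rewrite mxE ExZ; last exact: intg_hess_entry.
by rewrite mulrAC.
Qed.

Lemma copies_in (G : set E) : measurable G -> P (Z @^-1` (~` G)) = 0%E ->
  {ae P, forall w, forall k, G (Zs k w)}.
Proof.
move=> mG G0; apply: ae_foralln => k; exists (Zs k @^-1` (~` G)); split => //.
- by rewrite -[X in measurable X]setTI; apply: measurable_funP => //; exact: measurableC.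
- by case: Ziid => _ H; exact: etrans (H k _ (measurableC mG)) G0.
Qed.

(** Pointwise convergence of the empirical Hessian on a finite net extends to
    the whole ball by the integrable Lipschitz bound, so that the empirical
    Hessian inherits positive definiteness from the mean Hessian. *)
Lemma whp_curved r : locally_strongly_convex mean -> 0 <= r -> exists m L : R,
  [/\ 0 < m, 0 <= L & whp P (fun n w => curved c r m L (Fn n w))].
Proof.
move=> conv r0; have [m m0 Hm] := mean_hess_ge r conv.
have [M [G [mM M0 iM [mG G0] HG]]] := hess_lipschitz r.
pose EM := Ex (fun w => M (Z w)); have EM0 : 0 <= EM by apply: Ex_ge0.
have EM1 : 0 < EM + 1 by rewrite ltr_wpDl.
(* At scale rho the Lipschitz bound moves an entry by eta, which is also the
   precision required at the points of the net; together they perturb the form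
   by at most d ^ 2 (2 eta) |u| ^ 2 <= m / 2 |u| ^ 2. *)
pose D := d%:R ^+ 2 + 1 : R; have D0 : 0 < D by rewrite ltr_wpDl ?sqr_ge0.
pose eta := m / (4 * D); have eta0 : 0 < eta by rewrite divr_gt0 // mulr_gt0.
pose rho := eta / (EM + 1); have rho0 : 0 < rho by rewrite divr_gt0.
have [S [Sr Snet]] := eball_net c r rho0.
pose b := \sum_(ij : 'I_d * 'I_d) Ex (fun w => `|hess_entry ij.1 ij.2 c (Z w)|).
have b0 : 0 <= b by apply: sumr_ge0 => ij _; apply: Ex_ge0.
pose L := d%:R ^+ 2 * (b + 1 + (EM + 1) * r).
have L0 : 0 <= L.
  by rewrite mulr_ge0 ?sqr_ge0 // !addr_ge0 // mulr_ge0 // ltW.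
exists (m / 2), L; split => //; first by rewrite divr_gt0.
have W1 := whp_ae (copies_in mG G0).
have W2 := lln_le Ziid mM iM ltr01.
have W3 : whp P (fun n w => forall p, p \in S -> forall ij : 'I_d * 'I_d,
    `|emp_hess_entry ij.1 ij.2 p n w - Ex (fun w => hess_entry ij.1 ij.2 p (Z w))| <= eta).
  apply: whp_all_seq => p pS; apply: whp_all => ij.
  exact: (lln Ziid (meas_hess_entry _ _ p) (intg_hess_entry _ _ p) eta0).
have W4 : whp P (fun n w => forall ij : 'I_d * 'I_d,
    n%:R^-1 * \sum_(k < n) `|hess_entry ij.1 ij.2 c (Zs k w)|
      <= Ex (fun w => `|hess_entry ij.1 ij.2 c (Z w)|) + 1).
  apply: whp_all => ij; apply: (lln_le (g := fun z => `|hess_entry ij.1 ij.2 c z|) Ziid _ _ ltr01).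
    by apply: measurable_abs; exact: meas_hess_entry.
  exact: intg_norm (intg_hess_entry _ _ _).
apply: whp_sub (whp_and (whp_and W1 W2) (whp_and W3 W4)) _; near=> n.
move=> w [[Gw Mw] [Hnet Hc]]; apply: curved_emp_risk => //; first exact: ddf.
have lip x y i j : enorm (x - c) <= r -> enorm (y - c) <= r ->
    `|emp_hess_entry i j x n w - emp_hess_entry i j y n w| <= (EM + 1) * enorm (x - y).
  move=> xr yr; rewrite -mulrBr -sumrB normrM ger0_norm ?invr_ge0 //.
  apply: (@le_trans _ _ (n%:R^-1 * \sum_(k < n) M (Zs k w) * enorm (x - y))).
    rewrite ler_wpM2l ?invr_ge0 // (le_trans (ler_norm_sum _ _ _)) //.
    by apply: ler_sum => k _; exact: HG.
  by rewrite -mulr_suml mulrA ler_wpM2r ?enorm_ge0.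
move=> x u xr; rewrite emp_hessE; apply/andP; split; last first.
  apply: (le_trans (ler_norm _)); apply: quadratic_form_le => i j; rewrite mxE.
  have cr : enorm (c - c) <= r by rewrite subrr enorm0.
  rewrite -[X in `|X|](subrK (emp_hess_entry i j c n w)) addrC (le_trans (ler_normD _ _)) //.
  apply: lerD.
    apply: le_trans (_ : Ex (fun w => `|hess_entry i j c (Z w)|) + 1 <= _).
      apply: le_trans (Hc (i, j)); rewrite normrM ger0_norm ?invr_ge0 //.
      by rewrite ler_wpM2l ?invr_ge0 // ler_norm_sum.
    rewrite lerD2r /b (bigD1 (i, j)) //= lerDl.
    by apply: sumr_ge0 => ij _; apply: Ex_ge0.
  by rewrite (le_trans (lip _ _ _ _ xr cr)) // ler_wpM2l // ltW.
have [p pS xp] := Snet x xr; have pr' := Sr p pS.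
have close : `|dot (u *m \matrix_(i, j) emp_hess_entry i j x n w) u - mean_hess p u|
    <= d%:R ^+ 2 * (m / (2 * D)) * enorm u ^+ 2.
  rewrite mean_hessE -dotNl -dotDl -mulmxBr; apply: quadratic_form_le => i j.
  rewrite !mxE -(subrKA (emp_hess_entry i j p n w)) (le_trans (ler_normD _ _)) //.
  rewrite (_ : m / (2 * D) = eta + eta); last by rewrite /eta; field; rewrite gt_eqF.
  apply: lerD; last exact: (Hnet p pS (i, j)).
  rewrite (le_trans (lip _ _ _ _ xr pr')) //.
  by rewrite (le_trans (ler_wpM2l (ltW EM1) xp)) // /rho mulrC divfK // gt_eqF.
move: close; rewrite ler_distl => /andP[+ _]; apply: le_trans.
rewrite lerBrDl; apply: le_trans (Hm p u pr').
rewrite -mulrDl ler_wpM2r ?sqr_ge0 // -lerBrDr (_ : m - m / 2 = m / 2); last by field.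
rewrite mulrCA ler_pM2l // ler_pdivrMr ?mulr_gt0 // mulrA mulVf // mul1r.
by rewrite /D lerDl.
Unshelve. all: by end_near. Qed.

End smooth_model.


(** * Consistency and rate *)

Lemma exprn_le_near0 (R : realType) (beta a : R) : 0 < beta < 1 -> 0 < a ->
  exists K, beta ^+ K <= a.
Proof.
move=> /andP[b0 b1] a0; have b1' : `|beta| < 1 by rewrite gtr0_norm.
have /cvgr0Pnorm_le/(_ a a0)[K _ HK] := cvg_expr b1'.
by exists K; rewrite (le_trans (ler_norm _)) //; exact: (HK K (leqnn K)).
Qed.

Lemma limn_esup_le_near (R : realType) (u : nat -> \bar R) (l : \bar R) :
  (\forall n \near \oo, (u n <= l)%E) -> (limn_esup u <= l)%E.
Proof.
move=> ul; apply: (@le_trans _ _ (ereal_sup (u @` [set n | (u n <= l)%E]))).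
  by apply: ereal_inf_lbound; exists [set n | (u n <= l)%E].
by apply: ge_ereal_sup => _ [n ? <-].
Qed.

Section multistage.
Context {R : realType} {disp disp' : measure_display} {T : measurableType disp}
  {E : measurableType disp'}.
Variable P : probability T R.
Variables (Z : {RV P >-> E}) (Zs : nat -> {RV P >-> E}).
Hypothesis Ziid : iid_copies P Z (fun i => Zs i : T -> E).
Variables (d : nat) (f : 'rV[R]_d -> E -> R) (c : 'rV[R]_d).
Hypothesis mf : jointly_measurable f.
Hypothesis df : forall z x, differentiable (f^~ z) x.
Hypothesis F_fin : forall x, intg P (fun w => f x (Z w)).
Hypothesis c_min : forall x, mean Z f c <= mean Z f x.
Hypothesis convex : locally_strongly_convex (mean Z f).
Variables (Cgrad Ceval : nat) (alpha' kappa tau beta delta : R).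
Variables (x0 : 'rV[R]_d) (J : nat).
Hypothesis (Ceval_gt0 : (0 < Ceval)%N) (J_gt0 : (0 < J)%N).
Hypotheses (kappa_gt0 : 0 < kappa) (tau_gt0 : 0 < tau).
Hypotheses (alpha'_itv : 0 < alpha' <= 1) (beta_itv : 0 < beta < 1).
Hypothesis delta_itv : 0 < delta < 1.

Local Notation Fn n w := (emp_risk f (fun i => Zs i w) n).
Local Notation size B j := (stage_size kappa delta B j).
Local Notation tol B j := (stage_tolerance tau alpha' delta B j).

Definition output B w : 'rV[R]_d :=
  multi Cgrad Ceval (emp_risk f (fun i => Zs i w)) x0 B alpha' delta J kappa tau beta.

Lemma emp_risk_random n : random_objective (fun w => Fn n w).
Proof.
split=> x mx.
  apply: measurable_funM => //; apply: measurable_sum => i.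
  by apply: mf => //; exact: measurable_funP.
under eq_fun do rewrite grad_emp_risk //.
apply: mvecZ => //; apply: mvecP => j; under eq_fun do rewrite summxE.
apply: measurable_sum => i; apply: mvec_coord; exact: mvec_grad.
Qed.

Lemma mvec_output B : mvec (output B).
Proof. exact: (measurable_multi _ _ _ _ _ _ _ _ _ _ emp_risk_random). Qed.

Section smooth_case.
Variable alpha : R.
Hypothesis alpha_itv : 0 < alpha <= 1.
Hypothesis smooth : smooth_moments P f Z c alpha.

(** The radii are chosen in an order that avoids circularity: the curvature on
    the ball containing the starting point determines the size R0 of the
    sublevel sets, the gradient on the ball of radius R0 determines how far a
    trial step may reach, and only then are the constants of the final ball
    fixed. *)
Lemma output_error : exists2 m : R, 0 < m &
  whp P (fun B w => m * enorm (output B w - c) <=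
    tol B J + enorm (grad (Fn (size B J) w) c)).
Proof.
pose r := Num.max 1 (enorm (x0 - c)).
have r1 : 1 <= r by rewrite le_max lexx.
have r0 : 0 <= r by rewrite (le_trans ler01).
have x0r : enorm (x0 - c) <= r by rewrite le_max lexx orbT.
have curv s := whp_curved Ziid mf df F_fin smooth (r := s) convex.
have [m1 [L1 [m10 L10 W1]]] := curv r r0.
pose R0 := Num.max r ((m1 / 4 * r + L1 / 2 * r ^+ 2) / (m1 / 4)).
have R0r : r <= R0 by rewrite le_max lexx.
have R00 : 0 <= R0 by rewrite (le_trans r0).
have m14 : 0 < m1 / 4 by rewrite divr_gt0.
have R01 : 0 <= R0 + 1 by rewrite addr_ge0.
have [m0 [L0 [m00 L00 W0]]] := curv (R0 + 1) R01.
pose gb e := grad_bound R0 L0 e.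
pose rr := R0 + gb (m1 / 4).
have gb0 e : 0 <= e -> 0 <= gb e.
  move=> e0; rewrite /gb /grad_bound !addr_ge0 ?mulr_ge0 ?sqr_ge0 ?invr_ge0 //.
  by rewrite addr_ge0 ?mulr_ge0.
have rr0 : 0 <= rr by rewrite addr_ge0 // gb0 // ltW.
have [m [L [mp Lp W]]] := curv rr rr0.
pose eps := Num.min (m1 / 4) (m / 2).
have eps0 : 0 < eps by rewrite lt_min m14 divr_gt0.
have eps1 : eps <= m1 / 4 by rewrite ge_min lexx.
have eps2 : eps <= m / 2 by rewrite ge_min lexx orbT.
have growth : eps * r + L1 / 2 * r ^+ 2 <= m1 / 4 * R0.
  rewrite -ler_pdivrMl // mulrC le_max; apply/orP; right.
  by rewrite ler_wpM2r ?invr_ge0 ?(ltW m14) // lerD2r ler_wpM2r.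
have r1_ge : R0 + grad_bound R0 L0 eps <= rr.
  rewrite lerD2l /gb /grad_bound !lerD2r ler_wpM2r //.
  by rewrite addr_ge0 // mulr_ge0.
have Lm0 : 0 < L + m by rewrite ltr_wpDl.
have Lmi0 : 0 < (L + m)^-1 by rewrite invr_gt0.
have [K HK] := exprn_le_near0 beta_itv Lmi0.
have {}HK : beta ^+ K * (L + m) <= 1.
  by rewrite (le_trans (ler_wpM2r (ltW Lm0) HK)) // mulVf ?gt_eqF.
have bK0 : 0 < beta ^+ K by rewrite exprn_gt0 //; case/andP: beta_itv.
have bL : beta ^+ K * L <= 1.
  by apply: le_trans HK; rewrite ler_wpM2l ?(ltW bK0) // lerDl ltW.
have mK : m * beta ^+ K <= 1.
  by rewrite mulrC; apply: le_trans HK; rewrite ler_wpM2l ?(ltW bK0) // lerDr.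
exists m => //.
have Wg := whp_grad_small Ziid mf df F_fin alpha_itv smooth c_min eps0.
have Wgood := whp_and (whp_and W1 W0) (whp_and W Wg).
have Wstage : whp P (fun B w => forall j : 'I_J,
    good_sample c r R0 rr m1 L1 m0 L0 m L eps (Fn (size B j.+1) w)).
  apply: whp_all => j.
  have := whp_comp Wgood (fun N => stage_size_near kappa_gt0 delta_itv N (ltn0Sn j)).
  by move=> /whp_sub; apply; near=> B => w [[a1 a2] [a3 a4]].
apply: whp_sub Wstage _.
have G0 : 0 <= grad_bound R0 L0 eps ^+ 2 / (2 * m).
  by rewrite divr_ge0 ?sqr_ge0 // mulr_ge0 // ltW.
have a01 : 0 < m * beta ^+ K <= 1 by rewrite mulr_gt0.
have bK20 : 0 < beta ^+ K / 2 by rewrite divr_gt0.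
have budget := enough_budget kappa_gt0 tau_gt0 alpha'_itv delta_itv J (Cgrad + Ceval)
  (pass_cost Cgrad Ceval K) a01 G0 bK20.
have m20 : 0 < m / 2 by rewrite divr_gt0.
have tols := stage_tolerance_le tau_gt0 alpha'_itv delta_itv m20.
near=> B => w good.
have B0 : (0 < B)%N by near: B; exact: nbhs_infty_gt.
have [N [V [V0 JV HV]]] : exists N V : nat, [/\ (0 < V)%N, (J * V <= B)%N &
   forall j, (1 <= j <= J)%N ->
    grad_bound R0 L0 eps ^+ 2 / (2 * m) * (1 - m * beta ^+ K) ^+ N <
      beta ^+ K / 2 * tol B j ^+ 2 /\
    (size B j * (Cgrad + Ceval + pass_cost Cgrad Ceval K * N.+1) <= V)%N].
  by near: B.
have tolB : forall j, (0 < j)%N -> 0 <= tol B j <= m / 2 by near: B.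
have := good_multi (Cgrad := Cgrad) (x0 := x0) (B := B) (alpha' := alpha') (delta := delta) (kappa := kappa)
  (tau := tau) (N := N) (F := emp_risk f (fun i => Zs i w)) beta_itv r1 R0r growth r1_ge m10
  (ltW m00) mp L10 L00 eps1 eps2 bL mK Ceval_gt0 x0r V0 JV.
rewrite /output /multi; case: multi_state => y b /= H.
case: H => [j jJ|_ _]; last exact.
have [j1 jJ'] := andP jJ; have [h1 h2] := HV j jJ.
have jJ1 : (j.-1 < J)%N by rewrite prednK.
split => //.
- by have := good (Ordinal jJ1); rewrite /= prednK.
- exact: stage_size_gt0.
- exact: tolB.
Unshelve. all: by end_near. Qed.

Lemma output_consistent (e : R) : 0 < e -> whp P (fun B w => enorm (output B w - c) <= e).
Proof.
move=> e0; have [m m0 W] := output_error.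
have e1 : 0 < m * (e / 2) by rewrite mulr_gt0 // divr_gt0.
have Wg := whp_comp (whp_grad_small Ziid mf df F_fin alpha_itv smooth c_min e1)
  (fun N => stage_size_near kappa_gt0 delta_itv N J_gt0).
have tols := stage_tolerance_le tau_gt0 alpha'_itv delta_itv e1.
apply: whp_sub (whp_and W Wg) _; near=> B => w [h1 h2].
have tolB : forall j, (0 < j)%N -> 0 <= tol B j <= m * (e / 2) by near: B.
have /andP[_ t1] := tolB J J_gt0.
by rewrite -(ler_pM2l m0) (le_trans h1) // (splitr e) mulrDr lerD.
Unshelve. all: by end_near. Qed.

End smooth_case.

Lemma output_oP1 alpha : 0 < alpha <= 1 -> smooth_moments P f Z c alpha ->
  is_oP1 P (fun B w => enorm (output B w - c)).
Proof.
move=> alpha_itv smooth e e0.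
have e20 : 0 < e / 2 by rewrite divr_gt0.
have [A [mA A0 HA]] := output_consistent alpha_itv smooth e20.
have mS B : measurable [set w | e <= `|enorm (output B w - c)|].
  apply/measurable_ge_set/measurable_abs/measurable_enorm/mvecB; last exact: mvec_cst.
  exact: mvec_output.
have S0 : pr P [set w | e <= `|enorm (output B w - c)|] @[B --> \oo] --> (0 : R).
  apply: (@squeeze_cvgr _ _ _ _ (fun=> 0) (fun B => pr P (A B))) => //; last exact: cvg_cst.
  apply: filterS HA => B HA; rewrite pr_ge0 /= pr_le // => w /=.
  rewrite ger0_norm ?enorm_ge0 // => ew; apply: contrapT => nA.
  have := HA w nA; rewrite leNgt => /negP; apply; apply: lt_le_trans ew.
  by rewrite ltr_pdivrMr // ltr_pMr // ltr1n.
apply/fine_cvgP; split => //.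
by near=> B; rewrite fin_num_measure.
Unshelve. all: by end_near. Qed.

(** The sample of the last stage has at least kappa B ^ (1 - delta ^ J)
    observations, so that both terms of [output_error] are of the order of
    B ^ (- alpha' / (1 + alpha') (1 - delta ^ J)). *)
Lemma output_OP : smooth_moments P f Z c alpha' ->
  is_OP P (fun B w => enorm (output B w - c))
    (fun B => B%:R `^ (- (alpha' / (1 + alpha')) * (1 - delta ^+ J))).
Proof.
move=> smooth e /andP[e0 _].
have [m m0 [A [mA A0 HA]]] := output_error alpha'_itv smooth.
have e20 : 0 < e / 2 by rewrite divr_gt0.
have [M M0 HM] := grad_rate Ziid mf df F_fin alpha'_itv smooth c_min e20.
set rho := alpha' / (1 + alpha') in HM *.
have rho0 : 0 < rho by exact: rate_gt0.
pose a (B : nat) : R := B%:R `^ (- rho * (1 - delta ^+ J)).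
exists ((tau + M * kappa `^ (- rho)) / m + 1).
apply: limn_esup_le_near.
have Ae : \forall B \near \oo, pr P (A B) <= e / 2.
  move/cvgr0Pnorm_le: A0 => /(_ _ e20); apply: filterS => B.
  by apply: le_trans; exact: ler_norm.
near=> B.
have B0 : (0 < B)%N by near: B; exact: nbhs_infty_gt.
have B0R : 0 < B%:R :> R by rewrite ltr0n.
have aB0 : 0 < a B by rewrite powR_gt0.
have n0 : (0 < size B J)%N by exact: stage_size_gt0.
have [A' [mA' A'e HA']] := HM _ n0.
have AB : forall w, ~ A B w -> m * enorm (output B w - c) <=
    tol B J + enorm (grad (Fn (size B J) w) c) by near: B.
set S := [set w | _].
have mS : measurable S.
  apply/measurable_ge_set/measurable_abs/measurable_funM => //.
  by apply/measurable_enorm/mvecB; [exact: mvec_output|exact: mvec_cst].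
have SA : S `<=` A B `|` A'.
  move=> w; rewrite /S /= => Sw; apply: contrapT => /not_orP[nA nA'].
  have h1 := AB w nA; have h2 := HA' w nA'.
  have nle : (size B J)%:R `^ (- rho) <= kappa `^ (- rho) * a B.
    have kB0 : 0 < kappa * B%:R `^ stage_exponent delta J by rewrite mulr_gt0 ?powR_gt0.
    rewrite (_ : kappa `^ (- rho) * a B =
        (kappa * B%:R `^ stage_exponent delta J) `^ (- rho)); last first.
      by rewrite powRM ?powR_ge0 ?(ltW kappa_gt0) // -powRrM [_ * - rho]mulrC.
    rewrite !powRN lef_pV2 ?posrE ?powR_gt0 ?ltr0n //.
    by rewrite ge0_ler_powR ?nnegrE ?(ltW rho0) ?(ltW kB0) // stage_size_ge.
  have tE : tol B J = tau * a B by [].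
  have h3 : enorm (output B w - c) <= (tau + M * kappa `^ (- rho)) / m * a B.
    rewrite -(ler_pM2l m0) (le_trans h1) // (_ : m * _ = (tau + M * kappa `^ (- rho)) * a B).
      rewrite tE mulrDl lerD2l (le_trans h2) // -mulrA ler_wpM2l //.
    by field; rewrite gt_eqF.
  move: Sw; rewrite ger0_norm ?divr_ge0 ?enorm_ge0 ?(ltW aB0) // ler_pdivlMr //.
  by rewrite leNgt => /negP; apply; rewrite (le_lt_trans h3) // ltr_pM2r // ltrDl.
rewrite prE // lee_fin (le_trans (pr_le P mS (measurableU _ _ (mA B) mA') SA)) //.
rewrite (le_trans (pr_setU P (mA B) mA')) // (splitr e) lerD //.
by near: B.
Unshelve. all: by end_near. Qed.

End multistage.

Theorem theorem2 (R : realType) (disp : measure_display)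
  (T : measurableType disp) (P : probability T R)
  (Pcomplete : measure_is_complete P)
  (X : ptopologicalType) (Xpolish : polish R X)
  (Z : {RV P >-> borel X}) (Zs : nat -> {RV P >-> borel X})
  (Ziid : iid_copies P Z (fun i => Zs i : T -> borel X))
  (d : nat) (d_ge1 : (1 <= d)%N)
  (f : 'rV[R]_d -> borel X -> R)
  (f_meas : measurable_fun [set: borel 'rV[R]_d * borel X]
              (fun u : borel 'rV[R]_d * borel X => f u.1 u.2))
  (f_diff : forall (z : borel X) (x : 'rV[R]_d), differentiable (f^~ z) x)
  (F_fin : forall x : 'rV[R]_d,
     P.-integrable setT (fun w : T => (f x (Z w))%:E))
  (F_convex : strictly_convex (risk P f Z))
  (xstar : 'rV[R]_d)
  (xstar_min : forall x : 'rV[R]_d, risk P f Z xstar <= risk P f Z x)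
  (Cgrad Ceval : nat) (Cgrad_ge1 : (1 <= Cgrad)%N) (Ceval_ge1 : (1 <= Ceval)%N)
  (assumption1 : locally_strongly_convex (risk P f Z))
  (assumption2 : exists2 alpha : R, 0 < alpha <= 1 &
     smooth_moments P f Z xstar alpha)
  (alpha' : R) (alpha'_itv : 0 < alpha' <= 1)
  (x0 : 'rV[R]_d) (J : nat) (J_ge1 : (1 <= J)%N)
  (kappa tau : R) (kappa_gt0 : 0 < kappa) (tau_gt0 : 0 < tau)
  (beta : R) (beta_itv : 0 < beta < 1)
  (delta : R) (delta_itv : 2 * alpha' / (1 + 3 * alpha') < delta < 1) :
  let thetahat (B : nat) (w : T) : 'rV[R]_d :=
    multi Cgrad Ceval (emp_risk f (fun i => Zs i w)) x0 B
      alpha' delta J kappa tau beta in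
  let err (B : nat) (w : T) : R := enorm (thetahat B w - xstar) in
  is_oP1 P err /\
  (smooth_moments P f Z xstar alpha' ->
   is_OP P err
     (fun B : nat => B%:R `^ (- (alpha' / (1 + alpha')) * (1 - delta ^+ J)))).
Proof.
move=> thetahat err.
have jf : jointly_measurable f.
  move=> disp' U x z mx mz.
  exact: (measurableT_comp f_meas (measurable_fun_pair mx mz)).
have riskE : risk P f Z = mean Z f.
  by apply/funext => x; rewrite /risk expectationE.
have d01 : 0 < delta < 1.
  have [dl ->] := andP delta_itv; rewrite andbT; apply: lt_trans dl.
  by case/andP: alpha'_itv => a0 _; rewrite divr_gt0 ?mulr_gt0 // addr_gt0 ?mulr_gt0.
rewrite riskE in xstar_min assumption1.
split.
  have [alpha a01 smooth] := assumption2.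
  exact: (output_oP1 Ziid jf f_diff F_fin xstar_min assumption1 _ x0 Ceval_ge1 J_ge1
    kappa_gt0 tau_gt0 alpha'_itv beta_itv d01 a01 smooth).
exact: (output_OP Ziid jf f_diff F_fin xstar_min assumption1 _ x0 Ceval_ge1 J_ge1
  kappa_gt0 tau_gt0 alpha'_itv beta_itv d01).
Qed.
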